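(* If $\mu$ is an atomless Borel probability measure on $\mathbb{S}^1$ and $v\in L^2(\mu)$, then for all but a countable number of values of $t\in[0,1]$, the measure $\mu+tv=(\mathrm{Id}+tv)_\#\mu$ has no atom. In particular, let $\Phi:\mathbb{S}^1\to\mathbb{S}^1$ be a $C^2$ expanding circle map with absolutely continuous invariant probability measure $\rho\lambda$, and let $n$ be a positive integer. Then there exists a bi-Lipschitz embedding $F:B^n\to(\mathscr{P}(\mathbb{S}^1),\mathrm{W})$ with $F(0)=\rho\lambda$, with $\mathrm{W}(\Phi_\#(F(a)),F(a))=o(|a|)$ as $a\to0$, and with the property that for all $\varepsilon>0$ and all integers $K$ there is $r>0$ such that $\mathrm{W}(\Phi_\#^k(F(a)),F(a))\leqslant\varepsilon|a|$ for all $k\leqslant K$ and all $a\in B^n(0,r)$, which can moreover be chosen such that for almost all $a\in B^n$ the measure $F(a)$ has no atom.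
   Context: $\mathbb{S}^1=\mathbb{R}/\mathbb{Z}$, $\lambda$ is the Lebesgue probability measure, $\mathscr{P}(\mathbb{S}^1)$ is the set of Borel probability measures on $\mathbb{S}^1$, $\Phi_\#$ is push-forward of measures and $\Phi_\#^k$ its $k$-th iterate ($k$ a nonnegative integer). Functions $v:\mathbb{S}^1\to\mathbb{R}$ are viewed as vector fields, and $\mathrm{Id}+tv$ is the map $x\mapsto x+tv(x)\bmod1$. A $C^2$ map $\Phi:\mathbb{S}^1\to\mathbb{S}^1$ is expanding if $|\Phi'|>1$ everywhere; such a map has a unique absolutely continuous invariant probability measure $\rho\lambda$, whose density $\rho$ is positive and $C^1$ (known facts). $\mathrm{W}$ is the quadratic Wasserstein metric: $\mathrm{W}(\mu,\nu)=\left(\inf_\Pi\int|x-y|^2\,\Pi(dx\,dy)\right)^{1/2}$, infimum over probability measures $\Pi$ on $\mathbb{S}^1\times\mathbb{S}^1$ with marginals $\mu,\nu$. $B^n$ is the unit Euclidean ball of $\mathbb{R}^n$ centered at $0$, $B^n(0,r)$ the ball of radius $r$ centered at $0$; ''almost all $a$'' is with respect to Lebesgue measure on $B^n$. *)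

(* Defs.v *)
From HB Require Import structures.
From mathcomp Require Import all_boot all_order all_algebra.
From mathcomp Require Import all_classical all_reals all_analysis.
From mathcomp Require Import ring_quotient generic_quotient measurable_realfun.

Set Implicit Arguments.
Unset Strict Implicit.
Unset Printing Implicit Defensive.

Import Order.TTheory GRing.Theory Num.Theory.
Import numFieldNormedType.Exports.

Local Open Scope classical_set_scope.
Local Open Scope ring_scope.
Local Open Scope quotient_scope.

Section circle.
Variable R : realType.

Definition int_subgroup : zmodClosed R :=
  GRing.ZmodClosed.clone R (@Num.int_num_subdef R) _.

(* R / Z: quotient group, quotient topology, Borel sigma-algebra. *)
Definition circle : Type := quotient_topology (Quotient.quot int_subgroup).

HB.instance Definition _ := Topological.on circle.
HB.instance Definition _ := Pointed.on circle.
HB.instance Definition _ := Quotient.on circle.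
HB.instance Definition _ :=
  GRing.Zmodule.copy circle (Quotient.quot int_subgroup).
HB.instance Definition _ :=
  @isMeasurable.Build (sigma_display (@open circle)) circle <<s @open circle >>
    (@sigma_algebra0 _ setT open) (@sigma_algebraC _ open)
    (@sigma_algebra_bigcup _ setT open).

Definition circle_pi (x : R) : circle := \pi_circle x.

Lemma circle_piD (x y : R) : circle_pi (x + y) = circle_pi x + circle_pi y.
Proof. exact: (@Quotient.pi_add R int_subgroup). Qed.

Lemma circle_pi_eqP (x y : R) :
  circle_pi x = circle_pi y <-> x - y \is a Num.int.
Proof.
have e : (x - y \is a Num.int) = (x == y %[mod Quotient.quot int_subgroup]).
  exact: (Quotient.idealrBE int_subgroup).
by rewrite e; split=> [h|/eqP//]; apply/eqP.
Qed.

Lemma measurable_circle_pi : measurable_fun [set: R] circle_pi.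
Proof.
apply: (measurability (@open circle)) => //= _ [A oA <-].
by rewrite setTI; exact: open_measurable.
Qed.

HB.instance Definition _ :=
  @isMeasurableFun.Build _ _ _ _ circle_pi measurable_circle_pi.

(* Quotient distance on R / Z, i.e. the |x - y| of the transport cost. *)
Definition circle_dist (x y : circle) : R :=
  inf [set `|t| | t in [set t : R | circle_pi t = x - y]].

Definition circle_lebesgue (A : set circle) : \bar R :=
  lebesgue_measure (`[0, 1[ `&` circle_pi @^-1` A).

Let restr_lebesgue := mrestr (@lebesgue_measure R) (measurable_itv `[0%R, 1%R[).

Let circle_lebesgueE :
  circle_lebesgue = pushforward restr_lebesgue circle_pi.
Proof. by apply/funext => A; rewrite /circle_lebesgue setIC. Qed.

Let circle_lebesgue0 : circle_lebesgue set0 = 0%E.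
Proof. by rewrite /circle_lebesgue preimage_set0 setI0 measure0. Qed.

Let circle_lebesgue_ge0 A : (0 <= circle_lebesgue A)%E.
Proof. exact: measure_ge0. Qed.

Let circle_lebesgue_sigma_additive : semi_sigma_additive circle_lebesgue.
Proof.
rewrite circle_lebesgueE.
by apply: measure_semi_sigma_additive; exact: measurable_circle_pi.
Qed.

HB.instance Definition _ := isMeasure.Build _ _ _ circle_lebesgue
  circle_lebesgue0 circle_lebesgue_ge0 circle_lebesgue_sigma_additive.

Let circle_lebesgue_setT : circle_lebesgue setT = 1%E.
Proof.
rewrite /circle_lebesgue preimage_setT setIT lebesgue_measure_itv /=.
by rewrite lte_fin ltr01 oppr0 adde0.
Qed.

HB.instance Definition _ := Measure_isProbability.Build _ _ _ circle_lebesgue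
  circle_lebesgue_setT.

End circle.

Section measures_on_circle.
Variable R : realType.
Implicit Types mu nu : set (circle R) -> \bar R.

Definition atomless mu := forall x, mu [set x] = 0%E.

(* Id + t v, i.e. x |-> x + t v(x) mod 1. *)
Definition id_plus (v : circle R -> R) (t : R) (x : circle R) : circle R :=
  x + circle_pi (t * v x).

Definition coupling mu nu (P : set (circle R * circle R) -> \bar R) :=
  forall A, measurable A ->
    pushforward P fst A = mu A /\ pushforward P snd A = nu A.

Definition transport_cost (P : probability (circle R * circle R)%type R) : \bar R :=
  (\int[P]_z (circle_dist z.1 z.2 ^+ 2)%:E)%E.

(* Between probability measures the infimum is a finite number: it is taken
   over a nonempty set, since the product measure is a coupling, and the
   distance is at most 1/2. Hence [fine] loses nothing. *)
Definition wasserstein mu nu : R :=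
  Num.sqrt (fine (ereal_inf [set transport_cost P |
    P in [set P : probability (circle R * circle R)%type R | coupling mu nu P]])).

End measures_on_circle.

Section expanding_maps.
Variable R : realType.

Definition is_lift (f : R -> R) (Phi : circle R -> circle R) :=
  forall x, circle_pi (f x) = Phi (circle_pi x).

Definition C2 (f : R -> R) :=
  [/\ forall x, derivable f x 1,
      forall x, derivable (derive1 f) x 1 &
      continuous (derive1n 2 f)].

(* A C^2 map of R / Z is one with a C^2 lift to R; its derivative at the class
   of x is the derivative of the lift at x. *)
Definition C2_expanding (Phi : circle R -> circle R) :=
  exists f : R -> R,
    [/\ is_lift f Phi, C2 f & forall x, 1 < `|derive1 f x|].

Definition invariant_measure (Phi : circle R -> circle R) (mu : set (circle R) -> \bar R) :=
  forall A, measurable A -> pushforward mu Phi A = mu A.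

Definition has_density (rho : circle R -> R) (mu : set (circle R) -> \bar R) :=
  [/\ measurable_fun setT rho, forall x, 0 <= rho x &
      forall A, measurable A ->
        mu A = (\int[@circle_lebesgue R]_(x in A) (rho x)%:E)%E].

End expanding_maps.

Section euclidean_space.
Variables (R : realType) (n : nat).
Implicit Types a b x : 'rV[R]_n.

(* The norm that the library puts on ['rV[R]_n] is the sup norm. *)
Definition enorm a : R := Num.sqrt (\sum_i a 0 i ^+ 2).

Definition eball (r : R) : set 'rV[R]_n := [set a | enorm a <= r].

Definition box a b : set 'rV[R]_n := [set x | forall i, a 0 i <= x 0 i <= b 0 i].

Definition box_volume a b : R := \prod_i (b 0 i - a 0 i).

Definition box_cover (A : set 'rV[R]_n) (c : nat -> 'rV[R]_n * 'rV[R]_n) :=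
  (forall k i, (c k).1 0 i <= (c k).2 0 i) /\
  A `<=` \bigcup_k box (c k).1 (c k).2.

(* n-dimensional Lebesgue outer measure; Lebesgue measure on R^n is not in the
   library, and only its null sets are needed. *)
Definition lebesgue_outer (A : set 'rV[R]_n) : \bar R :=
  ereal_inf [set (\sum_(0 <= k <oo) (box_volume (c k).1 (c k).2)%:E)%E |
    c in box_cover A].

Definition ae_on (A : set 'rV[R]_n) (P : 'rV[R]_n -> Prop) :=
  lebesgue_outer (A `&` [set a | ~ P a]) = 0%E.

Definition bilipschitz_on (A : set 'rV[R]_n)
    (F : 'rV[R]_n -> probability (circle R) R) :=
  exists2 C : R, 0 < C & forall a b, A a -> A b ->
    C^-1 * enorm (a - b) <= wasserstein (F a) (F b) <= C * enorm (a - b).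

End euclidean_space.

(* Main.v *)
Require Import Defs.
From HB Require Import structures.
From mathcomp Require Import all_boot all_order all_algebra.
From mathcomp Require Import all_classical all_reals all_analysis.
From mathcomp Require Import measurable_realfun.
From mathcomp Require Import ring lra zify.

Set Implicit Arguments.
Unset Strict Implicit.
Unset Printing Implicit Defensive.

Import Order.TTheory GRing.Theory Num.Theory.
Import numFieldNormedType.Exports.

Local Open Scope classical_set_scope.
Local Open Scope ring_scope.

(* If [s <> t], the values of [x + s v(x)] and [x + t v(x)] leave only countably many
   possibilities for [x]. Hence the sets mapped to an atom by [Id + t v] are disjoint,
   up to null sets, for different [t], and only countably many have positive measure.

   For the second part, a measure on the circle is described by its lifted
   distribution function [H], with [H (x + 1) = H x + 1]; if [H] has slope at least
   [c], quantile couplings give [W <= sup |H - K| / c]. The map has a lift [e * f] with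
   [e = 1] or [e = -1] and [f] increasing, [f (x + 1) = f x + d], and the push-forward
   acts on distribution functions by a linear transfer operator [T]. If [b] is
   [d]-periodic and has zero sum over [x, x + 1, ..., x + d - 1], the functions
   [w_k = (e / d)^k b (f ((e f)^k x))] satisfy [T w_0 = 0] and [T w_(k + 1) = w_k], so
   that [sum_k w_k] is fixed by [T]. It is only Hölder continuous in general; so [F a]
   is given by [M - delta sum_i a_i sum_k c_k(|a|) w_(i, k)], where [M] is the
   distribution function of [m] and the weights [c_k(t) = max 0 (1 - (L^k - 1) t)]
   make the sum Lipschitz and tend to 1 as [t] tends to 0. Bounded distortion and an
   approximation of [rho] in [L^1] show that [M] has slope bounded below, so that a
   small [delta] keeps the sum increasing: no [F a] has an atom. For the lower
   Lipschitz bound, the measures are tested on nested arcs with end points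
   [f^-1 s] and [f^-1 (s + 1)], between which every [w_k] with [k > 0] has zero
   increment; the number of arcs containing a point is nearly a Lipschitz function of
   that point. *)

(** * Arcs of the circle *)

(** The obstacle is that the slope of [w_k] may be of order [(L / d) ^+ k], where [L >= d] bounds
    the slope of [f]; subtracting a multiple of the full series from [M], however small, may destroy
    monotonicity. The weights cut the series off near [L ^+ k = 1 / |a|]: then [|a| c_k(|a|) L ^+ k]
    is bounded and the remaining factors [d ^- k] make the slopes summable. The price is a defect
    [T S - S = sum_k (c_(k + 1) - c_k) w_k] of the weighted sum [S]. Its terms up to a fixed index
    are small for small [a], the others form a geometric tail; multiplied by [|a|], the defect is
    [o(|a|)]. The slope of [M] is controlled through invariance: an arc has the mass of its preimage
    under a high iterate, and this preimage fills a fixed proportion of each short cylinder. A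
    single arc would not give a linear lower bound, since its indicator is not Lipschitz. With [N]
    arcs the counting function has Lipschitz constant of order [N] up to an error 1, which
    disappears after division by [N]. *)

Section circle_basics.
Variable R : realType.
Implicit Types (x y t : R) (z w : circle R).
Local Notation cpi := (@circle_pi R).

Lemma circle_piP x y : cpi x = cpi y <-> exists n : int, x = y + n%:~R.
Proof.
rewrite circle_pi_eqP; split.
  by move=> /intrP[n xyn]; exists n; rewrite -xyn; ring.
by move=> [n ->]; rewrite addrC addKr.
Qed.

Lemma circle_piDz x (n : int) : cpi (x + n%:~R) = cpi x.
Proof. by apply/circle_piP; exists n. Qed.

Lemma circle_piB x y : cpi (x - y) = cpi x - cpi y.
Proof. by apply: (addIr (cpi y)); rewrite -circle_piD !subrK. Qed.

Lemma circle_pi0 : cpi 0 = 0.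
Proof. by rewrite -(subrr 0) circle_piB subrr. Qed.

Lemma int_shift x t : exists n : int, x <= t + n%:~R < x + 1.
Proof.
exists (- Num.floor (t - x)).
have := floor_itv (t - x); rewrite intrD mulr1z mulrNz.
by move=> /andP[h1 h2]; apply/andP; split; lra.
Qed.

(** A measurable representative in [[0, 1[]; measurability on the circle is reduced through it to
    measurability on the line. *)
Definition circle_section z : R :=
  repr z - (Num.floor (repr z : R))%:~R.
Local Notation sec := circle_section.

Lemma circle_sectionK z : cpi (sec z) = z.
Proof. by rewrite /sec -mulrNz circle_piDz /circle_pi reprK. Qed.

Lemma circle_section_ge0 z : 0 <= sec z.
Proof. by rewrite subr_ge0 floor_le. Qed.

Lemma circle_section_lt1 z : sec z < 1.
Proof.
by have := floorD1_gt (repr z : R); rewrite intrD /circle_section => ?; lra.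
Qed.

Lemma eq_int_dist_lt1 (m n : int) :
  `|m%:~R - n%:~R : R| < 1 -> m = n.
Proof.
rewrite -intrB -intr_norm -[1]/(1%:~R) ltr_int => h.
by apply/eqP; rewrite -subr_eq0; move: h; case: (m - n) => [[|k]|k].
Qed.

Lemma circle_section_pi t : 0 <= t < 1 -> sec (cpi t) = t.
Proof.
move=> /andP[t0 t1].
have /circle_piP[n e] := circle_sectionK (cpi t).
have s0 := circle_section_ge0 (cpi t); have s1 := circle_section_lt1 (cpi t).
suff n0 : n = 0 by rewrite e n0 addr0.
by apply: eq_int_dist_lt1; rewrite subr0 ltr_norml; apply/andP; split; lra.
Qed.

(** Closed arc with lifted end points: a single point for [x = y], the whole circle for
    [y >= x + 1]. *)
Definition arc x y : set (circle R) := cpi @` [set t | x <= t <= y].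

Lemma arcP x y t : arc x y (cpi t) <-> exists n : int, x <= t + n%:~R <= y.
Proof.
split=> [[s sxy /circle_piP[n e]]|[n nxy]].
  by exists n; rewrite -e.
by exists (t + n%:~R) => //; rewrite circle_piDz.
Qed.

Lemma narcP x y t : x <= y < x + 1 ->
  ~ arc x y (cpi t) <-> exists n : int, y < t + n%:~R < x + 1.
Proof.
move=> /andP[xy yx]; rewrite arcP; split => [nar|[n /andP[n1 n2]] [m /andP[m1 m2]]].
  have [n /andP[n1 n2]] := int_shift x t.
  exists n; rewrite n2 andbT ltNge; apply/negP => h; apply: nar.
  by exists n; rewrite n1.
suff mn : m = n by subst m; lra.
by apply: eq_int_dist_lt1; rewrite ltr_norml; apply/andP; split; lra.
Qed.

Lemma open_narc x y : x <= y < x + 1 -> open (~` arc x y).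
Proof.
(* Openness in the quotient topology is by definition openness of the preimage. *)
move=> xy; change (open (cpi @^-1` ~` arc x y)).
rewrite (_ : _ @^-1` _ = \bigcup_(n in [set: int]) `]y - n%:~R, x + 1 - n%:~R[%classic).
  by apply: bigcup_open => n _; exact: interval_open.
apply/seteqP; split=> t /=.
  move=> /(narcP _ xy)[n /andP[n1 n2]]; exists n => //=.
  by rewrite in_itv /=; apply/andP; split; lra.
move=> [n _]; rewrite /= in_itv/= => /andP[n1 n2].
by apply/(narcP _ xy); exists n; apply/andP; split; lra.
Qed.

Lemma measurable_arc x y : x <= y < x + 1 -> measurable (arc x y).
Proof.
move=> xy; rewrite -(setCK (arc x y)); apply: measurableC.
by apply: sub_sigma_algebra; exact: open_narc.
Qed.

Lemma arc1 x : arc x x = [set cpi x].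
Proof.
apply/seteqP; split=> z /=.
  by move=> [t /andP[t1 t2] <-]; rewrite (_ : t = x) //; lra.
by move=> ->; exists x => //=; apply/andP; split.
Qed.

Lemma measurable_circle1 z : measurable [set z].
Proof.
rewrite -(circle_sectionK z) -arc1; apply: measurable_arc.
by apply/andP; split; lra.
Qed.

(** The section jumps at 0, but the preimage of a ray []x, +oo[] is everything, empty, or the
    complement of a closed arc. *)
Lemma measurable_circle_section :
  measurable_fun setT (sec : circle R -> measurableTypeR R).
Proof.
apply: (measurability _ (RGenOInfty.measurableE R)) => // _ [_ [x ->] <-].
rewrite setTI.
have [x0|x0] := ltP x 0.
  rewrite (_ : _ @^-1` _ = setT); first exact: measurableT.
  apply/seteqP; split => // z _ /=; rewrite in_itv/= andbT.
  by apply: lt_le_trans x0 _; exact: circle_section_ge0.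
have [x1|x1] := leP 1 x.
  rewrite (_ : _ @^-1` _ = set0); first exact: measurable0.
  apply/seteqP; split => // z /=; rewrite in_itv/= andbT.
  by have := circle_section_lt1 z; lra.
rewrite (_ : _ @^-1` _ = ~` arc 0 x).
  by apply: measurableC; apply: measurable_arc; rewrite x0 add0r.
apply/seteqP; split => z /=; rewrite in_itv/= andbT.
  move=> xz; rewrite -(circle_sectionK z); apply/narcP; first by rewrite x0 add0r.
  by exists 0; rewrite addr0 add0r xz circle_section_lt1.
rewrite ltNge => nz; apply/negP => zx; apply: nz.
by exists (sec z); rewrite ?circle_sectionK//= zx circle_section_ge0.
Qed.

(** Continuity of the subtraction would speak of the Borel sets of the product topology; the
    sections reduce the claim to subtraction of reals, for the product sigma-algebra. *)
Lemma measurable_circleB :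
  measurable_fun setT (fun z : circle R * circle R => z.1 - z.2).
Proof.
rewrite [X in measurable_fun _ X](_ : _ =
  cpi \o (fun z : circle R * circle R => sec z.1 - sec z.2)); last first.
  by apply/funext => z /=; rewrite circle_piB !circle_sectionK.
apply: measurableT_comp; first exact: measurable_circle_pi.
by apply: measurable_funB; apply: measurableT_comp => //;
  exact: measurable_circle_section.
Qed.

Lemma measurable_id_plus v t : measurable_fun setT v ->
  measurable_fun setT (@id_plus R v t).
Proof.
move=> mv.
rewrite (_ : id_plus _ _ = cpi \o (fun z => sec z + t * v z)); last first.
  by apply/funext => z /=; rewrite circle_piD circle_sectionK.
apply: measurableT_comp; first exact: measurable_circle_pi.
apply: measurable_funD; first exact: measurable_circle_section.
exact: measurable_funM.
Qed.

End circle_basics.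

(** * Atoms of a family of displaced measures *)

(** Once null overlaps are discarded, [n + 1] of the sets cannot all have measure above
    [1 / (n + 1)]; so each of these levels is reached by finitely many indices. *)
Lemma ae_disjoint_countable d (T : measurableType d) (R : realType)
    (P : probability T R) (J : pointedType) (D : set J) (E : J -> set T) :
  (forall i, measurable (E i)) ->
  (forall i j, i <> j -> P (E i `&` E j) = 0%E) ->
  countable [set i | D i /\ (0 < P (E i))%E].
Proof.
move=> mE E0.
rewrite [X in countable X](_ : _ =
    \bigcup_n [set i | D i /\ (n.+1%:R^-1%:E < P (E i))%E]); last first.
  apply/seteqP; split=> [i [Di Ei]|i [k _ [Di Ei]]]; last first.
    by split=> //; apply: lt_trans Ei; rewrite lte_fin invr_gt0.
  have : 0 < fine (P (E i)) by rewrite fine_gt0// Ei/= ltey_eq fin_num_measure.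
  move=> /ltr_add_invr[k]; rewrite add0r => h; exists k => //; split=> //.
  by rewrite -[ltRHS]fineK ?fin_num_measure// lte_fin.
apply: bigcup_countable => // n _; apply: finite_set_countable.
apply: contrapT => /infiniteP/pcard_leP/injfunPex[/= q q_fun q_inj].
(* Only the overlaps along the sequence [q] are removed: the union over all pairs of indices need
   not be null. *)
pose N := \bigcup_k \bigcup_j (if j == k then set0 else E (q k) `&` E (q j)).
have mI k j : measurable (if j == k then set0 else E (q k) `&` E (q j)).
  by case: ifP => // _; exact: measurableI.
have mN : measurable N.
  by apply: bigcup_measurable => k _; apply: bigcup_measurable => j _.
have N0 : P N = 0%E.
  apply: measure_negligible => //; apply: negligible_bigcup => k.
  apply: negligible_bigcup => j; apply/negligibleP => //.
  case: ifP => [|/negbT jk]; first by rewrite measure0.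
  apply: E0 => qq; move: jk; rewrite eq_sym => /eqP; apply.
  by apply: q_inj => //; rewrite in_setT.
have PD k : P (E (q k) `\` N) = P (E (q k)).
  have mD : measurable (E (q k) `\` N) by exact: measurableD.
  have -> : P (E (q k)) = P (E (q k) `\` N) + P (E (q k) `&` N).
    by rewrite -measureU//; [rewrite setUC setUIDK|exact: measurableI|
      rewrite setDE setIACA setICl setI0].
  rewrite [X in (_ + X)%E](_ : _ = 0%E) ?adde0//.
  by apply: (subset_measure0 (B := N)) => //; exact: measurableI.
have mU : measurable (\bigcup_k (E (q k) `\` N)).
  by apply: bigcup_measurable => k _; exact: measurableD.
have := probability_le1 P mU; rewrite leNgt => /negP; apply.
rewrite [ltRHS](_ : _ = \sum_(0 <= k <oo) P (E (q k) `\` N))%E; last first.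
  rewrite measure_bigcup//.
  - by apply: eq_eseriesl =>// i; rewrite in_setT.
  - by move=> k _; exact: measurableD.
  apply/trivIsetP => i j _ _ ij; apply/seteqP; split => // z [[zi zN] [zj _]].
  by apply: zN; exists i => //; exists j => //; rewrite eq_sym (negbTE ij).
apply: (lt_le_trans _ (nneseries_lim_ge n.+1 _)) => //.
under eq_bigr do rewrite PD.
rewrite -EFin_sum_fine//; last by move=> ? _; rewrite fin_num_measure.
rewrite lte_fin (_ : 1%R = (\sum_(0 <= k < n.+1) n.+1%:R^-1:R)%R); last first.
  by rewrite sumr_const_nat subn0 -[RHS]mulr_natr mulVf.
apply: ltr_sum => // k _; have [_] := q_fun k I.
by rewrite -[ltRHS]fineK ?fin_num_measure// lte_fin.
Qed.

Section translates.
Variable R : realType.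
Implicit Types (mu : probability (circle R) R) (v : circle R -> R).

Lemma atomless_id_plusI mu v s t x y : atomless mu -> measurable_fun setT v ->
  s <> t -> mu ((id_plus v s @^-1` [set x]) `&` (id_plus v t @^-1` [set y])) = 0%E.
Proof.
move=> mu0 mv st.
have mpre r z : measurable (@id_plus R v r @^-1` [set z]).
  rewrite -[X in measurable X]setTI; apply: measurable_id_plus => //.
  exact: measurable_circle1.
apply: measure_negligible; first exact: measurableI.
pose X := circle_section x; pose Y := circle_section y.
(* Once the integer shifts are fixed, the two lifted equations determine [v z] by subtraction, and
   then [z]. *)
pose h (c : int * int) : circle R :=
  circle_pi (X + c.1%:~R - s * ((X + c.1%:~R - Y - c.2%:~R) / (s - t))).
apply: (@negligibleS _ _ _ _
    (\bigcup_k (if unpickle k is Some c then [set h c] else set0))); last first.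
  apply: negligible_bigcup => k; case: unpickle => [c|].
    by apply/negligibleP; [exact: measurable_circle1|exact: mu0].
  exact: negligible_set0.
move=> z [/= zx zy].
have /circle_piP[m em] : circle_pi (circle_section z + s * v z) = circle_pi X.
  by rewrite circle_piD !circle_sectionK.
have /circle_piP[n en] : circle_pi (circle_section z + t * v z) = circle_pi Y.
  by rewrite circle_piD !circle_sectionK.
exists (pickle (m, n)) => //; rewrite pickleK /= -(circle_sectionK z) /h/=.
have st0 : s - t != 0 by rewrite subr_eq0; apply/eqP.
have -> : X + m%:~R - Y - n%:~R = (s - t) * v z.
  by rewrite mulrBl; lra.
by rewrite mulrAC divff// mul1r -em addrK.
Qed.

Lemma countable_atoms mu v : atomless mu -> measurable_fun setT v ->
  countable [set t : R | ~ atomless (pushforward mu (id_plus v t))].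
Proof.
move=> mu0 mv.
pose A t := [set x | pushforward mu (id_plus v t) [set x] <> 0%E].
(* One atom for each [t] is enough. Where there is none, [get] returns a default point, whose mass
   is 0. *)
pose a t := get (A t).
apply: (@sub_countable _ _ _ [set t | [set: R] t /\
    (0 < mu (id_plus v t @^-1` [set a t]))%E]).
  apply: subset_card_le => t /existsNP[x xA]; split=> //.
  have : A t (a t) by apply: (@getI _ _ x).
  by rewrite /A/= measure_gt0 => /eqP.
apply: ae_disjoint_countable.
  move=> t; rewrite -[X in measurable X]setTI; apply: measurable_id_plus => //.
  exact: measurable_circle1.
by move=> s t; exact: atomless_id_plusI.
Qed.

End translates.

(** * Distribution functions on the circle *)

Lemma measureU_null d (T : measurableType d) (R : realType)
    (mu : {measure set T -> \bar R}) (A B : set T) :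
  measurable A -> measurable B -> mu (A `&` B) = 0%E ->
  mu (A `|` B) = (mu A + mu B)%E.
Proof.
move=> mA mB AB0.
have -> : A `|` B = A `|` (B `\` A).
  apply/seteqP; split=> z; last by move=> [?|[? _]]; [left|right].
  by have [?|?] := pselect (A z); [left|move=> []//; right].
rewrite measureU//; last 2 first.
- exact: measurableD.
- by rewrite setDE setICA setICr setI0.
congr (_ + _)%E; have mBA : measurable (B `\` A) by exact: measurableD.
have mIBA : measurable (B `&` A) by exact: measurableI.
have dBA : (B `&` A) `&` (B `\` A) = set0 by rewrite setDE setIACA setICr setI0.
have := measureU mu mIBA mBA dBA.
rewrite setUIDK => ->; rewrite [X in (X + _)%E](_ : _ = 0%E) ?add0e//.
by rewrite setIC.
Qed.

Lemma pushforward_probability d d' (T : measurableType d)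
    (T' : measurableType d') (R : realType) (P : probability T R) (f : T -> T') :
  measurable_fun setT f ->
  exists Q : probability T' R, (Q : set T' -> \bar R) = pushforward P f.
Proof. by move=> mf; exists (distribution P (mfun_Sub (mem_set mf))). Qed.

Section integer_translation.
Variable R : realType.
Implicit Types (f H : R -> R) (c x y : R).

Lemma quasiperiodicz f c : (forall x, f (x + 1) = f x + c) ->
  forall x (n : int), f (x + n%:~R) = f x + n%:~R * c.
Proof.
move=> fc; have fn x (n : nat) : f (x + n%:R) = f x + n%:R * c.
  elim: n => [|n ih]; first by rewrite mul0r !addr0.
  by rewrite -natr1 addrA fc ih; ring.
move=> x [n|n]; first exact: fn.
rewrite NegzE mulrNz; have := fn (x - n.+1%:R) n.+1.
by rewrite subrK => ->; rewrite -pmulrn; ring.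
Qed.

(** Any [y] lies between the values of [f] at two consecutive integers, so surjectivity follows from
    the intermediate value theorem. *)
Lemma quasiperiodic_inverse f c : continuous f -> {homo f : x y / x < y} ->
  0 < c -> (forall x, f (x + 1) = f x + c) ->
  exists2 g, cancel f g & cancel g f.
Proof.
move=> cf f_inc c0 fc.
have surj y : exists x, f x = y.
  pose n := Num.floor ((y - f 0) / c).
  have := floor_itv ((y - f 0) / c); rewrite -/n => /andP[n1 n2].
  have fn : f n%:~R = f 0 + n%:~R * c by rewrite -(quasiperiodicz fc) add0r.
  have fn1 : f (n + 1)%:~R = f 0 + (n + 1)%:~R * c.
    by rewrite -(quasiperiodicz fc) add0r.
  rewrite ler_pdivlMr// in n1; rewrite ltr_pdivrMr// in n2.
  have nn1 : (n%:~R : R) <= (n + 1)%:~R by rewrite ler_int lerDl.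
  have [||x _ fx] := @IVT R f n%:~R (n + 1)%:~R y nn1.
  - exact: continuous_subspaceT.
  - have ff : f n%:~R <= f (n + 1)%:~R by rewrite fn fn1; lra.
    by rewrite (min_idPl _)// (max_idPr _)// fn fn1; apply/andP; split; lra.
  by exists x.
pose g y := projT1 (cid (surj y)).
have gK : cancel g f by move=> y; exact: (projT2 (cid (surj y))).
exists g => // x; have [h|h|//] := ltgtP (g (f x)) x.
  by have := f_inc _ _ h; rewrite gK ltxx.
by have := f_inc _ _ h; rewrite gK ltxx.
Qed.

Lemma quasiperiodic_inverseD f g c : cancel f g -> cancel g f ->
  (forall x, f (x + 1) = f x + c) -> forall x, g (x + c) = g x + 1.
Proof. by move=> fK gK fc x; rewrite -(fK (g x + 1)) fc gK. Qed.

Lemma inverse_increasing f g : cancel g f -> {homo f : x y / x < y} ->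
  {homo g : x y / x < y}.
Proof.
move=> gK f_inc x y xy; have [//|h|h] := ltgtP (g x) (g y).
  by have := f_inc _ _ h; rewrite !gK; lra.
by move: xy; rewrite -(gK x) h gK ltxx.
Qed.

End integer_translation.

(** Only arcs shorter than the circle are prescribed. The case [x = y] excludes atoms, and [H] is
    determined up to an additive constant. *)
Definition arc_cdf (R : realType) (H : R -> R) (mu : set (circle R) -> \bar R) :=
  (forall x, H (x + 1) = H x + 1) /\
  (forall x y, x <= y < x + 1 -> mu (arc x y) = (H y - H x)%:E).

Section cdf.
Variable R : realType.
Implicit Types (mu nu : probability (circle R) R) (H : R -> R).

Lemma arcDz (x y : R) (n : int) : arc (x + n%:~R) (y + n%:~R) = arc x y.
Proof.
apply/seteqP; split=> z; rewrite -(circle_sectionK z) => /arcP[m hm];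
  apply/arcP.
  by exists (m - n); lra.
by exists (m + n); lra.
Qed.

Lemma arcU (x y z : R) : x <= y -> y <= z -> arc x y `|` arc y z = arc x z.
Proof.
move=> xy yz; apply/seteqP; split=> w.
  by move=> [] [t /= ht <-]; exists t => //=; lra.
move=> [t /= ht <-]; have [ty|ty] := leP t y; [left|right]; exists t => //=; lra.
Qed.

Lemma arcI (x y z : R) : x <= y -> y <= z -> z < x + 1 ->
  arc x y `&` arc y z `<=` [set circle_pi y].
Proof.
move=> xy yz zx w [] [t /= ht <-] /arcP[m hm].
suff m0 : m = 0 by apply: congr1; move: hm; rewrite m0 addr0; lra.
by apply: (@eq_int_dist_lt1 R); rewrite subr0 ltr_norml; lra.
Qed.

Lemma arc_full (x y : R) : y <= x + 1 -> arc x y `|` arc y (x + 1) = setT.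
Proof.
move=> yx; apply/seteqP; split=> // z _; rewrite -(circle_sectionK z).
have [n hn] := int_shift x (circle_section z); rewrite -(circle_piDz _ n).
by have [h|h] := leP (circle_section z + n%:~R) y; [left|right];
  exists (circle_section z + n%:~R) => //=; lra.
Qed.

Lemma arcI_full (x y : R) : x < y < x + 1 ->
  arc x y `&` arc y (x + 1) `<=` [set circle_pi x] `|` [set circle_pi y].
Proof.
move=> xy w [] [t /= ht <-] /arcP[m hm].
have [e|] := eqVneq m 0.
  by right; apply: congr1; move: hm; rewrite e addr0; lra.
have [e|] := eqVneq m 1.
  by left; apply: congr1; move: hm; rewrite e mulr1z; lra.
move=> m1 m0; exfalso.
have : (1 < m) || (m < 0).
  by move: m m0 m1 {hm} => [[|[|k]]|k].
by move=> /orP[]; rewrite -(ltr_int R); lra.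
Qed.

Section atomless_measure.
Variable mu : probability (circle R) R.
Hypothesis mu0 : atomless mu.

(** Consecutive closed arcs overlap in an end point only, which is null. *)
Lemma atomless_arcD (x y z : R) : x <= y -> y <= z -> z < x + 1 ->
  mu (arc x z) = (mu (arc x y) + mu (arc y z))%E.
Proof.
move=> xy yz zx; rewrite -(arcU xy yz) measureU_null//.
- by apply: measurable_arc; lra.
- by apply: measurable_arc; lra.
apply: (subset_measure0 _ _ (arcI xy yz zx)) => //.
- by apply: measurableI; apply: measurable_arc; lra.
- exact: measurable_circle1.
- exact: mu0.
Qed.

Lemma atomless_arc_full (x y : R) : x < y < x + 1 ->
  (mu (arc x y) + mu (arc y (x + 1)) = 1)%E.
Proof.
move=> xy; have yx : y <= x + 1 by lra.
rewrite -measureU_null ?arc_full//; first exact: probability_setT.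
- by apply: measurable_arc; lra.
- by apply: measurable_arc; lra.
apply: (subset_measure0 _ _ (arcI_full xy)) => //.
- by apply: measurableI; apply: measurable_arc; lra.
- by apply: measurableU; exact: measurable_circle1.
apply: measure_negligible.
  by apply: measurableU; exact: measurable_circle1.
by apply: negligibleU; apply/negligibleP;
  [exact: measurable_circle1|exact: mu0|exact: measurable_circle1|exact: mu0].
Qed.

Lemma atomless_arc_cdf (G : R -> R) :
  (forall u : R, 0 <= u < 1 -> mu (arc 0 u) = (G u)%:E) ->
  arc_cdf (fun x => (Num.floor x)%:~R + G (x - (Num.floor x)%:~R)) mu.
Proof.
move=> muG.
have G0 : G 0 = 0.
  have : mu (arc 0 0) = 0%E by rewrite arc1; exact: mu0.
  by rewrite muG ?lexx ?ltr01// => -[].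
split=> [x|x y].
  have -> : Num.floor (x + 1) = Num.floor x + 1 by rewrite floorDrz ?int_num1// floor1.
  by rewrite intrD mulr1z (_ : x + 1 - _ = x - (Num.floor x)%:~R); ring.
wlog [n0 n1] : x y / 0 <= x /\ x < 1.
  move=> wl xy; pose n := Num.floor x.
  have := floor_itv x; rewrite -/n intrD => /andP[n0 n1].
  have := wl (x - n%:~R) (y - n%:~R).
  rewrite -mulrNz arcDz => -> //; [|by split; lra|lra].
  rewrite !floorDrz ?intr_int// !intrKfloor !intrD !mulrNz -/n.
  have -> : y - n%:~R - ((Num.floor y)%:~R - n%:~R) = y - (Num.floor y)%:~R by ring.
  have -> : x - n%:~R - (n%:~R - n%:~R) = x - n%:~R by ring.
  by congr EFin; ring.
move=> xy; have -> : Num.floor x = 0 by apply: floor_def; rewrite add0r; lra.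
rewrite subr0 add0r.
have Gx : mu (arc 0 x) = (G x)%:E by apply: muG; lra.
have [y1|y1] := ltP y 1.
  have -> : Num.floor y = 0 by apply: floor_def; rewrite add0r; lra.
  have Gy : mu (arc 0 y) = (G y)%:E by apply: muG; lra.
  have : (mu (arc 0 y) = mu (arc 0 x) + mu (arc x y))%E.
    by apply: atomless_arcD; lra.
  have : mu (arc x y) \is a fin_num.
    by rewrite fin_num_measure//; apply: measurable_arc.
  rewrite Gx Gy; case: (mu _) => // r _ [e].
  by congr EFin; rewrite subr0 e; ring.
(* An arc that passes 1 is measured through its complement, which up to end points is
   [arc (y - 1) x]. *)
have -> : Num.floor y = 1 by apply: floor_def; rewrite intrD !mulr1z; lra.
have Gy : mu (arc 0 (y - 1)) = (G (y - 1))%:E by apply: muG; lra.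
have := @atomless_arc_full x y.
have : (mu (arc 0 x) = mu (arc 0 (y - 1)) + mu (arc (y - 1) x))%E.
  by apply: atomless_arcD; lra.
have -> : arc y (x + 1) = arc (y - 1) x.
  by rewrite -(arcDz (y - 1) x 1) mulr1z subrK.
rewrite Gx Gy.
have : mu (arc (y - 1) x) \is a fin_num.
  by rewrite fin_num_measure//; apply: measurable_arc; lra.
have : mu (arc x y) \is a fin_num.
  by rewrite fin_num_measure//; apply: measurable_arc.
case: (mu (arc x y)) => // s _; case: (mu _) => // r _ [e1] e2.
have [e2'] := e2 ltac:(lra).
by congr EFin; lra.
Qed.

Lemma atomless_arc_cdf_ex : exists H, arc_cdf H mu.
Proof.
eexists; apply: (@atomless_arc_cdf (fun u => fine (mu (arc 0 u)))) => u u01.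
by rewrite fineK// fin_num_measure//; apply: measurable_arc; rewrite add0r.
Qed.

End atomless_measure.

Lemma arc_cdf_atomless H (mu : set (circle R) -> \bar R) :
  arc_cdf H mu -> atomless mu.
Proof.
move=> [_ muH] z; rewrite -(circle_sectionK z) -arc1 muH ?subrr//.
by rewrite lexx ltrDl ltr01.
Qed.

Lemma circle_lebesgue_cdf : arc_cdf id (@circle_lebesgue R).
Proof.
have at0 : atomless (@circle_lebesgue R).
  move=> z; apply/eqP; rewrite eq_le measure_ge0 andbT.
  rewrite -(lebesgue_measure_set1 (circle_section z)) /circle_lebesgue.
  apply: le_measure; rewrite ?inE//.
    apply: measurableI => //; rewrite -[X in measurable X]setTI.
    by apply: measurable_circle_pi => //; exact: measurable_circle1.
  move=> t /= [+ <-]; rewrite in_itv/= => t01.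
  by rewrite circle_section_pi.
have := @atomless_arc_cdf _ at0 id; rewrite (_ : (fun _ => _) = id).
  apply=> u /[dup] u01 /andP[u0 u1]; rewrite /= /circle_lebesgue.
  rewrite (_ : _ `&` _ = `[0, u]%classic); last first.
    apply/seteqP; split=> t /=; rewrite !in_itv/=.
      move=> [t01 /arcP[n hn]]; suff n0 : n = 0 by move: hn; rewrite n0 addr0.
      by apply: (@eq_int_dist_lt1 R); rewrite subr0 ltr_norml; lra.
    by move=> tu; split; [lra|exists t].
  rewrite lebesgue_measure_itv/= lte_fin.
  by case: ltgtP u0 => // [_|<-] _; rewrite ?oppr0 ?adde0.
by apply/funext => x; rewrite addrC subrK.
Qed.

End cdf.

Section cdf_measure.
Variable R : realType.
Implicit Types (P Q : probability (circle R) R) (H : R -> R).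

Lemma arc_cdf_int H (mu : set (circle R) -> \bar R) x (n : int) :
  arc_cdf H mu -> H (x + n%:~R) = H x + n%:~R.
Proof. by move=> [H1 _]; rewrite (quasiperiodicz H1) mulr1. Qed.

Lemma arc_cdf_nondecreasing H P : arc_cdf H P -> {homo H : x y / x <= y}.
Proof.
move=> PH x y xy; have [n hn] := int_shift x y.
have : (0 <= P (arc x (y + n%:~R)))%E by [].
rewrite PH.2// lee_fin (arc_cdf_int y n PH) => h.
have : n < 1 by rewrite -(ltr_int R); lra.
rewrite -[1]add0r ltzD1 -(ler_int R) => ?; lra.
Qed.

(** The arcs around [x] decrease to a point, which is null, so their measures tend to 0;
    monotonicity does the rest. *)
Lemma arc_cdf_continuous H P : arc_cdf H P -> continuous H.
Proof.
move=> PH; have nd := arc_cdf_nondecreasing PH.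
move=> x; apply/cvgrPdist_lt => e e0.
(* The offset 3 keeps all these arcs shorter than the circle, as [arc_cdf] requires. *)
pose r n : R := (n.+3)%:R^-1.
have r0 n : 0 < r n by rewrite invr_gt0.
have r3 n : r n <= 3^-1.
  by rewrite lef_pV2 ?posrE// ler_nat.
pose A n := arc (x - r n) (x + r n).
have mA n : measurable (A n).
  by apply: measurable_arc; have := r0 n; have := r3 n; lra.
have capA : \bigcap_n A n = [set circle_pi x].
  apply/seteqP; split => [z zA|z -> n _]; last first.
    by exists x => //=; have := r0 n; lra.
  have [t /= ht tz] := zA 0%N I; rewrite -tz; congr circle_pi.
  have rt n : `|t - x| <= r n.
    have := zA n I; rewrite -tz => /arcP[m hm].
    have m0 : m = 0.
      apply: (@eq_int_dist_lt1 R); rewrite subr0 ltr_norml.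
      by have := r3 n; have := r3 0%N; lra.
    by move: hm; rewrite m0 addr0 ler_norml; lra.
  apply/eqP; rewrite -subr_eq0 -normr_le0 leNgt; apply/negP => tx.
  have [n] := ltr_add_invr tx; rewrite add0r => hn.
  have := rt n; apply/negP; rewrite -ltNge; apply: le_lt_trans hn.
  by rewrite lef_pV2 ?posrE// ler_nat; apply: leq_trans (leqnSn _) _.
have cvA : P (A n) @[n --> \oo] --> 0%E.
  have <- : P (\bigcap_n A n) = 0%E.
    by rewrite capA; apply: (arc_cdf_atomless PH).
  apply: nonincreasing_cvg_mu => //.
  - by apply: le_lt_trans (probability_le1 P (mA 0%N)) _; rewrite ltry.
  - by rewrite capA; exact: measurable_circle1.
  move=> m n mn; apply/subsetPset => z [t /= ht <-]; exists t => //=.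
  have : r n <= r m by rewrite lef_pV2 ?posrE// ler_nat !ltnS.
  lra.
have [n hn] : exists n, (P (A n) < e%:E)%E.
  have /fine_cvgP[_ /cvgrPdist_lt/(_ e e0)[N _ /(_ N (leqnn N))]] := cvA.
  rewrite /= sub0r normrN => h; exists N; rewrite -[ltLHS]fineK.
    by rewrite lte_fin; apply: le_lt_trans h; exact: ler_norm.
  exact: fin_num_measure.
rewrite PH.2 ?lte_fin in hn; last by have := r0 n; have := r3 n; lra.
near=> y; have : `|x - y| < r n.
  by near: y; apply: cvgr_dist_lt => //; exact: r0.
rewrite !ltr_norml => hy.
have h1 : H (x - r n) <= H y by apply: nd; lra.
have h2 : H y <= H (x + r n) by apply: nd; lra.
have h3 : H (x - r n) <= H x by apply: nd; lra.
have h4 : H x <= H (x + r n) by apply: nd; lra.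
lra.
Unshelve. all: by end_near. Qed.

Lemma arc_cdf_eq H1 H2 P : arc_cdf H1 P -> arc_cdf H2 P ->
  exists c, forall x, H1 x = H2 x + c.
Proof.
move=> h1 h2; exists (H1 0 - H2 0) => x.
have [n hn] := int_shift 0 x.
have := h1.2 0 (x + n%:~R) hn.
by rewrite h2.2// (arc_cdf_int x n h1) (arc_cdf_int x n h2) => -[]; lra.
Qed.

Lemma arc_cdfD H c (mu : set (circle R) -> \bar R) :
  arc_cdf H mu -> arc_cdf (fun x => H x + c) mu.
Proof.
move=> [h1 h2]; split=> [x|x y xy]; first by rewrite h1; ring.
by rewrite h2//; congr EFin; ring.
Qed.

(** Both measures are transported to the line by the section, where the rays []x, +oo[] form a
    generating family stable under intersection; their preimages are complements of arcs starting at
    0. *)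
Lemma arc_measure_unique P Q :
  (forall x : R, 0 <= x < 1 -> P (arc 0 x) = Q (arc 0 x)) ->
  forall A, measurable A -> P A = Q A.
Proof.
move=> PQ A mA.
have mP := @measurable_circle_section R.
have [P' PE] := pushforward_probability P mP.
have [Q' QE] := pushforward_probability Q mP.
suff e B : measurable B -> P' B = Q' B.
  have := e (@circle_pi R @^-1` A); rewrite PE QE /pushforward.
  have -> : @circle_section R @^-1` (@circle_pi R @^-1` A) = A.
    by apply/seteqP; split=> z /=; rewrite circle_sectionK.
  apply; rewrite -[X in measurable X]setTI.
  exact: measurable_circle_pi.
apply: (@measure_unique _ R (measurableTypeR R) (@RGenOInfty.G R)
  (fun n => `]- n%:R, +oo[%classic) _ _ _ _ P' Q').
- exact: RGenOInfty.measurableE.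
- move=> _ _ [x ->] [y ->]; exists (Num.max x y).
  apply/seteqP; split=> z /=; rewrite !in_itv/= !andbT gt_max.
    by move=> [-> ->].
  by move=> /andP.
- by move=> n; exists (- n%:R).
- apply/seteqP; split=> // x _.
  exists (Num.truncn `|x|).+1 => //=; rewrite in_itv/= andbT.
  by rewrite ltrNl; apply: le_lt_trans (truncnS_gt _); rewrite -normrN ler_norm.
- move=> _ [x ->]; suff : P' `]x, +oo[%classic = Q' `]x, +oo[%classic by [].
  rewrite PE QE /pushforward.
  have [x0|x0] := ltP x 0.
    have -> : @circle_section R @^-1` `]x, +oo[ = setT.
      apply/seteqP; split => // z _ /=; rewrite in_itv/= andbT.
      by apply: lt_le_trans x0 _; exact: circle_section_ge0.
    by rewrite !probability_setT.
  have [x1|x1] := leP 1 x.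
    have -> : @circle_section R @^-1` `]x, +oo[ = set0.
      apply/seteqP; split => // z /=; rewrite in_itv/= andbT.
      by have := circle_section_lt1 z; lra.
    by rewrite !measure0.
  have x01 : 0 <= x < 1 by lra.
  have -> : @circle_section R @^-1` `]x, +oo[ = ~` arc 0 x.
    apply/seteqP; split => z /=; rewrite in_itv/= andbT.
      move=> xz; rewrite -(circle_sectionK z); apply/narcP; first by rewrite x0 add0r.
      by exists 0; rewrite addr0 add0r xz circle_section_lt1.
    rewrite ltNge => nz; apply/negP => zx; apply: nz.
    by exists (circle_section z); rewrite ?circle_sectionK//= zx circle_section_ge0.
  have ma : measurable (arc 0 x) by apply: measurable_arc; rewrite add0r.
  by rewrite !probability_setC// PQ.
- by move=> n; apply: le_lt_trans (probability_le1 _ _) _ => //; rewrite ltry.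
Qed.

Lemma arc_cdf_unique H P Q : arc_cdf H P -> arc_cdf H Q ->
  forall A, measurable A -> P A = Q A.
Proof.
move=> hP hQ; apply: arc_measure_unique => x x01.
by rewrite hP.2 ?hQ.2 ?add0r.
Qed.

Section quantile.
Variables (H G : R -> R).
Hypothesis H1 : forall x, H (x + 1) = H x + 1.
Hypothesis H_inc : {homo H : x y / x < y}.
Hypotheses (HK : cancel H G) (GK : cancel G H).

Definition quantile (z : circle R) : circle R :=
  circle_pi (G (circle_section z)).

Lemma measurable_quantile : measurable_fun setT quantile.
Proof.
apply: measurableT_comp; first exact: measurable_circle_pi.
apply: measurableT_comp; last exact: measurable_circle_section.
apply: nondecreasing_measurable => // x y.
rewrite le_eqVlt => /orP[/eqP->//|xy].
exact/ltW/(inverse_increasing GK H_inc).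
Qed.

(** Since [H (x + n) = H x + n], the choice of the representative in [quantile] is immaterial. *)
Lemma quantile_arc x y : quantile @^-1` (arc x y) = arc (H x) (H y).
Proof.
have Hle a b : (H a <= H b) = (a <= b) by exact: le_mono H_inc a b.
apply/seteqP; split=> z.
  move=> /= /arcP[n hn]; rewrite -(circle_sectionK z); apply/arcP; exists n.
  by move: hn; rewrite -(Hle x) -(Hle _ y) (quasiperiodicz H1) GK mulr1.
rewrite -{1}(circle_sectionK z) => /arcP[n hn]; apply/arcP; exists n.
by rewrite -(Hle x) -(Hle _ y) (quasiperiodicz H1) GK mulr1.
Qed.

Lemma quantile_cdf : arc_cdf H (pushforward (@circle_lebesgue R) quantile).
Proof.
split=> // x y xy; rewrite /pushforward quantile_arc.
rewrite (circle_lebesgue_cdf R).2//; have [xy0|xy0] := eqVneq x y.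
  by rewrite xy0; lra.
have /H_inc : x < y by rewrite lt_neqAle xy0; lra.
have /H_inc : y < x + 1 by lra.
by rewrite H1; lra.
Qed.

End quantile.

End cdf_measure.

(** * The Wasserstein distance *)

Section circle_distance.
Variable R : realType.
Implicit Types (X Y : R) (z w : circle R).

Lemma circle_distE z w : circle_dist z w =
  Num.min (circle_section (z - w)) (1 - circle_section (z - w)).
Proof.
set s := circle_section (z - w).
have s0 : 0 <= s by exact: circle_section_ge0.
have s1 : s < 1 by exact: circle_section_lt1.
have sE : circle_pi s = z - w by exact: circle_sectionK.
apply/eqP; rewrite eq_le; apply/andP; split.
  have lb : has_lbound [set `|t| | t in [set t : R | circle_pi t = z - w]].
    by exists 0 => _ [t _ <-].
  rewrite le_min; apply/andP; split; apply: ge_inf => //=.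
    by exists s; rewrite // ger0_norm.
  exists (s - 1); last by rewrite ler0_norm; lra.
  by have := circle_piDz s (- 1); rewrite mulrNz mulr1z sE.
apply: lb_le_inf; first by exists `|s|, s.
move=> _ [t /= + <-]; rewrite -sE => /circle_piP[n ->].
have [n0|n0] := leP 0 n.
  apply: (le_trans (y := s)); first by rewrite ge_min lexx.
  have : 0 <= n%:~R :> R by rewrite ler0z.
  by move=> ?; rewrite ger0_norm; lra.
apply: (le_trans (y := 1 - s)); first by rewrite ge_min lexx orbT.
have : n%:~R <= (- 1)%:~R :> R by rewrite ler_int -ltzD1 addNr.
by rewrite mulrNz => ?; rewrite ler0_norm; lra.
Qed.

Lemma circle_dist_le X Y : circle_dist (circle_pi X) (circle_pi Y) <= `|X - Y|.
Proof.
by apply: ge_inf; [exists 0 => _ [t _ <-]|exists (X - Y) => //; rewrite /= circle_piB].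
Qed.

(** The infimum is attained by a suitable lift of [w]; this is how Lipschitz bounds on the line
    descend to the circle. *)
Lemma circle_dist_lift X w : exists2 Y, circle_pi Y = w &
  circle_dist (circle_pi X) w = `|X - Y|.
Proof.
rewrite circle_distE; set s := circle_section _.
have s0 : 0 <= s by exact: circle_section_ge0.
have s1 : s < 1 by exact: circle_section_lt1.
have sE : circle_pi s = circle_pi X - w by exact: circle_sectionK.
have E1 : circle_pi (X - s) = w by rewrite circle_piB sE subKr.
have [h|h] := leP s (1 - s).
  by exists (X - s) => //; rewrite ger0_norm; lra.
exists (X - s + 1); first by rewrite (circle_piDz _ 1).
by rewrite ler0_norm; lra.
Qed.

Lemma circle_dist_ge0 z w : 0 <= circle_dist z w.
Proof.
rewrite circle_distE le_min circle_section_ge0 subr_ge0.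
exact/ltW/circle_section_lt1.
Qed.

Lemma circle_dist_le1 z w : circle_dist z w <= 1.
Proof.
rewrite circle_distE ge_min; apply/orP; left.
exact/ltW/circle_section_lt1.
Qed.

Lemma measurable_circle_dist :
  measurable_fun setT (fun z : circle R * circle R => circle_dist z.1 z.2).
Proof.
under eq_fun do rewrite circle_distE.
have ms : measurable_fun setT
    (fun z : circle R * circle R => circle_section (z.1 - z.2)).
  apply: measurableT_comp; first exact: measurable_circle_section.
  exact: measurable_circleB.
by apply: measurable_minr => //; apply: measurable_funB.
Qed.

Lemma measurable_circle_dist2 : measurable_fun setT
  (fun z : circle R * circle R => (circle_dist z.1 z.2 ^+ 2)%:E).
Proof.
by apply/measurable_EFinP; apply: measurable_funX; exact: measurable_circle_dist.
Qed.

End circle_distance.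

Section wasserstein_bounds.
Variable R : realType.
Implicit Types (mu nu : set (circle R) -> \bar R)
  (P : probability (circle R * circle R)%type R).

Lemma transport_cost_ge0 P : (0 <= transport_cost P)%E.
Proof. by apply: integral_ge0 => z _; rewrite lee_fin sqr_ge0. Qed.

(** A crude bound, used to know that costs and their infimum are finite. *)
Lemma transport_cost_le1 P : (transport_cost P <= 1)%E.
Proof.
have -> : 1%E = (\int[P]_z (cst 1%E z))%E :> \bar R.
  by rewrite integral_cst// mul1e; exact/esym/probability_setT.
apply: ge0_le_integral => //.
- by move=> z _; rewrite lee_fin sqr_ge0.
- exact: measurable_circle_dist2.
- by move=> z _; rewrite lee_fin exprn_ile1// ?circle_dist_ge0 ?circle_dist_le1.
Qed.

Lemma wasserstein_le mu nu P (c : R) : 0 <= c -> coupling mu nu P ->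
  (transport_cost P <= (c ^+ 2)%:E)%E -> wasserstein mu nu <= c.
Proof.
move=> c0 cP Pc; rewrite /wasserstein; set I := ereal_inf _.
have IP : (I <= transport_cost P)%E by apply: ereal_inf_lbound; exists P.
have I0 : (0 <= I)%E.
  by apply: le_ereal_inf_tmp => _ [Q _ <-]; exact: transport_cost_ge0.
rewrite -(ger0_norm c0) -sqrtr_sqr ler_wsqrtr//.
rewrite -lee_fin fineK; first exact: le_trans Pc.
by rewrite ge0_fin_numE// (le_lt_trans IP)// (le_lt_trans Pc)// ltry.
Qed.

(** A coupling must exist: the infimum of the empty set is [+oo], which [fine] sends to 0. *)
Lemma le_wasserstein mu nu (c : R) : 0 <= c ->
  (exists P : probability (circle R * circle R)%type R, coupling mu nu P) ->
  (forall P, coupling mu nu P -> ((c ^+ 2)%:E <= transport_cost P)%E) ->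
  c <= wasserstein mu nu.
Proof.
move=> c0 [P cP] cle; rewrite /wasserstein; set I := ereal_inf _.
have IP : (I <= transport_cost P)%E by apply: ereal_inf_lbound; exists P.
have Ic : ((c ^+ 2)%:E <= I)%E.
  by apply: le_ereal_inf_tmp => _ [Q cQ <-]; exact: cle.
rewrite -(ger0_norm c0) -sqrtr_sqr ler_wsqrtr//.
rewrite -lee_fin fineK// ge0_fin_numE.
  rewrite (le_lt_trans IP)// (le_lt_trans (transport_cost_le1 _))//.
  by rewrite ltry.
by apply: le_trans Ic; rewrite lee_fin sqr_ge0.
Qed.

Section maps.
Variables (q1 q2 : circle R -> circle R).
Hypotheses (mq1 : measurable_fun setT q1) (mq2 : measurable_fun setT q2).
Variables (mu nu : set (circle R) -> \bar R).
Hypothesis muE : forall A, measurable A ->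
  mu A = pushforward (@circle_lebesgue R) q1 A.
Hypothesis nuE : forall A, measurable A ->
  nu A = pushforward (@circle_lebesgue R) q2 A.

Lemma coupling_maps : exists2 P : probability (circle R * circle R)%type R, coupling mu nu P &
  (P : set _ -> \bar R) =
    pushforward (@circle_lebesgue R) (fun z => (q1 z, q2 z)).
Proof.
have mq : measurable_fun setT (fun z => (q1 z, q2 z)).
  exact: measurable_fun_pair.
have [P PE] := pushforward_probability (@circle_lebesgue R) mq.
by exists P => // A mA; rewrite muE// nuE// PE.
Qed.

(** The coupling carried by the pair of maps costs at most the square of their uniform distance. *)
Lemma wasserstein_le_maps (c : R) : 0 <= c ->
  (forall z, circle_dist (q1 z) (q2 z) <= c) -> wasserstein mu nu <= c.
Proof.
move=> c0 qc; have [P cP PE] := coupling_maps.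
apply: (wasserstein_le c0 cP).
have mq : measurable_fun setT (fun z => (q1 z, q2 z)).
  exact: measurable_fun_pair.
have -> : transport_cost P =
    (\int[@circle_lebesgue R]_z (circle_dist (q1 z) (q2 z) ^+ 2)%:E)%E.
  transitivity (\int[pushforward (@circle_lebesgue R) (fun z => (q1 z, q2 z))]_z
      (circle_dist z.1 z.2 ^+ 2)%:E)%E.
    by apply: eq_measure_integral => A mA _; exact: (congr1 (fun m => m A) PE).
  rewrite ge0_integral_pushforward//; first exact: measurable_circle_dist2.
  by move=> z _; rewrite lee_fin sqr_ge0.
have -> : (c ^+ 2)%:E = (\int[@circle_lebesgue R]_z (cst (c ^+ 2)%:E z))%E.
  rewrite integral_cst// [X in (_ * X)%E](_ : _ = 1%E) ?mule1//.
  exact: (@probability_setT _ _ _ (@circle_lebesgue R)).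
apply: ge0_le_integral => //.
- by move=> z _; rewrite lee_fin sqr_ge0.
- have := measurableT_comp (@measurable_circle_dist2 R) mq; exact.
- by move=> z _; rewrite lee_fin lerXn2r// ?nnegrE// circle_dist_ge0.
Qed.

End maps.

End wasserstein_bounds.

Section wasserstein_cdf.
Variable R : realType.
Implicit Types (P Q : probability (circle R) R) (H K : R -> R).

Lemma cdf_quantile H P : arc_cdf H P -> {homo H : x y / x < y} ->
  exists G, [/\ cancel H G, cancel G H & forall A, measurable A ->
    P A = pushforward (@circle_lebesgue R) (quantile G) A].
Proof.
move=> HP H_inc; have Hc := arc_cdf_continuous HP; have H1 := HP.1.
have [G HK GK] := quasiperiodic_inverse Hc H_inc ltr01 H1.
exists G; split=> // A mA.
have mq := measurable_quantile H_inc GK.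
have [P' PE] := pushforward_probability (@circle_lebesgue R) mq.
rewrite -PE; apply: (@arc_cdf_unique _ H P P') => //.
by rewrite PE; exact: quantile_cdf.
Qed.

Lemma cdf_coupling H K P Q :
  arc_cdf H P -> {homo H : x y / x < y} ->
  arc_cdf K Q -> {homo K : x y / x < y} ->
  exists p : probability (circle R * circle R)%type R, coupling P Q p.
Proof.
move=> HP H_inc KQ K_inc.
have [G [HK GK PE]] := cdf_quantile HP H_inc.
have [L [KK LK QE]] := cdf_quantile KQ K_inc.
have [p cp _] := coupling_maps (measurable_quantile H_inc GK)
  (measurable_quantile K_inc LK) PE QE.
by exists p.
Qed.

(** At a common level [u] the two quantiles satisfy [H (G u) - H (L u) = K (L u) - H (L u) - k],
    which is at most [e] in absolute value; as [H] has slope at least [c], they are within [e / c].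
    The constant [k] absorbs the indeterminacy of distribution functions. *)
Lemma wasserstein_cdf_le H K P Q c k e :
  arc_cdf H P -> {homo H : x y / x < y} ->
  arc_cdf K Q -> {homo K : x y / x < y} ->
  0 < c -> (forall x y, x <= y -> c * (y - x) <= H y - H x) ->
  (forall x, `|K x - H x - k| <= e) -> wasserstein Q P <= e / c.
Proof.
move=> HP H_inc KQ K_inc c0 Hc HKe.
have KQ' := arc_cdfD (- k) KQ.
have K_inc' : {homo (fun x => K x - k) : x y / x < y}.
  by move=> x y xy /=; have := K_inc _ _ xy; lra.
have [G [HK GK PE]] := cdf_quantile HP H_inc.
have [L [KK LK QE]] := cdf_quantile KQ' K_inc'.
have e0 : 0 <= e by exact: le_trans (HKe 0).
apply: (wasserstein_le_maps (measurable_quantile K_inc' LK)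
  (measurable_quantile H_inc GK) QE PE).
  by rewrite divr_ge0// ltW.
move=> z; apply: le_trans (circle_dist_le _ _) _.
rewrite distrC ler_pdivlMr//; set u := circle_section z.
have := HKe (L u); rewrite -/u.
have -> : K (L u) - H (L u) - k = H (G u) - H (L u).
  by have /= := LK u; rewrite GK; lra.
have [h|/ltW h] := leP (L u) (G u) => He.
  rewrite (@ger0_norm _ (G u - L u)) ?subr_ge0//.
  by have := le_trans (ler_norm _) He; have := Hc _ _ h; lra.
rewrite (@ler0_norm _ (G u - L u)) ?subr_le0//.
by rewrite distrC in He; have := le_trans (ler_norm _) He; have := Hc _ _ h; lra.
Qed.

Section lower.
Variables (P Q : probability (circle R) R).
Variables (p : probability (circle R * circle R)%type R).
Hypothesis cp : coupling P Q p.
Variables (N : nat) (A : 'I_N -> set (circle R)).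
Hypothesis mA : forall i, measurable (A i).
Let count z : R := \sum_i \1_(A i) z.

Let mcount : measurable_fun setT count.
Proof. by apply: measurable_sum => i; exact: measurable_indic. Qed.

Let count_ge0 z : 0 <= count z.
Proof. exact: sumr_ge0. Qed.

Let integral_count (f : circle R * circle R -> circle R) : measurable_fun setT f ->
  (\int[p]_z (count (f z))%:E = \sum_i p (f @^-1` A i))%E.
Proof.
move=> mf.
have mfA i : measurable (f @^-1` A i).
  by rewrite -[X in measurable X]setTI; exact: mf.
under eq_integral do rewrite /count -sumEFin.
rewrite ge0_integral_sum//.
- apply: eq_bigr => i _.
  have := @integral_indic _ _ R p setT measurableT _ (mfA i).
  by rewrite setIT => <-.
- move=> i; apply/measurable_EFinP; apply: measurableT_comp => //.
Qed.

(* [circle_dist z w <= s / 2 + circle_dist z w ^+ 2 / (2 s)] by AM-GM. *)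
Lemma transport_cost_count (L s : R) : 0 <= L -> 0 < s ->
  (forall z w, `|count z - count w| <= L * circle_dist z w + 1) ->
  `|\sum_i (fine (P (A i)) - fine (Q (A i)))| <=
    L * (s / 2 + (2 * s)^-1 * fine (transport_cost p)) + 1.
Proof.
move=> L0 s0 cL; set c := fine (transport_cost p).
have cE : transport_cost p = c%:E.
  rewrite fineK// ge0_fin_numE ?transport_cost_ge0//.
  by apply: le_lt_trans (transport_cost_le1 _) _; rewrite ltry.
have PE i : P (A i) = p (fst @^-1` A i) by have [<-] := cp (mA i).
have QE i : Q (A i) = p (snd @^-1` A i) by have [_ <-] := cp (mA i).
pose h (z : circle R * circle R) :=
  L * (s / 2 + (2 * s)^-1 * circle_dist z.1 z.2 ^+ 2) + 1.
have s20 : 0 <= (2 * s)^-1 by rewrite invr_ge0; lra.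
have hE : (\int[p]_z (h z)%:E = (L * (s / 2 + (2 * s)^-1 * c) + 1)%:E)%E.
  rewrite (eq_integral (fun z => (L * (2 * s)^-1)%:E *
    (circle_dist z.1 z.2 ^+ 2)%:E + cst (L * s / 2 + 1)%:E z)%E); last first.
    by move=> z _; rewrite /h/= -EFinM -EFinD; congr EFin; ring.
  have d2 := @measurable_circle_dist2 R.
  rewrite ge0_integralD//; last 3 first.
  - move=> z _; rewrite mule_ge0// lee_fin ?sqr_ge0// mulr_ge0//.
  - exact: measurable_funeM.
  - by move=> z _; rewrite lee_fin; have := mulr_ge0 L0 (ltW s0); lra.
  rewrite ge0_integralZl_EFin//; last 2 first.
  - by move=> z _; rewrite lee_fin sqr_ge0.
  - by rewrite mulr_ge0.
  rewrite -/(transport_cost p) cE integral_cst//.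
  rewrite [X in (_ + _ * X)%E](_ : _ = 1%E) ?mule1; last first.
    exact: (@probability_setT _ _ _ p).
  by rewrite -EFinM -EFinD; congr EFin; ring.
have key f g : measurable_fun setT f -> measurable_fun setT g ->
    (forall z, count (f z) - count (g z) <= L * circle_dist z.1 z.2 + 1) ->
    \sum_i (fine (p (f @^-1` A i)) - fine (p (g @^-1` A i))) <=
      L * (s / 2 + (2 * s)^-1 * c) + 1.
  move=> mf mg fg.
  have fin k i : measurable_fun setT k -> p (k @^-1` A i) = (fine (p (k @^-1` A i)))%:E.
    move=> mk; rewrite fineK// fin_num_measure//.
    by rewrite -[X in measurable X]setTI; exact: mk.
  rewrite sumrB lerBlDl -lee_fin EFinD -hE -!sumEFin.
  under eq_bigr do rewrite -fin//.
  under [in leRHS]eq_bigr do rewrite -fin//.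
  rewrite -!integral_count// -ge0_integralD//; last 4 first.
  - by move=> z _; rewrite lee_fin.
  - by apply/measurable_EFinP; exact: measurableT_comp.
  - move=> z _; rewrite lee_fin /h addr_ge0// mulr_ge0// addr_ge0//.
      by rewrite divr_ge0// ltW.
    by rewrite mulr_ge0// sqr_ge0.
  - have d2 := @measurable_circle_dist R.
    apply/measurable_EFinP; apply: measurable_funD => //.
    apply: measurable_funM => //; apply: measurable_funD => //.
    by apply: measurable_funM => //; exact: measurable_funX.
  apply: ge0_le_integral => //.
  - by move=> z _; rewrite lee_fin.
  - by apply/measurable_EFinP; exact: measurableT_comp.
  - apply: emeasurable_funD; apply/measurable_EFinP; first exact: measurableT_comp.
    have d2 := @measurable_circle_dist R.
    apply: measurable_funD => //.
    apply: measurable_funM => //; apply: measurable_funD => //.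
    by apply: measurable_funM => //; exact: measurable_funX.
  move=> z _; rewrite -EFinD lee_fin -lerBlDl; apply: le_trans (fg z) _.
  rewrite lerD2r ler_wpM2l//.
  have -> : s / 2 + (2 * s)^-1 * circle_dist z.1 z.2 ^+ 2 =
      circle_dist z.1 z.2 + (2 * s)^-1 * (circle_dist z.1 z.2 - s) ^+ 2.
    by field; rewrite gt_eqF.
  by rewrite lerDl mulr_ge0// sqr_ge0.
rewrite ler_norml; apply/andP; split.
  rewrite lerNl -sumrN.
  under eq_bigr do rewrite opprB PE QE.
  apply: key => // z; apply: le_trans (cL z.1 z.2); rewrite distrC; exact: ler_norm.
under eq_bigr do rewrite PE QE.
by apply: key => // z; apply: le_trans (cL z.1 z.2); exact: ler_norm.
Qed.

End lower.

(** A discretized Kantorovich duality: after division by [N], the error 1 in the Lipschitz bound of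
    the counting function vanishes as [N] grows. The choice [s = k / L] turns the limit inequality
    into [s ^+ 2 <= c]. *)
Lemma wasserstein_ge P Q L k : 0 < L -> 0 <= k ->
  (exists p : probability (circle R * circle R)%type R, coupling P Q p) ->
  (forall N, (0 < N)%N -> exists2 A : 'I_N -> set (circle R),
    (forall i, measurable (A i)) /\
    (forall z w, `|\sum_i \1_(A i) z - \sum_i \1_(A i) w : R| <=
       N%:R * L * circle_dist z w + 1) &
    N%:R * k <= `|\sum_i (fine (P (A i)) - fine (Q (A i)))|) ->
  k / L <= wasserstein P Q.
Proof.
move=> L0 k0 Pp PQ; apply: le_wasserstein => // [|p cp].
  by rewrite divr_ge0// ltW.
have [->|kn0] := eqVneq k 0; first by rewrite mul0r expr0n transport_cost_ge0.
have {}k0 : 0 < k by rewrite lt_def kn0.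
set c := fine (transport_cost p).
have cE : transport_cost p = c%:E.
  rewrite fineK// ge0_fin_numE ?transport_cost_ge0//.
  by apply: le_lt_trans (transport_cost_le1 _) _; rewrite ltry.
rewrite cE lee_fin.
pose s := k / L; have s0 : 0 < s by rewrite divr_gt0.
have h N : (0 < N)%N -> N%:R * (k - L * (s / 2 + (2 * s)^-1 * c)) <= 1.
  move=> N0; have [A [mA cA] kA] := PQ N N0.
  have NL : 0 <= N%:R * L by rewrite mulr_ge0// ltW.
  have := transport_cost_count cp mA NL s0 cA; rewrite -/c.
  move=> /(le_trans kA) hh.
  rewrite mulrBr (mulrA _ L) lerBlDl; exact: hh.
have : k - L * (s / 2 + (2 * s)^-1 * c) <= 0.
  rewrite leNgt; apply/negP => b0.
  set b := _ - _ in b0 h.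
  have := h (Num.truncn b^-1).+1 isT; apply/negP; rewrite -ltNge.
  rewrite -(ltr_pdivrMr _ _ b0) mul1r; exact: truncnS_gt.
rewrite -/s; have -> : k - L * (s / 2 + (2 * s)^-1 * c) =
    L / (2 * s) * (s ^+ 2 - c).
  have -> : k = L * s by rewrite /s mulrC divfK// gt_eqF.
  by field; rewrite gt_eqF.
rewrite pmulr_rle0 ?subr_le0// divr_gt0//; lra.
Qed.

End wasserstein_cdf.

(** * Lower bound for an invariant distribution function *)

Section density.
Variable R : realType.
Local Notation leb := (@lebesgue_measure R).

(** Compactness in its near-covering form: a radius that works near each point works on the whole
    segment. Only [x] is confined to the segment. *)
Lemma segment_unif_continuous (g : R -> R) (a b e : R) : continuous g -> 0 < e ->
  exists2 h, 0 < h & forall x y, a <= x <= b -> `|x - y| < h -> `|g x - g y| < e.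
Proof.
move=> cg e0.
have cK : compact `[a, b]%classic by exact: segment_compact.
pose P (h x : R) := forall y, `|x - y| < h -> `|g x - g y| < e.
have cov : forall x, `[a, b]%classic x -> \forall x' \near x & i \near 0^'+, P i x'.
  move=> x _; have e20 : 0 < e / 2 by rewrite divr_gt0.
  have /cvgrPdist_lt/(_ _ e20)/nbhs_ballP[r /= r0 hr] := cg x.
  exists (ball x (r / 2), [set h | h < r / 2]) => /=.
    split; first by apply: nbhsx_ballx; rewrite divr_gt0.
    by apply: nbhs_right_lt; rewrite divr_gt0.
  move=> [x' h] [/= xx' hr2] y x'y.
  have hx' : `|g x - g x'| < e / 2.
    by apply: hr; move: xx'; rewrite /ball/=; lra.
  have hy : `|g x - g y| < e / 2.
    apply: hr; rewrite /ball/= -(subrKA x'); apply: le_lt_trans (ler_normD _ _) _.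
    by move: xx'; rewrite /ball/=; lra.
  rewrite -(subrKA (g x)) (le_lt_trans (ler_normD _ _))// distrC; lra.
have := (compact_near_coveringP `[a, b]%classic).1 cK _ _ P _ cov.
move=> /(_ _) H.
have /filter_ex[h [h0 hP]] : \forall h \near 0^'+, 0 < h /\ `[a, b]%classic `<=` P h.
  by apply: filterI; [exact: nbhs_right_gt|exact: H].
exists h => // x y xab; apply: hP.
by rewrite /= in_itv.
Unshelve. all: by end_near. Qed.

Lemma integral_circle_lebesgue (f : circle R -> \bar R) (A : set (circle R)) :
  measurable A -> measurable_fun setT f -> (forall z, 0 <= f z)%E ->
  (\int[@circle_lebesgue R]_(z in A) f z =
   \int[leb]_(x in @circle_pi R @^-1` A `&` `[0%R, 1%R[%classic) f (circle_pi x))%E.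
Proof.
move=> mA mf f0.
have mpi := @measurable_circle_pi R.
pose D : set (measurableTypeR R) := `[0, 1[%classic.
have mD : measurable D by exact: measurable_itv.
pose m := mrestr leb mD.
have mpre : measurable (@circle_pi R @^-1` A).
  by rewrite -[X in measurable X]setTI; exact: mpi.
have mfpi : measurable_fun setT (f \o @circle_pi R) by exact: measurableT_comp.
transitivity (\int[pushforward m (@circle_pi R)]_(z in A) f z)%E.
  apply: eq_measure_integral => B mB _.
  change (leb (D `&` @circle_pi R @^-1` B) = leb (@circle_pi R @^-1` B `&` D)).
  by rewrite setIC.
rewrite ge0_integral_pushforward//; last exact: measurable_funS mf.
have mND : measurable (~` D) by exact: measurableC.
have mfA : measurable_fun (@circle_pi R @^-1` A) (f \o @circle_pi R).
  exact: measurable_funS mfpi.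
have m0 : m (~` D) = 0%E by rewrite /m /mrestr setICl measure0.
rewrite (@ge0_negligible_integral _ _ _ _ _ (~` D))//; last by move=> x _; exact: f0.
rewrite setDE setCK; apply: eq_measure_integral => B mB BD.
suff : leb (B `&` D) = leb B by [].
by rewrite setIidl// => x /BD [].
Qed.

Lemma integral_arc_lebesgue (f : circle R -> \bar R) (s t : R) :
  0 <= s -> s <= t -> t < 1 -> measurable_fun setT f -> (forall z, 0 <= f z)%E ->
  (\int[@circle_lebesgue R]_(z in arc s t) f z =
   \int[leb]_(x in `[s, t]%classic) f (circle_pi x))%E.
Proof.
move=> s0 st t1 mf f0.
rewrite integral_circle_lebesgue//; last by apply: measurable_arc; lra.
rewrite (_ : _ `&` _ = `[s, t]%classic)//.
apply/seteqP; split=> x /=; rewrite !in_itv/=.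
  move=> [/arcP[n hn] x01]; suff n0 : n = 0 by move: hn; rewrite n0 addr0.
  by apply: (@eq_int_dist_lt1 R); rewrite subr0 ltr_norml; lra.
by move=> xst; split; [exists x|lra].
Qed.

(* With [g] a continuous [L^1]-approximation of [rho], take [r] for the positive part
   of [g] and [V] for the primitive of [|rho - g|]. *)
Lemma density_local_approx (rho : circle R -> R) (m : probability (circle R) R) (e : R) :
  has_density rho m -> 0 < e ->
  exists h (r V : R -> R), [/\ 0 < h,
    forall s t, 0 <= s -> s <= t -> t < 1 -> 0 <= V t - V s <= e &
    forall z s t, 0 <= z -> z <= s -> s <= t -> t < 1 -> t - z < h ->
      `|fine (m (arc s t)) - r z * (t - s)| <= e * (t - s) + (V t - V s)].
Proof.
move=> [mrho rho0 mE] e0.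
have mpi := @measurable_circle_pi R.
pose R0 (x : R) := rho (circle_pi x).
have mR0 : measurable_fun setT (R0 : measurableTypeR R -> R) by exact: measurableT_comp.
pose D : set (measurableTypeR R) := `[0, 1[%classic.
have mD : measurable D by exact: measurable_itv.
have Dfin : (leb D < +oo)%E.
  by rewrite /D lebesgue_measure_itv/= lte_fin ltr01 -EFinD ltry.
have mEarc s t : 0 <= s -> s <= t -> t < 1 ->
    m (arc s t) = (\int[leb]_(x in `[s, t]%classic) (R0 x)%:E)%E.
  move=> s0 st t1; rewrite mE; last by apply: measurable_arc; lra.
  by rewrite integral_arc_lebesgue//; exact/measurable_EFinP.
have intR0 : leb.-integrable D (EFin \o R0).
  apply/integrableP; split; first by apply/measurable_EFinP; exact: measurable_funS mR0.
  have := mE setT measurableT; rewrite integral_circle_lebesgue//; last exact/measurable_EFinP.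
  rewrite preimage_setT setTI -/D => mT.
  under eq_integral => x _ do rewrite gee0_abs ?lee_fin ?rho0//.
  by rewrite -mT; apply: le_lt_trans (probability_le1 _ _) _; rewrite ?ltry.
have [g_ [cg ig /fine_cvgP[gfin gcv]]] := approximation_continuous_integrable mD Dfin intR0.
have [g {}cg [{}ig intg]] : exists2 g : R -> R, continuous g & leb.-integrable D (EFin \o g) /\
    (\int[leb]_(z in D) `|(R0 z - g z)%:E| <= e%:E)%E.
  have /cvgrPdist_lt/(_ e e0) He := gcv.
  have [n [nfin ne]] := filter_ex (filterI gfin He).
  exists (g_ n); [exact: cg|split; first exact: ig].
  rewrite -[leLHS]fineK// lee_fin ltW//.
  by move: ne; rewrite /= sub0r normrN; apply: le_lt_trans; exact: ler_norm.
have e20 : 0 < e by [].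
have [h h0 hg] := @segment_unif_continuous g 0 1 e cg e20.
pose d (x : R) := `|(R0 x - g x)%:E|%E.
have d0 x : (0 <= d x)%E by exact: abse_ge0.
have md : measurable_fun setT (d : measurableTypeR R -> \bar R).
  apply: measurableT_comp => //; apply/measurable_EFinP; apply: measurable_funB => //.
  exact: continuous_measurable_fun.
pose VE t := (\int[leb]_(x in `[0%R, t]%classic) d x)%E.
pose V t := fine (VE t).
have VEe t : t < 1 -> (VE t <= e%:E)%E.
  move=> t1; apply: le_trans intg; apply: ge0_subset_integral => //.
    exact: measurable_funS md.
  by move=> x; rewrite /D/= !in_itv/= => /andP[-> /le_lt_trans ->].
have VE0 t : (0 <= VE t)%E by apply: integral_ge0.
have VEfin t : t < 1 -> VE t = (V t)%:E.
  by move=> t1; rewrite fineK// ge0_fin_numE// (le_lt_trans (VEe t t1))// ltry.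
have VD : forall s t, 0 <= s -> s <= t -> t < 1 ->
    (\int[leb]_(x in `[s, t]%classic) d x = (V t - V s)%:E)%E.
  move=> s t s0 st t1; have s1 : s < 1 by lra.
  have mdst : measurable_fun `]s, t] (d : measurableTypeR R -> \bar R).
    exact: measurable_funS md.
  rewrite -integral_itv_obnd_cbnd//.
  have E : (VE t = VE s + \int[leb]_(x in `]s, t]%classic) d x)%E.
    rewrite /VE -ge0_integral_setU//.
    - rewrite (_ : _ `|` _ = `[0, t]%classic)//.
      apply/seteqP; split=> x /=; rewrite !in_itv/=; first by move=> []; lra.
      by move=> xt; have [xs|xs] := leP x s; [left|right]; lra.
    - exact: measurable_funS md.
    - by apply/disj_setPS => x /=; rewrite !in_itv/= => -[]; lra.
  move: E; by rewrite !VEfin// => E; rewrite EFinB E addeAC subee// add0e.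
exists h, (fun z => Num.max (g z) 0), V; split=> //.
  move=> s t s0 st t1; have s1 : s < 1 by lra.
  have : (0 <= (V t - V s)%:E)%E by rewrite -VD//; exact: integral_ge0.
  rewrite lee_fin => -> /=.
  have := VEe t t1; have := VE0 s; rewrite !VEfin// !lee_fin; lra.
move=> z s t z0 zs st t1 tzh.
have s0 : 0 <= s by lra.
have lst : leb `[s, t]%classic = (t - s)%:E.
  rewrite lebesgue_measure_itv/= lte_fin; case: ifPn => [_|]; first by rewrite -EFinB.
  by rewrite -leNgt => ts; rewrite (_ : s = t) ?subrr//; lra.
set r := Num.max (g z) 0.
have r0 : 0 <= r by rewrite le_max lexx orbT.
have mst : measurable (`[s, t]%classic : set (measurableTypeR R)) by exact: measurable_itv.
have gz x : x \in `[s, t] -> `|g z - g x| < e.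
  by rewrite in_itv/= => xst; apply: hg; [lra|rewrite ler0_norm; lra].
have mfin : m (arc s t) = (fine (m (arc s t)))%:E.
  by rewrite fineK// fin_num_measure//; apply: measurable_arc; lra.
have cint (c : R) : (\int[leb]_(x in `[s, t]%classic) (cst c%:E x) = (c * (t - s))%:E)%E.
  by rewrite integral_cst// [X in (_ * X)%E](_ : _ = (t - s)%:E).
have mdst : measurable_fun `[s, t] (d : measurableTypeR R -> \bar R).
  exact: measurable_funS md.
have mRst : measurable_fun `[s, t] (fun x : measurableTypeR R => (R0 x)%:E).
  by apply/measurable_EFinP; exact: measurable_funS mR0.
have up : fine (m (arc s t)) <= (r + e) * (t - s) + (V t - V s).
  rewrite -lee_fin -mfin mEarc// EFinD -cint -VD// -ge0_integralD//; last first.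
    by move=> x _; rewrite /= lee_fin addr_ge0// ltW.
  apply: ge0_le_integral => //.
  - by move=> x _; rewrite lee_fin; exact: rho0.
  - exact: emeasurable_funD.
  move=> x xst; rewrite /d/= -EFinD lee_fin.
  have := gz x; rewrite inE => /(_ xst); rewrite ltr_norml => hx.
  have : g z <= r by rewrite le_max lexx.
  have := ler_norm (R0 x - g x); lra.
(* The truncation at 0 makes the constant integrand nonnegative, as the comparison of integrals
   requires. *)
have dn : (Num.max (r - e) 0) * (t - s) <= fine (m (arc s t)) + (V t - V s).
  rewrite -lee_fin EFinD -mfin mEarc// -cint -VD// -ge0_integralD//; last first.
    by move=> x _; rewrite /= lee_fin; exact: rho0.
  apply: ge0_le_integral => //.
  - by move=> x _; rewrite /= lee_fin le_max lexx orbT.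
  - exact: emeasurable_funD.
  move=> x xst; rewrite /d/= -EFinD lee_fin.
  have := gz x; rewrite inE => /(_ xst); rewrite ltr_norml => hx.
  have Rx : 0 <= R0 x by exact: rho0.
  have := ler_norm (g x - R0 x); rewrite distrC => h1.
  have h2 := normr_ge0 (R0 x - g x).
  rewrite ge_max; apply/andP; split; last by lra.
  by rewrite /r; case: (leP (g z) 0) => gz0; lra.
have : (r - e) * (t - s) <= Num.max (r - e) 0 * (t - s).
  by apply: ler_wpM2r; [lra|rewrite le_max lexx].
by rewrite ler_norml; lra.
Qed.
End density.

(** * Orientation signs and geometric growth *)

Section sign.
Variable R : realType.
Implicit Types (e x y : R).

Definition is_sign e := e = 1 \/ e = -1.

Lemma is_signX e k : is_sign e -> is_sign (e ^+ k).
Proof.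
move=> es; elim: k => [|k [] ih]; rewrite ?expr0 ?exprS ?ih ?mulr1 ?mulrN1; first by left.
  exact: es.
by case: es => ->; [right|left]; rewrite ?opprK.
Qed.

Lemma is_sign_sqr e : is_sign e -> e * e = 1.
Proof. by case=> ->; rewrite ?mulrNN mulr1. Qed.

Lemma circle_piN x : circle_pi (- x) = - circle_pi x.
Proof. by rewrite -[- x]sub0r circle_piB circle_pi0 sub0r. Qed.

Lemma arcN x y (z : circle R) : arc x y (- z) <-> arc (- y) (- x) z.
Proof.
by split=> -[t /= ht tz]; exists (- t) => /=; rewrite ?circle_piN ?tz ?opprK//; lra.
Qed.

(* An orientation-reversing lift is replaced by its opposite, at the price of
   reflecting the arc; the shift by 1 keeps it in [[0, 1]]. *)
Lemma signed_lift_preimage_arc (f : R -> R) e (Phi : circle R -> circle R) x y :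
  is_sign e -> (forall t, circle_pi (e * f t) = Phi (circle_pi t)) ->
  exists Phi0 a b, [/\ forall t, circle_pi (f t) = Phi0 (circle_pi t),
    (a = x /\ b = y /\ e = 1) \/ (a = 1 - y /\ b = 1 - x /\ e = -1) &
    forall n : int, Phi @^-1` arc x y = Phi0 @^-1` arc (a + n%:~R) (b + n%:~R)].
Proof.
move=> [->|->] fPhi.
  exists Phi, x, y; split=> [t||n]; [by rewrite -fPhi mul1r|by left|].
  by rewrite arcDz.
exists (fun z => - Phi z), (1 - y), (1 - x); split=> [t||n]; last 2 first.
- by right.
- have E (u : R) : 1 - u + (- 1)%:~R = - u by rewrite mulrNz mulr1z; ring.
  rewrite arcDz -(arcDz (1 - y) (1 - x) (- 1)) !E; apply/seteqP.
  split=> z; rewrite /preimage/=; last by move=> /arcN; rewrite !opprK.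
  by move=> h; apply/arcN; rewrite !opprK.
by rewrite -fPhi mulN1r circle_piN opprK.
Qed.

End sign.

Section geometric.
Variable R : realType.

Lemma sum_geometric_le2 (q : R) N : 0 <= q <= 2^-1 -> \sum_(k < N) q ^+ k <= 2.
Proof.
move=> hq; have q0 : 0 <= q by lra.
(* The added term dominates the tail of the series and makes the induction close. *)
suff : \sum_(k < N) q ^+ k + 2 * q ^+ N <= 2.
  by have := exprn_ge0 N q0; lra.
elim: N => [|N ih]; first by rewrite big_ord0 expr0; lra.
rewrite big_ord_recr/= exprS.
have : q * q ^+ N <= 2^-1 * q ^+ N by rewrite ler_wpM2r ?exprn_ge0//; lra.
lra.
Qed.

(** Bernoulli's inequality: [l ^+ k >= 1 + k (l - 1)]. *)
Lemma expr_unbounded (l w : R) : 1 < l -> 0 < w -> exists k, 1 <= w * l ^+ k.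
Proof.
move=> l1 w0; have lk k : 1 + k%:R * (l - 1) <= l ^+ k.
  elim: k => [|k ih]; first by rewrite mul0r addr0 expr0.
  rewrite exprS -natr1.
  have h1 : l * (1 + k%:R * (l - 1)) <= l * l ^+ k by apply: ler_wpM2l => //; lra.
  have : 0 <= k%:R * ((l - 1) * (l - 1)).
    by rewrite mulr_ge0// mulr_ge0 ?subr_ge0 ?ltW.
  lra.
have wl : 0 < w * (l - 1) by rewrite mulr_gt0 ?subr_gt0.
exists (Num.truncn (w * (l - 1))^-1).+1; set k := _.+1.
apply: le_trans (ler_wpM2l (ltW w0) (lk k)).
have : 1 <= k%:R * (w * (l - 1)) by rewrite -ler_pdivrMr// mul1r ltW// truncnS_gt.
lra.
Qed.

End geometric.

(** * Expansion and distortion of compositions *)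

Section distortion.
Variable R : realType.
Implicit Types (x y : R).

(** A form without derivatives: the mean slope on a subinterval is at most [1 + B (y - x)] times the
    mean slope on the interval. *)
Definition bounded_distortion (l B : R) (h : R -> R) :=
  (forall x y, x <= y -> l * (y - x) <= h y - h x) /\
  (forall x x' y' y, x <= x' -> x' <= y' -> y' <= y ->
    (h y' - h x') * (y - x) <= (1 + B * (y - x)) * (y' - x') * (h y - h x)).

Lemma bounded_distortion_sym l B h : bounded_distortion l B h ->
  bounded_distortion l B (fun x => - h (- x)).
Proof.
move=> [h1 h2]; split=> [x y xy|x x' y' y xx' x'y' y'y].
  have yx : - y <= - x by rewrite lerN2.
  by have := h1 _ _ yx; lra.
have a1 : - y <= - y' by rewrite lerN2.
have a2 : - y' <= - x' by rewrite lerN2.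
have a3 : - x' <= - x by rewrite lerN2.
by have := h2 _ _ _ _ a1 a2 a3; lra.
Qed.

(** The maps may change from step to step: for a reversed orientation, the increasing version of the
    iterate alternates between the lift and its reflection. *)
Fixpoint iter_maps (h : nat -> R -> R) (k : nat) (x : R) : R :=
  if k is k'.+1 then h k' (iter_maps h k' x) else x.

Variables (l B : R) (h : nat -> R -> R).
Hypotheses (l1 : 1 < l) (B0 : 0 <= B).
Hypothesis hd : forall i, bounded_distortion l B (h i).
Local Notation F := (iter_maps h).

Let l0 : 0 < l. Proof. have := l1. lra. Qed.

Lemma iter_maps_expand k x y : x <= y -> l ^+ k * (y - x) <= F k y - F k x.
Proof.
move=> xy; elim: k => [|k ih] /=; first by rewrite mul1r.
have Fxy : F k x <= F k y.
  rewrite -subr_ge0; apply: le_trans ih.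
  by rewrite mulr_ge0 ?subr_ge0// exprn_ge0// ltW.
apply: le_trans ((hd k).1 _ _ Fxy).
by rewrite exprS -mulrA ler_pM2l.
Qed.

Lemma iter_maps_le k x y : x <= y -> F k x <= F k y.
Proof.
move=> xy; rewrite -subr_ge0; apply: le_trans (iter_maps_expand k xy).
by rewrite mulr_ge0 ?subr_ge0// exprn_ge0// ltW.
Qed.

(* The exponents add up to a geometric series: the length of the image of [x, y]
   under the first [k] maps is at most 1/l times that under [k + 1] maps. *)
Lemma iter_maps_distortion k x x' y' y : x <= x' -> x' <= y' -> y' <= y ->
  (F k y' - F k x') * (y - x) <=
    expR (B / (l - 1) * (F k y - F k x)) * (y' - x') * (F k y - F k x).
Proof.
move=> xx' x'y' y'y; have xy : x <= y by lra.
elim: k => [|k ih] /=.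
  rewrite -mulrA; apply: ler_peMl; first by rewrite mulr_ge0 ?subr_ge0.
  by rewrite -[leLHS]expR0 ler_expR mulr_ge0 ?subr_ge0// divr_ge0 ?subr_ge0// ltW.
have [xey|xney] := eqVneq x y.
  have -> : y' - x' = 0 by subst y; lra.
  have -> : x' = y' by subst y; lra.
  by rewrite !subrr mulr0 !mul0r.
have {}xy : x < y by rewrite lt_neqAle xney.
set a := F k x in ih *; set a' := F k x' in ih *.
set b' := F k y' in ih *; set b := F k y in ih *.
have ab : 0 < b - a.
  apply: lt_le_trans (iter_maps_expand k (ltW xy)).
  by rewrite mulr_gt0 ?subr_gt0// exprn_gt0.
have [h1 h2] := hd k.
have aa' : a <= a' by exact: iter_maps_le.
have a'b' : a' <= b' by exact: iter_maps_le.
have b'b : b' <= b by exact: iter_maps_le.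
have ab' : a <= b by lra.
have e1 := h2 _ _ _ _ aa' a'b' b'b.
have e2 := h1 _ _ ab'.
set E1 := expR (B / (l - 1) * (b - a)) in ih.
set E2 := expR _.
have hab0 : 0 <= h k b - h k a by apply: le_trans e2; rewrite mulr_ge0 ?subr_ge0// ltW.
(* The exponent reproduces itself because [B + B / (l - 1) = B / (l - 1) * l] and the next image is
   at least [l] times as long. *)
have E12 : (1 + B * (b - a)) * E1 <= E2.
  apply: (le_trans (y := expR (B * (b - a)) * E1)).
    by rewrite ler_wpM2r ?expR_ge0// expR_ge1Dx.
  rewrite /E1 /E2 -expRD ler_expR.
  have -> : B * (b - a) + B / (l - 1) * (b - a) = B / (l - 1) * (l * (b - a)).
    by field; rewrite gt_eqF// subr_gt0.
  by rewrite ler_wpM2l// divr_ge0// subr_ge0 ltW.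
rewrite -(ler_pM2r ab).
have -> : (h k b' - h k a') * (y - x) * (b - a) =
  (h k b' - h k a') * (b - a) * (y - x) by ring.
apply: (le_trans (y := (1 + B * (b - a)) * (b' - a') * (h k b - h k a) * (y - x))).
  by rewrite ler_wpM2r// subr_ge0 ltW.
have -> : (1 + B * (b - a)) * (b' - a') * (h k b - h k a) * (y - x) =
  (1 + B * (b - a)) * (h k b - h k a) * ((b' - a') * (y - x)) by ring.
have c0 : 0 <= (1 + B * (b - a)) * (h k b - h k a).
  by rewrite mulr_ge0// addr_ge0// mulr_ge0// ltW.
apply: le_trans (ler_wpM2l c0 ih) _.
have -> : (1 + B * (b - a)) * (h k b - h k a) * (E1 * (y' - x') * (b - a)) =
  (1 + B * (b - a)) * E1 * ((y' - x') * (h k b - h k a) * (b - a)) by ring.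
have -> : E2 * (y' - x') * (h k b - h k a) * (b - a) =
  E2 * ((y' - x') * (h k b - h k a) * (b - a)) by ring.
apply: ler_wpM2r => //; apply: mulr_ge0; last exact: ltW.
by apply: mulr_ge0 => //; rewrite subr_ge0.
Qed.

End distortion.

(* [F] is meant to be a lift of an iterate of the map, or the opposite of one: it
   cuts [[0, 1]] into the short intervals between consecutive points of [G @` int]. On
   each of these, [M] is nearly a multiple of the identity up to the variation of [V],
   so that a proportion at least [(b - a) / C] of it survives. *)
Section cylinder_estimate.
Variable R : realType.
Variables (M F G : R -> R) (D : nat) (C : R).
Hypothesis M_nd : {homo M : x y / x <= y}.
Hypotheses (FK : cancel F G) (GK : cancel G F).
Hypothesis F_inc : {homo F : x y / x < y}.
Hypothesis FD : forall x, F (x + 1) = F x + D%:R.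
Hypothesis D0 : (0 < D)%N.
Hypothesis C0 : 0 < C.
Hypothesis F_dist : forall x x' y' y, x <= x' -> x' <= y' -> y' <= y ->
  F y - F x = 1 -> (F y' - F x') * (y - x) <= C * (y' - x').
Variables (r V : R -> R) (e w : R).
Hypothesis e0 : 0 < e.
Hypothesis V_nd : forall s t, 0 <= s -> s <= t -> t < 1 -> 0 <= V t - V s <= e.
Hypothesis M_approx : forall z s t, 0 <= z -> z <= s -> s <= t -> t < 1 ->
  t - z <= w -> `|M t - M s - r z * (t - s)| <= e * (t - s) + (V t - V s).
Hypothesis F_exp : forall x y, x <= y -> F y - F x <= 1 -> y - x <= w.
Hypothesis M_ends : forall x y, 0 <= x <= w -> 1 - w <= y <= 1 -> 1 - e <= M y - M x.

Lemma cylinder_estimate (i : int) (a b : R) :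
  i%:~R - 1 < F 0 <= i%:~R -> i%:~R <= a -> a <= b -> b <= i%:~R + 1 ->
  C^-1 * (b - a) * (1 - 4 * e) - e <=
    \sum_(j < D) (M (G (b + j%:R)) - M (G (a + j%:R))).
Proof.
move=> /andP[iF0 F0i] ia ab bi; have e_gt0 := e0.
have G_inc := inverse_increasing GK F_inc.
have G_nd : {homo G : x y / x <= y}.
  by move=> x y; rewrite le_eqVlt => /orP[/eqP->//|/G_inc/ltW].
pose z (j : nat) := G (i%:~R + j%:R).
pose s (j : nat) := G (a + j%:R); pose t (j : nat) := G (b + j%:R).
have zs j : z j <= s j by apply: G_nd; lra.
have st j : s j <= t j by apply: G_nd; lra.
have tz j : t j <= z j.+1 by apply: G_nd; rewrite -natr1; lra.
have Fz j : F (z j.+1) - F (z j) = 1 by rewrite !GK -natr1; ring.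
have zz j : z j <= z j.+1 by apply: le_trans (tz j); apply: le_trans (st j).
have zw j : z j.+1 - z j <= w by apply: F_exp; rewrite ?Fz.
have z_nd : {homo z : m n / (m <= n)%N >-> m <= n}.
  by move=> m n mn; apply: G_nd; rewrite lerD2l ler_nat.
have G0 : G (F 0) = 0 by rewrite FK.
have z0 : 0 <= z 0%N by rewrite -G0; apply: G_nd; rewrite addr0.
have z0w : z 0%N <= w.
  rewrite -[leLHS]subr0; apply: F_exp => //; rewrite GK addr0; lra.
have DE : D%:R = (D.-1)%:R + 1 :> R by rewrite natr1 prednK.
have F1 : F 1 = F 0 + (D.-1)%:R + 1 by rewrite -[in LHS](add0r 1) FD DE; ring.
have zn1 : z D.-1 < 1.
  by rewrite -(FK 1); apply: G_inc; rewrite F1; lra.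
have znw : 1 - w <= z D.-1.
  have := F_exp (ltW zn1); rewrite GK F1 => /(_ _); lra.
have C'0 : 0 <= C^-1 by rewrite invr_ge0 ltW.
(* Only the first [D - 1] pieces are estimated, which end before 1; the last one may cross 1, and
   its nonnegative contribution is dropped in [sumD]. *)
have piece j : (j < D.-1)%N ->
    C^-1 * (b - a) * (M (z j.+1) - M (z j) - (V (z j.+1) - V (z j)) -
      2 * e * (z j.+1 - z j)) - (V (z j.+1) - V (z j)) <= M (t j) - M (s j).
  move=> jn.
  have zj0 : 0 <= z j by apply: le_trans z0 _; exact: z_nd.
  have zj1 : z j.+1 < 1 by apply: le_lt_trans zn1; exact: z_nd.
  have tj1 : t j < 1 by exact: le_lt_trans zj1.
  have := zs j; have := st j; have := tz j; have := zw j => h1 h2 h3 h4.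
  have Mz := M_approx zj0 (lexx _) (zz j) zj1 h1.
  have Ms : `|M (t j) - M (s j) - r (z j) * (t j - s j)| <=
      e * (t j - s j) + (V (t j) - V (s j)) by apply: M_approx => //; lra.
  have V1 := V_nd zj0 (zz j) zj1.
  have zjt : z j <= t j by lra.
  have V2 := V_nd zj0 h4 (le_lt_trans h3 tj1).
  have tj0 : 0 <= t j by lra.
  have V3 := V_nd tj0 h2 zj1.
  have Mst := M_nd h3.
  set A := M (z j.+1) - M (z j) - (V (z j.+1) - V (z j)) - 2 * e * (z j.+1 - z j).
  have Ar : A <= (r (z j) - e) * (z j.+1 - z j).
    by move: Mz; rewrite ler_norml /A; lra.
  have ba : (b - a) * (z j.+1 - z j) <= C * (t j - s j).
    have := F_dist (zs j) (st j) (tz j) (Fz j); rewrite !GK.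
    by rewrite (_ : b + j%:R - (a + j%:R) = b - a)//; ring.
  have {}ba : C^-1 * (b - a) * (z j.+1 - z j) <= t j - s j.
    by rewrite -mulrA -ler_pdivlMl ?invr_gt0// invrK.
  have Cba : 0 <= C^-1 * (b - a) by rewrite mulr_ge0// subr_ge0.
  have [re|re] := leP e (r (z j)).
    have h5 : C^-1 * (b - a) * A <= (r (z j) - e) * (t j - s j).
      apply: le_trans (ler_wpM2l Cba Ar) _; rewrite mulrCA.
      by apply: ler_wpM2l => //; rewrite subr_ge0.
    by move: Ms; rewrite ler_norml; lra.
  (* Where [r (z j) < e], the claimed lower bound is at most 0 and monotonicity of [M] suffices. *)
  have A0 : A <= 0.
    apply: le_trans Ar _; rewrite mulr_le0_ge0 ?subr_ge0//; lra.
  have : C^-1 * (b - a) * A <= 0 by rewrite mulr_ge0_le0.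
  lra.
have sumD : \sum_(0 <= j < D.-1) (M (t j) - M (s j)) <=
    \sum_(j < D) (M (G (b + j%:R)) - M (G (a + j%:R))).
  rewrite -(big_mkord xpredT (fun j => M (t j) - M (s j))) -(prednK D0) /=.
  by rewrite big_nat_recr//= lerDl subr_ge0 M_nd.
apply: le_trans sumD.
apply: (le_trans (y := \sum_(0 <= j < D.-1) (C^-1 * (b - a) *
  (M (z j.+1) - M (z j) - (V (z j.+1) - V (z j)) - 2 * e * (z j.+1 - z j)) -
  (V (z j.+1) - V (z j))))); last first.
  by rewrite !big_nat; apply: ler_sum => j /andP[_]; exact: piece.
have tel (u : nat -> R) : \sum_(0 <= j < D.-1) (u j.+1 - u j) = u D.-1 - u 0%N.
  exact: telescope_sumr.
rewrite sumrB -mulr_sumr (tel (V \o z)) sumrB sumrB -mulr_sumr (tel z).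
rewrite (tel (M \o z)) (tel (V \o z)) /=.
have Mn := M_ends (x := z 0%N) (y := z D.-1).
have Vn := V_nd z0 (z_nd _ _ (leq0n D.-1)) zn1.
have Cba : 0 <= C^-1 * (b - a) by rewrite mulr_ge0// subr_ge0.
(* After telescoping, [M] contributes at least [1 - e], [V] costs at most [e] and the lengths at
   most [2 * e], whence [1 - 4 * e]; the variation of [V] outside the product costs the last [e]. *)
have : C^-1 * (b - a) * (1 - 4 * e) <= C^-1 * (b - a) *
    (M (z D.-1) - M (z 0) - (V (z D.-1) - V (z 0)) - 2 * e * (z D.-1 - z 0)).
  apply: ler_wpM2l => //.
  have : 1 - e <= M (z D.-1) - M (z 0) by apply: Mn; lra.
  have : e * (z D.-1 - z 0%N) <= e by rewrite ler_piMr ?ltW//; lra.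
  lra.
lra.
Qed.

End cylinder_estimate.

(** * Lifts of expanding circle maps *)

Section circle_lifts.
Variable R : realType.
Implicit Types (f : R -> R) (x y c : R).

Lemma derivable_continuous f : (forall x, derivable f x 1) -> continuous f.
Proof.
by move=> df x; apply: differentiable_continuous; exact/derivable1_diffP.
Qed.

Lemma derivable_MVT f x y : (forall x, derivable f x 1) -> x <= y ->
  exists2 t, x <= t <= y & f y - f x = derive1 f t * (y - x).
Proof.
move=> df xy; have cf := derivable_continuous df.
have [|t txy ft] := @MVT_segment R f (derive1 f) x y xy _ (continuous_subspaceT cf).
  by move=> t _; rewrite derive1E; exact/derivableP.
by exists t => //; rewrite in_itv in txy.
Qed.

Lemma derive1_quasiperiodic f c : (forall x, derivable f x 1) ->
  (forall x, f (x + 1) = f x + c) -> forall x, derive1 f (x + 1) = derive1 f x.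
Proof.
move=> df fc x; rewrite !derive1E /derive.
apply: (congr1 (fun F : R -> R => lim (F @ 0^'))).
apply/funext => h /=.
have -> : h *: 1 + (x + 1) = h *: 1 + x + 1 by rewrite addrA.
by rewrite !fc; congr (_ *: _); ring.
Qed.

Lemma periodic_bounded f : continuous f -> (forall x, f (x + 1) = f x) ->
  exists a b, forall x, f a <= f x <= f b.
Proof.
move=> cf f1.
have fz x (n : int) : f (x + n%:~R) = f x.
  have f1' y : f (y + 1) = f y + 0 by rewrite addr0.
  by rewrite (quasiperiodicz f1') mulr0 addr0.
have cf' : {within `[0, 1], continuous f} by exact: continuous_subspaceT.
have [a _ ha] := EVT_min (@ler01 R) cf'.
have [b _ hb] := EVT_max (@ler01 R) cf'.
exists a, b => x; have [n hn] := int_shift 0 x.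
have hx : x + n%:~R \in `[0, 1] by rewrite in_itv/=; lra.
by rewrite -(fz x n) ha// hb.
Qed.

(** Two different values would force, by the intermediate value theorem, a value at distance 1/2
    from an integer. *)
Lemma continuous_int_constant f : continuous f -> (forall x, f x \is a Num.int) ->
  forall x y, f x = f y.
Proof.
move=> cf fZ.
have key x y : x <= y -> f x = f y.
  move=> xy; apply/eqP/negPn/negP => fxy.
  have [m fm] := intrP (fZ x); have [n fn] := intrP (fZ y).
  have [t _ ft] : exists2 t, t \in `[x, y] & f t = Num.min (f x) (f y) + 2^-1.
    apply: IVT => //; first exact: continuous_subspaceT.
    rewrite fm fn in fxy *.
    have [h|h] := ltP (m%:~R : R) n%:~R.
      have : m + 1 <= n by rewrite lezD1 -(ltr_int R).
      rewrite -(ler_int R) intrD; lra.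
    have {}h : n%:~R < m%:~R :> R by rewrite lt_neqAle eq_sym fxy.
    have : n + 1 <= m by rewrite lezD1 -(ltr_int R).
    by rewrite -(ler_int R) intrD; lra.
  have : 2^-1 \is a @Num.int R.
    have -> : 2^-1 = f t - Num.min (f x) (f y) by rewrite ft; ring.
    by rewrite rpredB//; case: leP.
  move=> /intrP[k hk]; have : `|k%:~R - 0%:~R| < 1 :> R.
    by rewrite -hk subr0 ger0_norm; lra.
  by move=> /eq_int_dist_lt1 k0; move: hk; rewrite k0; lra.
by move=> x y; have [/key|/ltW/key] := leP x y.
Qed.

(** The difference [f (x + 1) - f x] is continuous and takes integer values. *)
Lemma lift_degree f (Phi : circle R -> circle R) : continuous f -> is_lift f Phi ->
  exists n : int, forall x, f (x + 1) = f x + n%:~R.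
Proof.
move=> cf fPhi; pose u x := f (x + 1) - f x.
have uZ x : u x \is a Num.int.
  by apply/circle_pi_eqP; rewrite !fPhi (circle_piDz x 1).
have cu : continuous u.
  move=> x; apply: continuousB; last exact: cf.
  apply: (@continuous_comp _ _ _ (fun x => x + 1) f); last exact: cf.
  by apply: continuousD => //; exact: cst_continuous.
have [n un] := intrP (uZ 0); exists n => x.
rewrite -un (continuous_int_constant cu uZ 0 x) /u; ring.
Qed.

Lemma constant_sign f : continuous f -> (forall x, 1 < `|f x|) ->
  exists2 e, is_sign e & forall x, 1 < e * f x.
Proof.
move=> cf f1.
have f0 x : f x != 0 by rewrite -normr_gt0; apply: lt_trans (f1 x).
have same x y : x <= y -> (0 < f x) = (0 < f y).
  move=> xy; apply/idP/idP => h; rewrite lt_neqAle eq_sym f0 /= leNgt;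
    apply/negP => h'.
    have [t _ /eqP] : exists2 t, t \in `[x, y] & f t = 0.
      apply: IVT => //; first exact: continuous_subspaceT.
      by rewrite ge_min le_max !(ltW h) !(ltW h') orbT.
    by rewrite (negbTE (f0 t)).
  have [t _ /eqP] : exists2 t, t \in `[x, y] & f t = 0.
    apply: IVT => //; first exact: continuous_subspaceT.
    by rewrite ge_min le_max !(ltW h) !(ltW h') orbT.
  by rewrite (negbTE (f0 t)).
have same0 x : (0 < f x) = (0 < f 0).
  by have [h|/ltW h] := leP x 0; rewrite ?(same _ _ h)// -(same _ _ h).
have [h|h] := ltP 0 (f 0).
  exists 1; first by left.
  by move=> x; rewrite mul1r -[ltRHS]ger0_norm// ltW// same0.
exists (-1); first by right.
move=> x; rewrite mulN1r -[ltRHS]ler0_norm//.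
by rewrite leNgt same0 -leNgt.
Qed.

Lemma norm_between (a b c : R) : a <= b <= c -> `|b| <= `|a| + `|c|.
Proof.
move=> abc; have := ler_norm (- a); have := ler_norm c; rewrite normrN => h1 h2.
by rewrite ler_norml; have := normr_ge0 a; have := normr_ge0 c; lra.
Qed.

(** With [e] the sign of the derivative, [e * f] is increasing; the extreme values of its derivative
    give [l] and [L], and [B] bounds the second derivative. As the derivative exceeds 1, the
    additive change [B (y - x)] of the slope is also a multiplicative one, which is the distortion
    bound. *)
Lemma C2_expanding_lift (Phi : circle R -> circle R) : C2_expanding Phi ->
  exists (e : R) (f : R -> R) (d : nat) (l L B : R),
  [/\ is_sign e, (1 < d)%N, 1 < l & continuous f] /\
  [/\ 0 <= B, forall x, circle_pi (e * f x) = Phi (circle_pi x),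
      forall x, f (x + 1) = f x + d%:R,
      forall x y, x <= y -> f y - f x <= L * (y - x) &
      bounded_distortion l B f].
Proof.
move=> [f [fPhi [df ddf cddf] f1]].
have cf := derivable_continuous df; have cdf := derivable_continuous ddf.
have [n fn] := lift_degree cf fPhi.
have dfp := derive1_quasiperiodic df fn.
have dfp0 x : derive1 f (x + 1) = derive1 f x + 0 by rewrite addr0.
have ddfp := derive1_quasiperiodic ddf dfp0.
have [e e1 ef] := constant_sign cdf f1.
have ee : e * e = 1 by case: e1 => ->; ring.
have [a [b hab]] := periodic_bounded cdf dfp.
have [a2 [b2 hab2]] := periodic_bounded cddf ddfp.
pose l := Num.min (e * derive1 f a) (e * derive1 f b).
pose L := Num.max (e * derive1 f a) (e * derive1 f b).
have l1 : 1 < l by rewrite lt_min !ef.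
have lL x : l <= e * derive1 f x <= L.
  have := hab x; rewrite /l /L; case: e1 => -> h.
    rewrite !mul1r ge_min le_max; lra.
  by rewrite !mulN1r ge_min le_max; lra.
pose B := `|derive1n 2 f a2| + `|derive1n 2 f b2|.
have B0 : 0 <= B by rewrite addr_ge0.
have ddB x : `|derive1 (derive1 f) x| <= B.
  exact: norm_between (hab2 x).
have dB x y : `|derive1 f x - derive1 f y| <= B * `|x - y|.
  wlog xy : x y / x <= y.
    move=> wl; have [/wl//|/ltW/wl] := leP x y.
    by rewrite distrC (distrC y).
  have [t _ ft] := derivable_MVT ddf xy.
  by rewrite distrC (distrC x) ft normrM ler_wpM2r.
have fMVT x y : x <= y -> exists2 t, x <= t <= y &
    e * f y - e * f x = e * derive1 f t * (y - x).
  move=> xy; have [t txy ft] := derivable_MVT df xy; exists t => //.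
  by rewrite -mulrBr ft mulrA.
have ne : 1 < (e * n%:~R : R).
  have f01 : f 1 = f 0 + n%:~R by rewrite -fn add0r.
  have [t _] := fMVT 0 1 ler01; rewrite f01 subr0 mulr1.
  by have := ef t; lra.
have [d d1 dE] : exists2 d : nat, (1 < d)%N & d%:R = e * n%:~R.
  have [m mE] : exists m : int, m%:~R = e * n%:~R.
    by case: e1 => ->; [exists n|exists (- n)]; rewrite ?mulrNz; ring.
  move: ne; rewrite -mE -[1 in X in X -> _]/(1%:~R) ltr_int.
  by case: m mE => // m mE m1; exists m.
exists e, (fun x => e * f x), d, l, L, B; split.
  by split=> // x; apply: continuousM; [exact: cst_continuous|exact: cf].
split=> //.
- by move=> x; rewrite mulrA ee mul1r.
- by move=> x; rewrite fn mulrDr dE.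
- move=> x y xy; have [t _ ->] := fMVT x y xy.
  by rewrite ler_wpM2r ?subr_ge0//; have := lL t; lra.
split=> [x y xy|x x' y' y xx' x'y' y'y].
  have [t _ ->] := fMVT x y xy.
  by rewrite ler_wpM2r ?subr_ge0//; have := lL t; lra.
have xy : x <= y by lra.
have [t ht ->] := fMVT x y xy.
have [t' ht' ->] := fMVT x' y' x'y'.
have h1 : e * derive1 f t' <= e * derive1 f t + B * (y - x).
  have := dB t' t; have : `|t' - t| <= y - x by rewrite ler_norml; lra.
  move=> h2 h3; have h4 := le_trans h3 (ler_wpM2l B0 h2).
  have : e * (derive1 f t' - derive1 f t) <= `|derive1 f t' - derive1 f t|.
    case: e1 => ->; rewrite ?mul1r ?mulN1r ?ler_norm//.
    by rewrite -normrN ler_norm.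
  lra.
have h2 : B * (y - x) <= B * (y - x) * (e * derive1 f t).
  by rewrite ler_peMr ?mulr_ge0 ?subr_ge0// ltW.
have h3 : e * derive1 f t' <= (1 + B * (y - x)) * (e * derive1 f t) by lra.
have h4 : 0 <= (y' - x') * (y - x) by rewrite mulr_ge0 ?subr_ge0.
have := ler_wpM2r h4 h3; lra.
Qed.

End circle_lifts.

(** * Preimages of arcs and the transfer operator *)

Section lift_preimage.
Variable R : realType.
Implicit Types (x y : R) (H : R -> R).
Variables (f g : R -> R) (d : nat).
Hypothesis d_gt0 : (0 < d)%N.
Hypothesis f_inc : {homo f : x y / x < y}.
Hypotheses (fK : cancel f g) (gK : cancel g f).
Hypothesis fD : forall x, f (x + 1) = f x + d%:R.

Let f_nd x y : (f x <= f y) = (x <= y). Proof. exact: le_mono f_inc x y. Qed.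

Let fDz x (n : int) : f (x + n%:~R) = f x + n%:~R * d%:R.
Proof. exact: quasiperiodicz. Qed.

Lemma lift_preimage_arc (Phi : circle R -> circle R) x y :
  (forall t, circle_pi (f t) = Phi (circle_pi t)) ->
  Phi @^-1` arc x y = \big[setU/set0]_(j < d) arc (g (x + j%:R)) (g (y + j%:R)).
Proof.
move=> fPhi; rewrite -(bigcup_mkord d (fun j => arc (g (x + j%:R)) (g (y + j%:R))));
  apply/seteqP; split=> z.
  rewrite -(circle_sectionK z); set t := circle_section z.
  rewrite /preimage/= -fPhi => /arcP[n hn].
  (* In the division of [- n] by [d], the remainder selects the inverse branch and the quotient is
     an integer translation of [t]. *)
  pose q := (- n %/ d)%Z; pose j := `|(- n %% d)%Z|%N.
  have jE : (j : int) = (- n %% d)%Z.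
    by rewrite /j gez0_abs// modz_ge0// -lt0n.
  have jd : (j < d)%N.
    by rewrite -ltz_nat jE ltz_pmod// ltz_nat.
  have nE : - n%:~R = q%:~R * d%:R + j%:R :> R.
    by rewrite -mulrNz (divz_eq (- n) d) intrD intrM -jE.
  exists j => //; rewrite -(circle_piDz t (- q)); exists (t + (- q)%:~R) => //=.
  by rewrite -(f_nd (g _)) -(f_nd _ (g _)) !gK fDz mulrNz; lra.
move=> [j /= jd]; rewrite -(circle_sectionK z); set t := circle_section z.
move=> /arcP[q hq]; rewrite -fPhi; apply/arcP.
exists (q * d - j%:Z); rewrite intrB intrM -!pmulrn.
by move: hq; rewrite -(f_nd (g _)) -(f_nd _ (g _)) !gK fDz; lra.
Qed.

Lemma measure_lift_preimage_arc (mu : {measure set (circle R) -> \bar R})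
    (Phi : circle R -> circle R) H x y :
  (forall t, circle_pi (f t) = Phi (circle_pi t)) -> arc_cdf H mu ->
  x <= y < x + 1 ->
  mu (Phi @^-1` arc x y) =
    (\sum_(j < d) (H (g (y + j%:R)) - H (g (x + j%:R))))%:E.
Proof.
move=> fPhi [_ muH] xy; rewrite (lift_preimage_arc _ _ fPhi).
have d1 : (1 : R) <= d%:R by rewrite ler1n.
have gxy (j : nat) : g (x + j%:R) <= g (y + j%:R) < g (x + j%:R) + 1.
  by rewrite -f_nd [X in _ && X]ltNge -(f_nd _ (g _)) -ltNge fD !gK; lra.
have mA (j : nat) : measurable (arc (g (x + j%:R)) (g (y + j%:R))).
  exact: measurable_arc.
rewrite (@measure_semi_additive_ord_I _ _ _ mu
  (fun j => arc (g (x + j%:R)) (g (y + j%:R)))) //; last 2 first.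
- apply/trivIsetP => i j /= id jd ij; apply/seteqP; split=> // z [].
  rewrite -(circle_sectionK z); set t := circle_section z.
  move=> /arcP[m hm] /arcP[n hn].
  move: hm; rewrite -(f_nd (g _)) -(f_nd _ (g _)) !gK !fDz => hm.
  move: hn; rewrite -(f_nd (g _)) -(f_nd _ (g _)) !gK !fDz => hn.
  (* Both translates of [f t] lie in [[x, y]], which is shorter than 1; so they agree, and [i = j]
     modulo [d]. *)
  have e : m * d - i%:Z = n * d - j%:Z.
    apply: (@eq_int_dist_lt1 R); rewrite !intrB !intrM -!pmulrn ltr_norml; lra.
  have : (i %% d)%N = (j %% d)%N.
    have : (i%:Z = j%:Z + (m - n) * d)%Z by rewrite mulrBl; lia.
    by move=> E; apply/eqP; rewrite -eqz_nat -!modz_nat E addrC modzMDl.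
  rewrite !modn_small//; exact/eqP.
- by apply: bigsetU_measurable.
by rewrite -sumEFin; apply: eq_bigr => j _; exact: muH.
Qed.

End lift_preimage.

Section transfer_operator.
Variable R : realType.
Implicit Types (x y : R) (H : R -> R).

(** The Perron-Frobenius operator in integrated form: distribution functions are transported instead
    of densities, so the branches carry no Jacobian weight. *)
Definition transfer (e : R) (g : R -> R) (d : nat) H x : R :=
  e * \sum_(j < d) H (g (e * x + j%:R)).

Lemma sum_shift (u : R -> R) (d : nat) x :
  \sum_(j < d) u (x + 1 + j%:R) = \sum_(j < d) u (x + j%:R) + u (x + d%:R) - u x.
Proof.
elim: d => [|d ih]; first by rewrite !big_ord0 addr0; ring.
rewrite !big_ord_recr/= ih (_ : x + 1 + d%:R = x + d.+1%:R); first ring.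
by rewrite -natr1; ring.
Qed.

Lemma transfer_cdf (f g : R -> R) (d : nat) e H (Phi : circle R -> circle R)
    (mu : {measure set (circle R) -> \bar R}) :
  is_sign e -> (0 < d)%N -> {homo f : x y / x < y} -> cancel f g -> cancel g f ->
  (forall x, f (x + 1) = f x + d%:R) ->
  (forall t, circle_pi (e * f t) = Phi (circle_pi t)) -> arc_cdf H mu ->
  arc_cdf (transfer e g d H) (pushforward mu Phi).
Proof.
move=> es d0 f_inc fK gK fD fPhi Hmu; have gD := quasiperiodic_inverseD fK gK fD.
split=> [x|x y xy].
  rewrite /transfer; case: es => ->.
    by rewrite !mul1r (sum_shift (fun x => H (g x))) gD Hmu.1; ring.
  have -> : -1 * x = -1 * (x + 1) + 1 by ring.
  by rewrite (sum_shift (fun x => H (g x))) gD Hmu.1; ring.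
rewrite /pushforward /transfer -mulrBr.
have [Phi0 [a [b [fPhi0 ab PE]]]] := signed_lift_preimage_arc x y es fPhi.
have ab1 (n : int) : a + n%:~R <= b + n%:~R < a + n%:~R + 1.
  by case: ab => -[-> [-> _]]; lra.
have Phi0E n := measure_lift_preimage_arc d0 f_inc gK fD fPhi0 Hmu (ab1 n).
case: ab Phi0E PE => -[-> [-> ->]] Phi0E PE.
  by rewrite (PE 0) Phi0E !addr0 !mul1r -sumrB.
(* The translation by -1 takes the reflected end points [1 - y] and [1 - x] back to [- y] and [- x],
   the arguments that occur in [transfer]. *)
rewrite (PE (- 1)) Phi0E; congr EFin.
have E (z : R) : 1 - z + (- 1)%:~R = -1 * z by rewrite mulrNz mulr1z; ring.
by rewrite sumrB !E; ring.
Qed.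

End transfer_operator.

(** * Slope of the invariant distribution function *)

Lemma reflected_bounds (R : realType) (P Q : Prop) (a b x y : R) :
  (a = x /\ b = y /\ P) \/ (a = 1 - y /\ b = 1 - x /\ Q) ->
  0 <= x -> x <= y -> y < 1 ->
  [/\ 0 <= a, a <= b, b <= 1, b < a + 1 & b - a = y - x].
Proof. by case=> -[-> [-> _]] x0 xy y1; split; lra. Qed.

Section invariant_cdf.
Variable R : realType.
Variables (Phi : circle R -> circle R) (rho : circle R -> R).
Variable m : probability (circle R) R.
Variables (e : R) (f g : R -> R) (d : nat) (l B : R) (M : R -> R).
Hypotheses (es : is_sign e) (d_gt1 : (1 < d)%N) (l1 : 1 < l) (B0 : 0 <= B).
Hypothesis cf : continuous f.
Hypothesis fPhi : forall x, circle_pi (e * f x) = Phi (circle_pi x).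
Hypothesis fD : forall x, f (x + 1) = f x + d%:R.
Hypotheses (fK : cancel f g) (gK : cancel g f).
Hypothesis f_bd : bounded_distortion l B f.
Hypothesis m_rho : has_density rho m.
Hypothesis m_inv : invariant_measure Phi m.
Hypothesis m_cdf : arc_cdf M m.

(** Chosen so that [e ^+ k * F k] is the [k]-th iterate of [e * f] while every [h i] is
    increasing. *)
Let h i x := e ^+ i * f (e ^+ i * x).

Let h_bd i : bounded_distortion l B (h i).
Proof.
rewrite /h; have [-> | ->] := is_signX i es.
  by rewrite (_ : (fun _ => _) = f)//; apply/funext => x; rewrite !mul1r.
rewrite (_ : (fun _ => _) = fun x => - f (- x)); first exact: bounded_distortion_sym.
by apply/funext => x; rewrite !mulN1r.
Qed.

Let hD i x : h i (x + 1) = h i x + d%:R.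
Proof.
rewrite /h; have [-> | ->] := is_signX i es; first by rewrite !mul1r fD.
have -> : -1 * x = -1 * (x + 1) + 1 by ring.
by rewrite fD; ring.
Qed.

Local Notation F := (iter_maps h).

Let FD k x : F k (x + 1) = F k x + (d ^ k)%:R.
Proof.
elim: k x => [//|k ih] x /=.
rewrite ih -[(d ^ k)%:R]/(((d ^ k)%N : int)%:~R) (quasiperiodicz (hD k)).
by rewrite expnS mulnC natrM.
Qed.

Let F_inverse k : exists2 G, cancel (F k) G & cancel G (F k).
Proof.
elim: k => [|k [G FK GK]]; first by exists id.
have ee : e ^+ k * e ^+ k = 1 by exact/is_sign_sqr/is_signX.
exists (fun x => G (e ^+ k * g (e ^+ k * x))) => x /=.
  by rewrite /h mulrA ee mul1r fK mulrA ee mul1r FK.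
by rewrite GK /h !mulrA ee !mul1r gK mulrA ee mul1r.
Qed.

Let F_inc k : {homo F k : x y / x < y}.
Proof.
move=> x y xy; rewrite -subr_gt0.
apply: lt_le_trans (iter_maps_expand l1 h_bd k (ltW xy)).
by rewrite mulr_gt0 ?subr_gt0// exprn_gt0// (lt_trans ltr01 l1).
Qed.

Let iter_lift k x : circle_pi (e ^+ k * F k x) = iter k Phi (circle_pi x).
Proof.
elim: k => [|k ih] /=; first by rewrite mul1r.
rewrite -ih -fPhi /h; have ee : e ^+ k * e ^+ k = 1 by exact/is_sign_sqr/is_signX.
by rewrite exprS -mulrA (mulrA (e ^+ k) (e ^+ k)) ee mul1r.
Qed.

Lemma lift_measurable : measurable_fun setT Phi.
Proof.
rewrite (_ : Phi = @circle_pi R \o (fun z => e * f (circle_section z))); last first.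
  by apply/funext => z /=; rewrite fPhi circle_sectionK.
apply: measurableT_comp; first exact: measurable_circle_pi.
apply: measurable_funM => //; apply: measurableT_comp; last first.
  exact: measurable_circle_section.
exact: continuous_measurable_fun.
Qed.

Let iter_inv k A : measurable A -> m (iter k Phi @^-1` A) = m A.
Proof.
elim: k A => [//|k ih] A mA.
have mPA : measurable (Phi @^-1` A).
  by rewrite -[X in measurable X]setTI; exact: lift_measurable.
by rewrite -(m_inv mA) /pushforward -(ih _ mPA).
Qed.

(** The factor of [iter_maps_distortion] for an interval whose image has length 1. *)
Let C := expR (B / (l - 1)).

Let C1 : 1 <= C.
Proof.
rewrite /C -[leLHS]expR0 ler_expR divr_ge0//; have := l1; lra.
Qed.

(** By invariance the arc has the mass of its preimage under a high iterate, to which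
    [cylinder_estimate] applies. *)
Let approx_lower x y (eps : R) : 0 <= x -> x <= y -> y < 1 -> 0 < eps ->
  C^-1 * (y - x) * (1 - 4 * eps) - eps <= M y - M x.
Proof.
move=> x0 xy y1 eps0.
have [w0 [r [V [w00 V_nd rV]]]] := density_local_approx m_rho eps0.
have cM := arc_cdf_continuous m_cdf.
have M_nd := arc_cdf_nondecreasing m_cdf.
have eps20 : 0 < eps / 2 by rewrite divr_gt0.
have /cvgrPdist_lt/(_ _ eps20)/nbhs_ballP[w1 /= w10 hw1] := cM 0.
have /cvgrPdist_lt/(_ _ eps20)/nbhs_ballP[w2 /= w20 hw2] := cM 1.
(* Below the scale of the local approximation of the density, and below the scales of continuity of
   [M] at 0 and at 1. *)
pose w := Num.min (w0 / 2) (Num.min (w1 / 2) (w2 / 2)).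
have w_gt0 : 0 < w by rewrite !lt_min !divr_gt0.
have ww0 : w < w0 by rewrite gt_min; apply/orP; left; lra.
have ww1 : w < w1.
  by rewrite !gt_min; apply/orP; right; apply/orP; left; lra.
have ww2 : w < w2.
  by rewrite !gt_min; apply/orP; right; apply/orP; right; lra.
have M1 : M 1 = M 0 + 1 by rewrite -[in LHS](add0r 1) m_cdf.1.
have M_ends s t : 0 <= s <= w -> 1 - w <= t <= 1 -> 1 - eps <= M t - M s.
  move=> hs ht.
  have := hw1 s; have := hw2 t; rewrite /ball/= => h2 h1.
  have {}h1 : `|M 0 - M s| < eps / 2 by apply: h1; rewrite sub0r normrN ger0_norm; lra.
  have {}h2 : `|M 1 - M t| < eps / 2 by apply: h2; rewrite ger0_norm; lra.
  by move: h1 h2; rewrite !ltr_norml; lra.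
(* Expansion by [l ^+ k >= 1 / w] makes the cylinders of order [k] no longer than [w]. *)
have [k hk] := expr_unbounded l1 w_gt0.
have [G FK GK] := F_inverse k.
have [Phi0 [a [b [FPhi0 ab PE]]]] :=
  signed_lift_preimage_arc x y (is_signX k es) (@iter_lift k).
(* Translating the arc by [i] puts the first cut point of the cylinders into [[0, w]]. *)
pose i := Num.ceil (F k 0).
have hi : i%:~R - 1 < F k 0 <= i%:~R.
  by rewrite -[1]/(1%:~R) -intrB ceil_itv.
have dk0 : (0 < d ^ k)%N by rewrite expn_gt0 (ltnW d_gt1).
have [a0 ab0 b1 ba1 baE] := reflected_bounds ab x0 xy y1.
have E : m (arc x y) = (\sum_(j < d ^ k) (M (G (b + i%:~R + j%:R)) -
    M (G (a + i%:~R + j%:R))))%:E.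
  rewrite -(@iter_inv k); last by apply: measurable_arc; lra.
  rewrite (PE i).
  by apply: (measure_lift_preimage_arc dk0 (@F_inc k) GK (FD k) FPhi0 m_cdf); lra.
move: E; rewrite m_cdf.2; last by lra.
move=> [->].
have l0 : 0 < l by exact: lt_trans ltr01 l1.
have cy := @cylinder_estimate R M (F k) G (d ^ k) C M_nd FK GK (@F_inc k) (FD k) dk0
  (lt_le_trans ltr01 C1) _ r V eps w eps0 V_nd _ _ M_ends i (a + i%:~R) (b + i%:~R) hi.
rewrite -baE (_ : b - a = b + i%:~R - (a + i%:~R)); last by ring.
apply: cy; [|  | |lra|lra|lra].
- move=> s s' t' t ss' s't' t't Fst.
  have := iter_maps_distortion l1 B0 h_bd k ss' s't' t't.
  by rewrite Fst !mulr1.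
- move=> z s t z0 zs st t1 tzw.
  have -> : M t - M s = fine (m (arc s t)) by rewrite m_cdf.2//; lra.
  by apply: rV => //; lra.
- move=> s t st Fst.
  have := le_trans (iter_maps_expand l1 h_bd k st) Fst => h1.
  rewrite -(ler_pM2l (exprn_gt0 k l0)); apply: (le_trans h1).
  by rewrite mulrC.
Qed.

Let lower01 x y : 0 <= x -> x <= y -> y <= 1 -> C^-1 * (y - x) <= M y - M x.
Proof.
have M_nd := arc_cdf_nondecreasing m_cdf.
have C0 : 0 < C by exact: lt_le_trans C1.
have key s t : 0 <= s -> s <= t -> t < 1 -> C^-1 * (t - s) <= M t - M s.
  move=> s0 st t1; set u := C^-1 * (t - s).
  have u0 : 0 <= u by rewrite mulr_ge0 ?invr_ge0 ?subr_ge0// ltW.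
  rewrite leNgt; apply/negP => hlt.
  (* The total error [eps * (4 * u + 1)] is half of the supposed gap. *)
  pose eps := (u - (M t - M s)) / (2 * (4 * u + 1)).
  have u1 : 0 < 4 * u + 1 by lra.
  have eps0 : 0 < eps by rewrite divr_gt0 ?subr_gt0// mulr_gt0.
  have := approx_lower s0 st t1 eps0; rewrite -/u.
  have : eps * (4 * u + 1) = (u - (M t - M s)) / 2 by rewrite /eps; field; rewrite gt_eqF.
  lra.
move=> x0 xy; rewrite le_eqVlt => /orP[/eqP y1|]; last exact: key.
have [x1|x1] := ltP x 1; last first.
  by rewrite (_ : x = y) ?subrr ?mulr0//; lra.
subst y; rewrite leNgt; apply/negP => hlt.
(* The end point 1 is approached from the left: for this [t] the loss [C^-1 * (1 - t)] is at most
   half of the supposed gap. *)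
pose t := Num.max x (1 - C * (C^-1 * (1 - x) - (M 1 - M x)) / 2).
have xt : x <= t by rewrite le_max lexx.
have tt1 : t < 1.
  rewrite gt_max x1 /= ltrBlDr ltrDl divr_gt0// mulr_gt0// subr_gt0//.
have := key x t x0 xt tt1.
have := M_nd t 1 (ltW tt1).
have : 1 - C * (C^-1 * (1 - x) - (M 1 - M x)) / 2 <= t by rewrite le_max lexx orbT.
have Cinv0 : 0 < C^-1 by rewrite invr_gt0.
move=> /(ler_wpM2l (ltW Cinv0)).
have -> : C^-1 * (1 - C * (C^-1 * (1 - x) - (M 1 - M x)) / 2) =
  C^-1 - (C^-1 * (1 - x) - (M 1 - M x)) / 2 by field; rewrite gt_eqF.
lra.
Qed.

(** An interval is cut at the integers: [lower01] applies to both ends, and on whole periods [M]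
    grows with slope 1, at least [C^-1]. *)
Lemma invariant_cdf_lower : exists2 c, 0 < c &
  forall x y, x <= y -> c * (y - x) <= M y - M x.
Proof.
have C0 : 0 < C by exact: lt_le_trans C1.
have Cinv0 : 0 < C^-1 by rewrite invr_gt0.
have Cinv1 : C^-1 <= 1 by rewrite invf_le1.
exists C^-1 => // x y xy.
pose p := Num.floor x; pose q := Num.floor y.
have := floor_itv x; have := floor_itv y; rewrite -/p -/q !intrD => hq hp.
have lz (n : int) s t : n%:~R <= s -> s <= t -> t <= n%:~R + 1 ->
    C^-1 * (t - s) <= M t - M s.
  move=> ns st tn; have := @lower01 (s - n%:~R) (t - n%:~R).
  rewrite -!mulrNz !(arc_cdf_int _ _ m_cdf) !mulrNz => /(_ _ _ _).
  have -> : t - n%:~R - (s - n%:~R) = t - s by ring.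
  have -> : M t - n%:~R - (M s - n%:~R) = M t - M s by ring.
  by apply; lra.
have pq : p <= q by exact: le_floor.
move: pq; rewrite le_eqVlt => /orP[/eqP pq|pq].
  by apply: (lz p) => //; [lra|rewrite pq; lra].
have {}pq : p%:~R + 1 <= q%:~R :> R.
  have : p + 1 <= q by rewrite lezD1.
  by rewrite -(ler_int R) intrD.
have h1 := lz p x (p%:~R + 1); have h2 := lz q q%:~R y.
have Mp : M (p%:~R + 1) = M 0 + p%:~R + 1.
  by rewrite m_cdf.1 -[p%:~R in LHS]add0r (arc_cdf_int _ _ m_cdf).
have Mq : M q%:~R = M 0 + q%:~R.
  by rewrite -[q%:~R in LHS]add0r (arc_cdf_int _ _ m_cdf).
rewrite Mp in h1; rewrite Mq in h2.
have {}h1 : C^-1 * (p%:~R + 1 - x) <= M 0 + p%:~R + 1 - M x by apply: h1; lra.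
have {}h2 : C^-1 * (y - q%:~R) <= M y - (M 0 + q%:~R) by apply: h2; lra.
have : C^-1 * (q%:~R - (p%:~R + 1)) <= q%:~R - (p%:~R + 1).
  by rewrite ler_piMl ?subr_ge0.
lra.
Qed.

End invariant_cdf.

(** * Oscillations *)

Section periodic_distance.
Variable R : realType.
Variable d : nat.
Hypothesis d_gt0 : (0 < d)%N.
Implicit Types (x y : R) (n : int).

Definition dist_multiples x : R := d%:R * circle_dist (circle_pi (x / d%:R)) 0.

Let d0 : 0 < d%:R :> R. Proof. by rewrite ltr0n. Qed.

Lemma dist_multiples_le x n : dist_multiples x <= `|x - n%:~R * d%:R|.
Proof.
rewrite /dist_multiples -circle_pi0 -(circle_piDz 0 n) add0r.
apply: le_trans (ler_wpM2l (ltW d0) (circle_dist_le _ _)) _.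
rewrite -{1}(ger0_norm (ltW d0)) -normrM mulrBr mulrCA divff ?gt_eqF// mulr1.
by rewrite (mulrC d%:R).
Qed.

Lemma dist_multiplesP x : exists n, dist_multiples x = `|x - n%:~R * d%:R|.
Proof.
have [Y /esym] := circle_dist_lift (x / d%:R) 0.
rewrite -circle_pi0 => /circle_piP[n nY] E; exists (- n).
rewrite /dist_multiples -circle_pi0 E -{1}(ger0_norm (ltW d0)) -normrM.
rewrite mulrBr mulrCA divff ?gt_eqF// mulr1; congr `| _ |.
by rewrite mulrNz mulNr (_ : Y = - n%:~R); [ring|lra].
Qed.

Lemma dist_multiples_lip x y : `|dist_multiples x - dist_multiples y| <= `|x - y|.
Proof.
have key u v : dist_multiples u - dist_multiples v <= `|u - v|.
  have [n ->] := dist_multiplesP v; rewrite lerBlDr.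
  apply: le_trans (dist_multiples_le u n) _.
  by rewrite -[leLHS](congr1 _ (subrKA v _ _)) ler_normD.
by rewrite ler_norml lerNl opprB key andbT distrC key.
Qed.

Lemma dist_multiplesDd x : dist_multiples (x + d%:R) = dist_multiples x.
Proof.
by rewrite /dist_multiples mulrDl divff ?gt_eqF// (circle_piDz _ 1).
Qed.

Lemma dist_multiples_le_norm x : dist_multiples x <= `|x|.
Proof. by have := dist_multiples_le x 0; rewrite mul0r subr0. Qed.

Lemma dist_multiples_ge x r : r <= x <= d%:R - r -> r <= dist_multiples x.
Proof.
move=> hx; have [n ->] := dist_multiplesP x; have d1 := d0.
have [n0|n0] := leP n 0.
  have n0' : n%:~R <= 0 :> R by rewrite lerz0.
  have : n%:~R * d%:R <= 0 :> R by rewrite mulr_le0_ge0// ltW.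
  by have := ler_norm (x - n%:~R * d%:R); lra.
have n1 : 1 <= n%:~R :> R by rewrite -[1]/(1%:~R) ler_int -gtz0_ge1.
have : 1 * d%:R <= n%:~R * d%:R :> R by apply: ler_wpM2r => //; exact: ltW.
by have := ler_norm (- (x - n%:~R * d%:R)); rewrite normrN; lra.
Qed.

Lemma dist_multiples_leP x h : dist_multiples x <= h <->
  exists n : int, - h <= x + n%:~R * d%:R <= h.
Proof.
split=> [|[n hn]].
  have [n ->] := dist_multiplesP x; rewrite ler_norml => hn; exists (- n).
  by rewrite mulrNz; lra.
apply: le_trans (dist_multiples_le x (- n)) _.
by rewrite ler_norml mulrNz; lra.
Qed.

End periodic_distance.

Section bumps.
Variables (R : realType) (d n : nat).
Hypotheses (d_gt1 : (1 < d)%N) (n_gt0 : (0 < n)%N).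
Implicit Types (x y : R).

(** Radius and centres let the [n] bumps tile [[0, 1]], one for each coordinate of the parameter. *)
Definition bump_radius : R := (2 * n%:R)^-1.
Local Notation r := bump_radius.

Definition bump_center (i : 'I_n) : R := r + 2 * r * i%:R.
Local Notation p := bump_center.

Definition bump (i : 'I_n) x : R := Num.max 0 (r - dist_multiples d (x - p i)).

(** The copy one unit further cancels the sum over [x, ..., x + d - 1]. It lives over []1, 2[]
    modulo [d], which avoids []0, 1[] because [d >= 2]. *)
Definition balanced_bump i x : R := bump i x - bump i (x - 1).

Let d0 : (0 < d)%N. Proof. exact: ltnW. Qed.
Let d2 : 2 <= d%:R :> R. Proof. by rewrite ler_nat. Qed.

Lemma bump_radius_gt0 : 0 < r.
Proof. by rewrite invr_gt0 mulr_gt0// ltr0n. Qed.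

Lemma bump_radius_le : r <= 2^-1.
Proof.
rewrite /r lef_pV2 ?posrE ?mulr_gt0 ?ltr0n// ler_peMr// ler1n//.
Qed.

Lemma bump_center_itv i : r <= p i <= 1 - r.
Proof.
have r0 := bump_radius_gt0; rewrite /p.
have i0 : 0 <= i%:R :> R by rewrite ler0n.
have i1 : i%:R + 1 <= n%:R :> R by rewrite natr1 ler_nat.
have rn : r * (2 * n%:R) = 1 by rewrite /r mulVf// gt_eqF// mulr_gt0// ltr0n.
have h1 : 0 <= r * i%:R by rewrite mulr_ge0// ltW.
have := ler_wpM2l (ltW r0) i1; lra.
Qed.

Lemma bump_ge0 i x : 0 <= bump i x. Proof. by rewrite le_max lexx. Qed.

Lemma dist_multiples_ge0 x : 0 <= dist_multiples d x.
Proof. by rewrite mulr_ge0// circle_dist_ge0. Qed.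

Lemma bump_le i x : bump i x <= r.
Proof.
rewrite ge_max (ltW bump_radius_gt0) lerBlDr lerDl /=.
exact: dist_multiples_ge0.
Qed.

Lemma bump_lip i x y : `|bump i x - bump i y| <= `|x - y|.
Proof.
have E : x - y = x - p i - (y - p i) by ring.
have := dist_multiples_lip d0 (x - p i) (y - p i); rewrite -E /bump.
set u := dist_multiples _ _; set v := dist_multiples _ _.
by rewrite !ler_norml; case: (leP 0 (r - u)); case: (leP 0 (r - v)); lra.
Qed.

Lemma bumpDd i x : bump i (x + d%:R) = bump i x.
Proof. by rewrite /bump addrAC dist_multiplesDd. Qed.

Lemma bump_eq0 i x : r <= x - p i <= d%:R - r -> bump i x = 0.
Proof.
move=> /(dist_multiples_ge d0) h; rewrite /bump; case: leP => //; lra.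
Qed.

Lemma balanced_bumpDd i x : balanced_bump i (x + d%:R) = balanced_bump i x.
Proof. by rewrite /balanced_bump bumpDd addrAC bumpDd. Qed.

Lemma balanced_bump_lip i x y :
  `|balanced_bump i x - balanced_bump i y| <= 2 * `|x - y|.
Proof.
have := bump_lip i x y; have := bump_lip i (x - 1) (y - 1).
rewrite (_ : x - 1 - (y - 1) = x - y); last by ring.
rewrite /balanced_bump; set a := `|x - y|.
by rewrite !ler_norml; lra.
Qed.

Lemma balanced_bump_le1 i x : `|balanced_bump i x| <= 1.
Proof.
have := bump_ge0 i x; have := bump_le i x.
have := bump_ge0 i (x - 1); have := bump_le i (x - 1).
by rewrite /balanced_bump ler_norml; have := bump_radius_le; lra.
Qed.

Lemma balanced_bump_sum i x : \sum_(j < d) balanced_bump i (x + j%:R) = 0.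
Proof.
rewrite /balanced_bump sumrB.
have := sum_shift (bump i) d (x - 1); rewrite subrK => ->.
under [X in _ - X]eq_bigr do rewrite addrAC.
by rewrite addrAC bumpDd; ring.
Qed.

(** Near the centre of bump [i], all bumps vanish at [x - 1] and [x + 1], and only bump [i] is
    present at [x]; it is counted once in each term. This separates the coordinates of the
    parameter. *)
Lemma balanced_bump_diff i i' x : `|x - p i| <= r / 2 ->
  balanced_bump i' x - balanced_bump i' (x + 1) =
  if i' == i then 2 * bump i x else 0.
Proof.
have r0 := bump_radius_gt0; have r2 := bump_radius_le; have dd := d2.
have pi := bump_center_itv i; have pi' := bump_center_itv i'.
rewrite ler_norml => hx; rewrite /balanced_bump addrK.
have -> : bump i' (x + 1) = 0 by apply: bump_eq0; lra.
have -> : bump i' (x - 1) = 0 by rewrite -bumpDd; apply: bump_eq0; lra.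
have [->|ne] := eqVneq i' i; first by ring.
suff -> : bump i' x = 0 by ring.
have [lt|gt|eq] := ltngtP i' i; last by move: ne; rewrite (ord_inj eq) eqxx.
  apply: bump_eq0; suff : p i' + 2 * r <= p i by lra.
  have i1 : i'%:R + 1 <= i%:R :> R by rewrite natr1 ler_nat.
  by rewrite /p; have := ler_wpM2l (ltW r0) i1; lra.
rewrite -bumpDd; apply: bump_eq0; suff : p i + 2 * r <= p i' by lra.
have i1 : i%:R + 1 <= i'%:R :> R by rewrite natr1 ler_nat.
by rewrite /p; have := ler_wpM2l (ltW r0) i1; lra.
Qed.

Lemma bump_ge i x : `|x - p i| <= r / 2 -> r / 2 <= bump i x.
Proof.
move=> h; rewrite le_max; apply/orP; right.
by have := dist_multiples_le_norm d0 (x - p i); lra.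
Qed.

End bumps.

(** * Staircases close to Lipschitz functions *)

Section counting.
Variable R : realType.
Implicit Types (u v : R).

Definition count_ge (N : nat) u : R := \sum_(j < N) (u <= j%:R)%R%:R.

(** The staircase stays below a 1-Lipschitz ramp and within 1 of it. *)
Lemma count_ge_bounds N u :
  count_ge N u <= Num.max 0 (Num.min N%:R (N%:R - u)) <= count_ge N u + 1.
Proof.
rewrite maxEle minEle /count_ge; elim: N => [|N].
  rewrite big_ord0 !mulr0n; case: (leP 0 (0 - u)) => h1; case: ifPn => h2; lra.
rewrite big_ord_recr/= -natr1; set S := \sum_(_ < _) _; set M := N%:R.
have M0 : 0 <= M by rewrite /M ler0n.
have S0 : 0 <= S by apply: sumr_ge0 => j _; rewrite ler0n.
case: (leP M (M - u)) => h1; case: (leP (M + 1) (M + 1 - u)) => h2;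
  do 2 (case: ifPn; rewrite -?ltNge => ?); case: (leP u M) => h5 /=; lra.
Qed.

Lemma count_ge_lip N u v : `|count_ge N u - count_ge N v| <= `|u - v| + 1.
Proof.
have := count_ge_bounds N u; have := count_ge_bounds N v.
have lip : `|Num.max 0 (Num.min N%:R (N%:R - u)) -
             Num.max 0 (Num.min N%:R (N%:R - v))| <= `|u - v|.
  have := ler_norm (u - v); have := ler_norm (v - u); rewrite (distrC v).
  rewrite !maxEle !minEle; set M := N%:R; rewrite ler_norml.
  by case: (leP M (M - u)) => h1; case: (leP M (M - v)) => h2;
    do 2 ?(case: ifPn; rewrite -?ltNge => ?); lra.
move: lip; set w := `|u - v|; rewrite ler_norml => /andP[l1 l2] b1 b2.
by rewrite ler_norml; lra.
Qed.

End counting.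

(** * Action of the transfer operator on oscillations *)

Section transfer_linear.
Variables (R : realType) (e : R) (g : R -> R) (d : nat).

Lemma transfer_sum (I : Type) (s : seq I) (F : I -> R -> R) x :
  transfer e g d (fun y => \sum_(i <- s) F i y) x =
  \sum_(i <- s) transfer e g d (F i) x.
Proof. by rewrite /transfer exchange_big/= mulr_sumr. Qed.

Lemma transferZ c (F : R -> R) x :
  transfer e g d (fun y => c * F y) x = c * transfer e g d F x.
Proof. by rewrite /transfer -mulr_sumr; ring. Qed.

Lemma transferB (F G : R -> R) x :
  transfer e g d (fun y => F y - G y) x = transfer e g d F x - transfer e g d G x.
Proof. by rewrite /transfer sumrB; ring. Qed.

Lemma transfer_cst c x : transfer e g d (fun=> c) x = e * d%:R * c.
Proof. by rewrite /transfer sumr_const card_ord -mulr_natr; ring. Qed.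

Lemma transfer_le (F : R -> R) (b : R) : is_sign e -> (forall x, `|F x| <= b) ->
  forall x, `|transfer e g d F x| <= d%:R * b.
Proof.
move=> es Fb x; rewrite /transfer normrM (_ : `|e| = 1) ?mul1r; last first.
  by case: es => ->; rewrite ?normrN normr1.
apply: le_trans (ler_norm_sum _ _ _) _.
apply: le_trans (ler_sum _ (fun i _ => Fb _)) _.
by rewrite sumr_const card_ord (mulr_natl b).
Qed.

Lemma transfer_increasing (H : R -> R) : is_sign e -> (0 < d)%N ->
  {homo g : x y / x < y} -> {homo H : x y / x < y} ->
  {homo transfer e g d H : x y / x < y}.
Proof.
move=> es d0 g_inc H_inc x y xy; rewrite /transfer.
case: es => ->.
  rewrite !mul1r; apply: ltr_sum.
    by apply/hasP; exists (Ordinal d0) => //; rewrite mem_index_enum.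
  by move=> j _; apply/H_inc/g_inc; rewrite ltrD2r.
rewrite ltr_nM2l ?ltrN10//; apply: ltr_sum.
  by apply/hasP; exists (Ordinal d0) => //; rewrite mem_index_enum.
by move=> j _; apply/H_inc/g_inc; rewrite ltrD2r ltr_nM2l ?ltrN10.
Qed.

End transfer_linear.

Section oscillations.
Variables (R : realType) (e L : R) (f g : R -> R) (d : nat).
Hypotheses (es : is_sign e) (d_gt1 : (1 < d)%N) (L1 : 1 < L).
Hypothesis fD : forall x, f (x + 1) = f x + d%:R.
Hypothesis gK : cancel g f.
Hypothesis f_lip : forall x y, `|f x - f y| <= L * `|x - y|.
Implicit Types (x y : R) (b : R -> R) (c : nat -> R) (k N : nat).

Let fe x := e * f x.

Let ee : e * e = 1. Proof. exact: is_sign_sqr. Qed.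

Let norm_e : `|e| = 1.
Proof. by case: es => ->; rewrite ?normrN normr1. Qed.

Let d0 : 0 < d%:R :> R. Proof. by rewrite ltr0n ltnW. Qed.

Let q : R := d%:R^-1.

Let q_itv : 0 <= q <= 2^-1.
Proof.
rewrite /q invr_ge0 ler0n /= lef_pV2 ?posrE//.
by rewrite ler_nat.
Qed.

Definition osc b k x : R := (e / d%:R) ^+ k * b (f (iter k fe x)).

Definition balanced b := [/\ forall x, b (x + d%:R) = b x,
  forall x, \sum_(j < d) b (x + j%:R) = 0,
  forall x, `|b x| <= 1 & forall x y, `|b x - b y| <= 2 * `|x - y|].

Let fe_int x (n : int) : exists m : int, fe (x + n%:~R) = fe x + m%:~R.
Proof.
rewrite /fe (quasiperiodicz fD) mulrDr.
case: es => ->; [exists (n * d)|exists (- (n * d))];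
  by rewrite ?mulrNz intrM -pmulrn; ring.
Qed.

Let iter_fe_int k x (n : int) : exists m : int, iter k fe (x + n%:~R) = iter k fe x + m%:~R.
Proof.
elim: k => [|k [m ih]] /=; first by exists n.
by rewrite ih; exact: fe_int.
Qed.

Section one_bump.
Variable b : R -> R.
Hypothesis b_bal : balanced b.

Let b_int x (n : int) : b (x + n%:~R * d%:R) = b x.
Proof.
have [bd _ _ _] := b_bal.
have u1 z : b ((z + 1) * d%:R) = b (z * d%:R) + 0.
  by rewrite mulrDl mul1r bd addr0.
have dn0 : d%:R != 0 :> R by rewrite gt_eqF.
have := quasiperiodicz u1 (x / d%:R) n.
by rewrite mulrDl divfK// mulr0 addr0.
Qed.

Lemma oscDz k x (n : int) : osc b k (x + n%:~R) = osc b k x.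
Proof.
rewrite /osc; have [m ->] := iter_fe_int k x n.
by rewrite (quasiperiodicz fD) b_int.
Qed.

Lemma osc_le k x : `|osc b k x| <= q ^+ k.
Proof.
have [_ _ b1 _] := b_bal.
rewrite /osc normrM normrX normrM norm_e mul1r normfV (gtr0_norm d0).
by rewrite -/q ler_piMr// exprn_ge0// invr_ge0 ltW.
Qed.

Lemma osc_lip k x y :
  `|osc b k x - osc b k y| <= q ^+ k * (2 * L * L ^+ k * `|x - y|).
Proof.
have [_ _ _ b2] := b_bal.
rewrite /osc -mulrBr normrM normrX normrM norm_e mul1r normfV (gtr0_norm d0).
have L0 : 0 <= L by exact/ltW/(lt_trans ltr01 L1).
rewrite ler_wpM2l ?exprn_ge0 ?invr_ge0 ?(ltW d0)//.
apply: le_trans (b2 _ _) _; rewrite -!mulrA ler_wpM2l//.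
apply: le_trans (f_lip _ _) _; rewrite ler_wpM2l//.
elim: k => [|k ih] /=; first by rewrite mul1r.
rewrite /fe -mulrBr normrM norm_e mul1r; apply: le_trans (f_lip _ _) _.
by rewrite exprS -mulrA ler_wpM2l.
Qed.

Lemma transfer_osc0 x : transfer e g d (osc b 0) x = 0.
Proof.
have [_ b_sum _ _] := b_bal; rewrite /transfer /osc.
under eq_bigr do rewrite expr0 mul1r /= gK.
by rewrite b_sum mulr0.
Qed.

(** All [d] branches are mapped by [e * f] to [x] up to an integer, so the terms are equal; their
    number and the outer sign are compensated by the factor [e / d]. *)
Lemma transfer_oscS k x : transfer e g d (osc b k.+1) x = osc b k x.
Proof.
rewrite /transfer.
have E (j : 'I_d) : osc b k.+1 (g (e * x + j%:R)) = e / d%:R * osc b k x.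
  rewrite /osc iterSr exprS -!mulrA; congr (_ * (_ * _)).
  have -> : fe (g (e * x + j%:R)) = x + e * j%:R.
    by rewrite /fe gK mulrDr mulrA ee mul1r.
  have [n ->] : exists n : int, e * j%:R = n%:~R :> R.
    by case: es => ->; [exists j|exists (- j%:Z)]; rewrite ?mulrNz -pmulrn; ring.
  by have := oscDz k x n; rewrite /osc => ->.
under eq_bigr do rewrite E.
rewrite sumr_const card_ord -mulr_natl.
have dn0 : d%:R != 0 :> R by rewrite gt_eqF.
transitivity (e * e * osc b k x); first by field.
by rewrite ee mul1r.
Qed.

Lemma osc0_g s : osc b 0 (g s) = b s.
Proof. by rewrite /osc expr0 mul1r /= gK. Qed.

(** These oscillations depend only on the image under [e * f] modulo 1, which is the same for [g s]
    and [g (s + 1)]. *)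
Lemma oscS_g k s : osc b k.+1 (g (s + 1)) = osc b k.+1 (g s).
Proof.
rewrite /osc !iterSr /fe !gK mulrDr.
have [n ->] : exists n : int, e * 1 = n%:~R :> R.
  by case: es => ->; [exists 1|exists (- 1)]; rewrite ?mulrNz mulr1z; ring.
have := oscDz k (e * s) n; rewrite /osc => h.
by rewrite exprS -[LHS]mulrA -[RHS]mulrA h.
Qed.

Definition wsum c N x : R := \sum_(k < N) c k * osc b k x.

Lemma wsumDz c N x (n : int) : wsum c N (x + n%:~R) = wsum c N x.
Proof. by apply: eq_bigr => k _; rewrite oscDz. Qed.

Lemma wsum_widen c N N' x : (N <= N')%N -> (forall k, (N <= k)%N -> c k = 0) ->
  wsum c N' x = wsum c N x.
Proof.
move=> NN' c0; rewrite -(subnKC NN') /wsum big_split_ord/=.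
rewrite [X in _ + X]big1 ?addr0// => i _.
by rewrite c0 ?mul0r// leq_addr.
Qed.

Lemma wsum_le c N x D : (forall k, `|c k| <= D) -> `|wsum c N x| <= 2 * D.
Proof.
move=> cD; have D0 : 0 <= D by apply: le_trans (cD 0%N).
apply: le_trans (ler_norm_sum _ _ _) _.
apply: (le_trans (y := \sum_(k < N) D * q ^+ k)).
  apply: ler_sum => k _; rewrite normrM ler_pM// osc_le//.
by rewrite -mulr_sumr mulrC ler_wpM2r// sum_geometric_le2.
Qed.

Lemma wsumB c c' N x : wsum c N x - wsum c' N x = wsum (fun k => c k - c' k) N x.
Proof. by rewrite /wsum -sumrB; apply: eq_bigr => k _; rewrite mulrBl. Qed.

(** The bound [K] absorbs the growth [L ^+ k] of the slopes and leaves a geometric series in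
    [1 / d], with sum at most 2. *)
Lemma wsum_lip c N K x y : 0 <= K -> (forall k, `|c k| * L ^+ k <= K) ->
  `|wsum c N x - wsum c N y| <= 4 * L * K * `|x - y|.
Proof.
move=> K0 cK; rewrite /wsum -sumrB.
apply: le_trans (ler_norm_sum _ _ _) _.
apply: (le_trans (y := \sum_(k < N) 2 * L * K * `|x - y| * q ^+ k)).
  apply: ler_sum => k _; rewrite -mulrBr normrM.
  apply: le_trans (ler_wpM2l (normr_ge0 _) (osc_lip k x y)) _.
  have h : 0 <= q ^+ k * (2 * L * `|x - y|).
    have := q_itv; have L0 : 0 <= L by exact/ltW/(lt_trans ltr01 L1).
    by move=> /andP[q0 _]; rewrite mulr_ge0 ?exprn_ge0// !mulr_ge0.
  by have := ler_wpM2l h (cK k); lra.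
rewrite -mulr_sumr.
have h : 0 <= 2 * L * K * `|x - y|.
  by have L0 : 0 <= L by [exact/ltW/(lt_trans ltr01 L1)]; rewrite !mulr_ge0.
by have := ler_wpM2l h (@sum_geometric_le2 _ q N q_itv); lra.
Qed.

(** The operator shifts the weights by one; [c N = 0] lets the sum keep its length. *)
Lemma transfer_wsum c N x : c N = 0 ->
  transfer e g d (wsum c N) x = wsum (fun k => c k.+1) N x.
Proof.
rewrite /wsum transfer_sum; case: N => [|N] cN; first by rewrite !big_ord0.
rewrite big_ord_recl transferZ transfer_osc0 mulr0 add0r big_ord_recr /= cN mul0r addr0.
by apply: eq_bigr => k _; rewrite transferZ transfer_oscS.
Qed.

(** The defect is a sum of weight drops times [q ^+ k]. The drops before [J] add up to at most
    [c 0 - c J]; the later ones carry a factor at most [q ^+ J]. *)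
Lemma transfer_wsum_le c N J x : c N = 0 ->
  (forall k, 0 <= c k.+1 <= c k) ->
  `|transfer e g d (wsum c N) x - wsum c N x| <= c 0%N - c J + q ^+ J * c 0%N.
Proof.
move=> cN c_dec; rewrite transfer_wsum// wsumB.
have [/andP[q0 q2] c0] : (0 <= q <= 2^-1) /\ 0 <= c 0%N.
  by split=> //; have := c_dec 0%N; lra.
have c_nd m k : (m <= k)%N -> c k <= c m.
  elim: k => [|k ih]; first by rewrite leqn0 => /eqP->.
  rewrite leq_eqVlt => /orP[/eqP->//|]; rewrite ltnS => /ih.
  by have := c_dec k; lra.
have q1 k : 0 <= q ^+ k <= 1.
  by rewrite exprn_ge0//= exprn_ile1//; lra.
apply: le_trans (ler_norm_sum _ _ _) _.
apply: (le_trans (y := \sum_(k < N) (c k - c k.+1) * q ^+ k)).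
  apply: ler_sum => k _; rewrite normrM ler_pM// ?osc_le//.
  by rewrite ler0_norm; have := c_dec k; lra.
suff : \sum_(k < N) (c k - c k.+1) * q ^+ k <=
    c 0%N - c (minn N J) + q ^+ J * (c 0%N - c N).
  rewrite cN subr0; have := c_nd _ _ (geq_minr N J); lra.
elim: N {cN} => [|N ih].
  by rewrite big_ord0 min0n !subrr mulr0 addr0.
rewrite big_ord_recr/=; have := c_dec N => cc.
have [NJ|JN] := ltnP N J.
  move: ih; rewrite !(minn_idPl _) ?(ltnW NJ)// => ih.
  have h1 : (c N - c N.+1) * q ^+ N <= c N - c N.+1.
    by rewrite ler_piMr//; [lra|have := q1 N; lra].
  have h2 : q ^+ J * (c 0%N - c N) <= q ^+ J * (c 0%N - c N.+1).
    by rewrite ler_wpM2l//; [have := q1 J; lra|lra].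
  lra.
move: ih; rewrite !(minn_idPr _) ?(leqW JN)// => ih.
have h1 : (c N - c N.+1) * q ^+ N <= (c N - c N.+1) * q ^+ J.
  by rewrite ler_wpM2l//; [lra|rewrite ler_wiXn2l//; lra].
lra.
Qed.

End one_bump.

End oscillations.

(** * Damped weights *)

Section damping.
Variables (R : realType) (L : R).
Hypothesis L1 : 1 < L.
Implicit Types (t u v x y : R) (k : nat).

(* [t * damp k t] is Lipschitz in [t] uniformly in [k], although the slope of
   [damp k] is of order [L ^+ k]. *)
Definition damp k t : R := Num.max 0 (1 - (L ^+ k - 1) * t).

Let L_exp k : 0 <= L ^+ k - 1.
Proof. by rewrite subr_ge0 exprn_ege1// ltW. Qed.

Lemma damp0 t : damp 0 t = 1.
Proof. by rewrite /damp expr0 subrr mul0r subr0 max_r. Qed.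

Lemma damp_itv k t : 0 <= t -> 0 <= damp k t <= 1.
Proof.
move=> t0; rewrite le_max lexx ge_max ler01 /=.
by rewrite lerBlDr lerDl mulr_ge0.
Qed.

Lemma damp_dec k t : 0 <= t -> 0 <= damp k.+1 t <= damp k t.
Proof.
move=> t0; rewrite le_max lexx /= ge_max le_max lexx /= le_max; apply/orP; right.
rewrite lerB// ler_wpM2r// lerB// exprS ler_peMl ?ltW//.
by rewrite exprn_gt0// (lt_trans ltr01 L1).
Qed.

Lemma damp_eq0 t : 0 < t -> exists N, forall k, (N <= k)%N -> damp k t = 0.
Proof.
(* The inequality [1 <= t / (1 + t) * L ^+ N] is equivalent to [1 <= (L ^+ N - 1) * t]. *)
move=> t0; have w0 : 0 < t / (1 + t) by rewrite divr_gt0// addr_gt0.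
have [N hN] := expr_unbounded L1 w0; exists N => k Nk.
apply/max_l; have t1 : 0 < 1 + t by lra.
have h : 1 + t <= t * L ^+ N by move: hN; rewrite mulrAC ler_pdivlMr ?mul1r.
have Lk : L ^+ N <= L ^+ k by rewrite ler_weXn2l// ltW.
by have := ler_wpM2l (ltW t0) Lk; lra.
Qed.

Lemma damp_near1 k eps : 0 < eps -> exists2 h, 0 < h &
  forall t, 0 <= t <= h -> 1 - damp k t <= eps.
Proof.
move=> eps0; have Lk := L_exp k; have L2 : 0 < L ^+ k by lra.
exists (eps / L ^+ k); first by rewrite divr_gt0.
move=> t /andP[t0 th]; have : 1 - (L ^+ k - 1) * t <= damp k t.
  by rewrite le_max lexx orbT.
have : t * L ^+ k <= eps by rewrite -ler_pdivlMr.
lra.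
Qed.

(** With [m = L ^+ k - 1], the product [m t max 0 (1 - m t)] is at most 1, and so is
    [t * damp k t]. *)
Lemma damp_bound k t : 0 <= t <= 1 -> t * damp k t * L ^+ k <= 2.
Proof.
move=> t01; have := L_exp k; set m := L ^+ k - 1 => m0.
have -> : L ^+ k = m + 1 by rewrite /m; ring.
have t0 : 0 <= t by lra.
have [h0 h1] := andP (damp_itv k t0).
have a1 : t * damp k t <= 1.
  by rewrite -[leRHS]mulr1 ler_pM//; lra.
suff : m * t * damp k t <= 1 by lra.
have mt0 : 0 <= m * t by rewrite mulr_ge0.
have [mt|mt] := leP (m * t) 1.
  by rewrite -[leRHS]mulr1 ler_pM.
by rewrite /damp -/m max_l ?mulr0//; lra.
Qed.

(** The slope [L ^+ k - 1] of the weight is harmless: for [v <= u], either both weights vanish or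
    [(L ^+ k - 1) * |y| <= 1]. In use, [u] and [v] are norms of parameters and [x] and [y] are
    coordinates. *)
Lemma damp_lip k u v x y D : `|x| <= u -> `|y| <= v -> `|u - v| <= D ->
  `|x - y| <= D -> `|x * damp k u - y * damp k v| <= 2 * D.
Proof.
wlog vu : u v x y / v <= u.
  move=> wl xu yv uvD xyD; have [vu|/ltW uv] := leP v u; first exact: wl.
  by rewrite distrC; apply: (wl _ _ _ _ uv yv xu); rewrite distrC.
move=> xu yv uvD xyD; have m0 := L_exp k.
have u0 : 0 <= u by apply: le_trans xu.
have v0 : 0 <= v by apply: le_trans yv.
have D0 : 0 <= D by apply: le_trans xyD.
have [mv|mv] := leP 1 ((L ^+ k - 1) * v).
  have mu : 1 <= (L ^+ k - 1) * u by apply: le_trans (ler_wpM2l m0 vu).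
  by rewrite /damp !max_l ?mulr0 ?subrr ?normr0 ?mulr_ge0//; lra.
have -> : x * damp k u - y * damp k v =
    (x - y) * damp k u + y * (damp k u - damp k v) by ring.
apply: le_trans (ler_normD _ _) _; rewrite !normrM.
have h1 : `|x - y| * `|damp k u| <= D.
  rewrite -[leRHS]mulr1 ler_pM//.
  by have /andP[a0 a1] := damp_itv k u0; rewrite ger0_norm.
have h2 : `|damp k u - damp k v| <= (L ^+ k - 1) * D.
  have uv : (L ^+ k - 1) * (u - v) <= (L ^+ k - 1) * D.
    by rewrite ler_wpM2l// (le_trans (ler_norm _)).
  have : (L ^+ k - 1) * v <= (L ^+ k - 1) * u by rewrite ler_wpM2l.
  rewrite /damp; set mu := _ * u; set mv' := (L ^+ k - 1) * v => h.
  have E : mu - mv' <= (L ^+ k - 1) * D by rewrite /mu /mv' -mulrBr.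
  have mv1 : mv' < 1 by [].
  rewrite (max_r (y := 1 - mv')); last by rewrite subr_ge0 ltW.
  by rewrite ler_norml; case: (leP 0 (1 - mu)) => h'; lra.
have h3 : `|y| * `|damp k u - damp k v| <= D.
  apply: le_trans (ler_wpM2l (normr_ge0 _) h2) _.
  have : `|y| * (L ^+ k - 1) <= 1.
    by apply: le_trans (ltW mv); rewrite mulrC ler_wpM2l.
  by move=> /(ler_wpM2r D0); lra.
lra.
Qed.

End damping.

(** * Norms and null sets in the parameter space *)

Section vector_norms.
Variables (R : realType) (n : nat).
Implicit Types (a b : 'rV[R]_n).

Lemma coord_le_norm a i : `|a 0 i| <= `|a|.
Proof.
rewrite [leRHS]/Num.norm/= mx_normrE.
exact: (le_bigmax _ (fun ij : 'I_1 * 'I_n => `|a ij.1 ij.2|) (0, i)).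
Qed.

Lemma norm_le_enorm a : `|a| <= enorm a.
Proof.
have [->|a0] := eqVneq `|a| 0; first exact: sqrtr_ge0.
have [[i j] aij] := mx_norm_neq0 a0.
rewrite [leLHS]/Num.norm/= aij /= (ord1 i) -sqrtr_sqr ler_wsqrtr//.
by rewrite (bigD1 j)//= lerDl sumr_ge0// => k _; rewrite sqr_ge0.
Qed.

Lemma enorm_le_norm a : enorm a <= n%:R * `|a|.
Proof.
have na : 0 <= n%:R * `|a| by rewrite mulr_ge0.
rewrite -(ger0_norm na) -sqrtr_sqr ler_wsqrtr//.
apply: (le_trans (y := \sum_(i < n) `|a| ^+ 2)).
  apply: ler_sum => i _; rewrite -[leLHS]ger0_norm ?sqr_ge0// normrX.
  by rewrite lerXn2r ?nnegrE// coord_le_norm.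
rewrite sumr_const card_ord -[leLHS]mulr_natl exprMn ler_wpM2r ?sqr_ge0//.
case: n => [|k]; first by rewrite expr0n.
by rewrite expr2 ler_peMl ?ler0n// ler1n.
Qed.

(** Degenerate boxes have volume 0 in positive dimension; in dimension 0 the empty product is 1. *)
Lemma lebesgue_outer0 : (0 < n)%N -> lebesgue_outer (set0 : set 'rV[R]_n) = 0%E.
Proof.
move=> n0; apply/eqP; rewrite eq_le; apply/andP; split.
  apply: ereal_inf_lbound; exists (fun=> (0, 0)); first by split.
  apply: eseries0 => k _ _; rewrite /box_volume /=.
  rewrite (eq_bigr (fun=> 0)) => [|i _]; last by rewrite !mxE subrr.
  by rewrite prodr_const card_ord expr0n gtn_eqF.
apply: le_ereal_inf_tmp => _ [c [c_le _] <-]; apply: nneseries_ge0 => k _ _.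
by rewrite lee_fin; apply: prodr_ge0 => i _; rewrite subr_ge0.
Qed.

End vector_norms.

Lemma lipschitz_continuous (R : realType) (F : R -> R) (K : R) :
  (forall x y, `|F x - F y| <= K * `|x - y|) -> continuous F.
Proof.
move=> FK x; apply/cvgrPdist_lt => eps eps0.
have K0 : 0 <= K by have := FK 0 1; rewrite sub0r normrN normr1 mulr1; apply: le_trans.
have K1 : 0 < K + 1 by rewrite ltr_wpDl.
near=> y; apply: le_lt_trans (FK x y) _.
have : `|x - y| < eps / (K + 1).
  by near: y; apply: cvgr_dist_lt => //; rewrite divr_gt0.
rewrite ltr_pdivlMr// => h; have := normr_ge0 (x - y); lra.
Unshelve. all: by end_near. Qed.

Lemma balanced_bumpP (R : realType) (d n : nat) (i : 'I_n) : (1 < d)%N ->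
  balanced d (@balanced_bump R d n i).
Proof.
move=> d1; have n0 : (0 < n)%N by exact: leq_ltn_trans (ltn_ord i).
split=> [x|x|x|x y].
- exact: (balanced_bumpDd d1).
- exact: (balanced_bump_sum d1).
- exact: (balanced_bump_le1 d n0).
- exact: (balanced_bump_lip d1).
Qed.

(** * The perturbation of the distribution function *)

Section perturbation.
Variables (R : realType) (e L delta : R) (f g : R -> R) (d n : nat).
Hypotheses (es : is_sign e) (d_gt1 : (1 < d)%N) (L1 : 1 < L) (n_gt0 : (0 < n)%N).
Hypothesis delta0 : 0 < delta.
Hypothesis fD : forall x, f (x + 1) = f x + d%:R.
Hypothesis gK : cancel g f.
Hypothesis f_lip : forall x y, `|f x - f y| <= L * `|x - y|.
Implicit Types (a b : 'rV[R]_n) (x y s : R).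

Local Notation bump_sum i := (wsum e f d (@balanced_bump R d n i)).

Definition perturbation N a x : R :=
  delta * \sum_(i < n) a 0 i * bump_sum i (fun k => damp L k `|a|) N x.

Let bal i := @balanced_bumpP R d n i d_gt1.

Lemma perturbationD1 N a x : perturbation N a (x + 1) = perturbation N a x.
Proof.
congr (_ * _); apply: eq_bigr => i _; congr (_ * _).
exact: (wsumDz es d_gt1 fD (bal i) _ _ x 1).
Qed.

Lemma perturbation_widen N N' a x : (N <= N')%N ->
  (forall i k, (N <= k)%N -> a 0 i * damp L k `|a| = 0) ->
  perturbation N' a x = perturbation N a x.
Proof.
move=> NN' a0; congr (_ * _); apply: eq_bigr => i _.
have [->|ai0] := eqVneq (a 0 i) 0; first by rewrite !mul0r.
congr (_ * _); apply: wsum_widen => // k /(a0 i k)/eqP.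
by rewrite mulf_eq0 (negbTE ai0) => /eqP.
Qed.

(** For [a] nonzero the weights vanish eventually; for [a = 0] all weights are 1, but the
    coordinates vanish. With [0 < N] the first oscillation is always present. *)
Lemma perturbation_truncated a : exists2 N, (0 < N)%N &
  forall i k, (N <= k)%N -> a 0 i * damp L k `|a| = 0.
Proof.
have [->|a0] := eqVneq a 0; first by exists 1%N => // i k _; rewrite mxE mul0r.
have na : 0 < `|a| by rewrite normr_gt0.
have [N hN] := damp_eq0 L1 na.
by exists N.+1 => // i k Nk; rewrite hN ?mulr0// ltnW.
Qed.

Let wsumZ (i : 'I_n) (u : R) c N x :
  u * bump_sum i c N x = bump_sum i (fun k => u * c k) N x.
Proof. by rewrite /wsum mulr_sumr; apply: eq_bigr => k _; rewrite mulrA. Qed.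

Let norm_sum_le (F : 'I_n -> R) (D : R) : (forall i, `|F i| <= D) ->
  `|\sum_(i < n) F i| <= n%:R * D.
Proof.
move=> FD; apply: le_trans (ler_norm_sum _ _ _) _.
apply: le_trans (ler_sum _ (fun i _ => FD i)) _.
by rewrite sumr_const card_ord (mulr_natl D).
Qed.

Lemma perturbation_lip N a x y : `|a| <= 1 ->
  `|perturbation N a x - perturbation N a y| <= delta * n%:R * (8 * L * `|x - y|).
Proof.
move=> a1; rewrite /perturbation -mulrBr normrM gtr0_norm// -mulrA.
rewrite ler_wpM2l ?(ltW delta0)// -sumrB; apply: norm_sum_le => i; rewrite !wsumZ.
have := @wsum_lip R e L f d es d_gt1 L1 f_lip _ (bal i)
  (fun k => a 0 i * damp L k `|a|) N 2 x y (ler0n _ 2).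
rewrite (_ : 4 * L * 2 = 8 * L); last by ring.
apply=> k; have aa : 0 <= `|a| <= 1 by rewrite normr_ge0.
apply: le_trans (damp_bound L1 k aa).
have /andP[t0 _] := damp_itv L1 k (normr_ge0 a).
rewrite normrM (ger0_norm t0) ler_wpM2r ?exprn_ge0 ?ler_wpM2r ?coord_le_norm//.
by rewrite (ltW (lt_trans ltr01 L1)).
Qed.

Lemma perturbation_lip_param N a b x :
  `|perturbation N a x - perturbation N b x| <= delta * n%:R * (4 * `|a - b|).
Proof.
rewrite /perturbation -mulrBr normrM gtr0_norm// -mulrA.
rewrite ler_wpM2l ?(ltW delta0)// -sumrB; apply: norm_sum_le => i; rewrite !wsumZ wsumB.
rewrite (_ : 4 * _ = 2 * (2 * `|a - b|)); last by ring.
apply: (wsum_le f es d_gt1 (bal i)) => k.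
apply: damp_lip; [exact: L1|exact: coord_le_norm|exact: coord_le_norm| |].
  exact: ler_dist_dist.
by have := coord_le_norm (a - b) i; rewrite !mxE.
Qed.

Lemma transfer_perturbation_le N J a x :
  (forall i k, (N <= k)%N -> a 0 i * damp L k `|a| = 0) ->
  `|transfer e g d (perturbation N a) x - perturbation N a x| <=
    delta * n%:R * (`|a| * (1 - damp L J `|a| + d%:R^-1 ^+ J)).
Proof.
move=> a0; rewrite /perturbation transferZ transfer_sum -mulrBr normrM gtr0_norm//.
rewrite -mulrA ler_wpM2l ?(ltW delta0)// -sumrB; apply: norm_sum_le => i.
rewrite transferZ -mulrBr normrM.
have [ai0|ai0] := eqVneq (a 0 i) 0.
  rewrite ai0 normr0 mul0r mulr_ge0// addr_ge0 ?exprn_ge0 ?invr_ge0//.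
  by rewrite subr_ge0; have /andP[] := damp_itv L1 J (normr_ge0 a).
apply: ler_pM => //; first exact: coord_le_norm.
have cN : damp L N `|a| = 0.
  by have /eqP := a0 i N (leqnn N); rewrite mulf_eq0 (negbTE ai0) => /eqP.
have := transfer_wsum_le es d_gt1 fD gK (bal i) J x cN
  (fun k => damp_dec L1 k (normr_ge0 a)).
by rewrite damp0 mulr1.
Qed.

(** Between [g s] and [g (s + 1)] only the first, undamped oscillation changes, and near the centre
    of bump [i] it sees only the coordinate [i]. *)
Lemma perturbation_test N a i s : (0 < N)%N ->
  `|s - @bump_center R n i| <= @bump_radius R n / 2 ->
  perturbation N a (g s) - perturbation N a (g (s + 1)) =
  delta * (2 * bump d i s * a 0 i).
Proof.
case: N => // N _ si; rewrite /perturbation -mulrBr -sumrB; congr (_ * _).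
have E i' : a 0 i' * bump_sum i' (fun k => damp L k `|a|) N.+1 (g s) -
    a 0 i' * bump_sum i' (fun k => damp L k `|a|) N.+1 (g (s + 1)) =
    a 0 i' * (if i' == i then 2 * bump d i s else 0).
  rewrite -mulrBr; congr (_ * _).
  rewrite -(balanced_bump_diff d_gt1 n_gt0 i' si) /wsum -sumrB.
  rewrite big_ord_recl big1 ?addr0 => [|k _].
    by rewrite damp0 !mul1r !(osc0_g e d gK).
  by rewrite /= (oscS_g es d_gt1 fD gK (bal i')) subrr.
rewrite (eq_bigr _ (fun i' _ => E i')) (bigD1 i)//= eqxx big1 ?addr0; first ring.
by move=> i' /negbTE ->; rewrite mulr0.
Qed.

End perturbation.

(** * The perturbed measures *)

Section perturbed_measures.
Variable R : realType.
Variables (Phi : circle R -> circle R) (m : probability (circle R) R) (n : nat).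
Variables (e L c : R) (f g M : R -> R) (d : nat).
Hypotheses (n_gt0 : (0 < n)%N) (es : is_sign e) (d_gt1 : (1 < d)%N) (L1 : 1 < L).
Hypothesis c0 : 0 < c.
Hypothesis f_inc : {homo f : x y / x < y}.
Hypotheses (fK : cancel f g) (gK : cancel g f).
Hypothesis fD : forall x, f (x + 1) = f x + d%:R.
Hypothesis f_lip : forall x y, `|f x - f y| <= L * `|x - y|.
Hypothesis fPhi : forall x, circle_pi (e * f x) = Phi (circle_pi x).
Hypothesis mPhi : measurable_fun setT Phi.
Hypothesis m_inv : invariant_measure Phi m.
Hypothesis m_cdf : arc_cdf M m.
Hypothesis M_lower : forall x y, x <= y -> c * (y - x) <= M y - M x.
Implicit Types (a b : 'rV[R]_n) (x y s : R) (k N : nat).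

(* Small enough for [perturbation] to have slope at most [c / 2]. *)
Let delta : R := c / (16 * n%:R * L).

Let L0 : 0 < L. Proof. exact: lt_trans ltr01 L1. Qed.

Let n0 : 0 < n%:R :> R. Proof. by rewrite ltr0n. Qed.

Let delta0 : 0 < delta.
Proof. by rewrite divr_gt0// !mulr_gt0. Qed.

Let trunc a : nat := projT1 (cid2 (perturbation_truncated L1 a)).

Let trunc_gt0 a : (0 < trunc a)%N.
Proof. by rewrite /trunc; case: cid2. Qed.

Let truncP a i k : (trunc a <= k)%N -> a 0 i * damp L k `|a| = 0.
Proof. by rewrite /trunc; case: cid2 => N /= _; apply. Qed.

Let w a x := perturbation e L delta f d (trunc a) a x.

Let H a x := M x - w a x.

Let H_lower a x y : `|a| <= 1 -> x <= y -> c / 2 * (y - x) <= H a y - H a x.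
Proof.
move=> a1 xy; have := M_lower xy.
have := perturbation_lip es d_gt1 L1 delta0 f_lip (trunc a) y x a1.
rewrite -/(w a y) -/(w a x) (@ger0_norm _ (y - x)) ?subr_ge0// /delta.
have -> : c / (16 * n%:R * L) * n%:R * (8 * L * (y - x)) = c / 2 * (y - x).
  by field; rewrite !gt_eqF.
by move=> /(le_trans (ler_norm _)); rewrite /H; lra.
Qed.

Let H_inc a : `|a| <= 1 -> {homo H a : x y / x < y}.
Proof.
move=> a1 x y xy; rewrite -subr_gt0; apply: lt_le_trans (H_lower a1 (ltW xy)).
by rewrite mulr_gt0 ?subr_gt0// divr_gt0.
Qed.

Let H_D1 a x : H a (x + 1) = H a x + 1.
Proof. by rewrite /H /w (perturbationD1 L delta es d_gt1 fD) m_cdf.1; ring. Qed.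

Let H_continuous a : `|a| <= 1 -> continuous (H a).
Proof.
move=> a1 x; apply: continuousB; first exact: (arc_cdf_continuous m_cdf).
apply: (@lipschitz_continuous _ _ (delta * n%:R * (8 * L))) => y z.
have := perturbation_lip es d_gt1 L1 delta0 f_lip (trunc a) y z a1.
by rewrite -/(w a y) -/(w a z) !mulrA.
Qed.

Let H_measure a : exists P : probability (circle R) R,
  (a = 0 -> P = m) /\ (`|a| <= 1 -> arc_cdf (H a) P).
Proof.
have [->|a0] := eqVneq a 0.
  (* The condition [F 0 = m] is an equality of probabilities, so [m] itself is taken. *)
  exists m; split=> // _; rewrite (_ : H 0 = M)//.
  apply/funext => x; rewrite /H /w /perturbation big1 ?mulr0 ?subr0// => i _.
  by rewrite mxE mul0r.
(* Outside the unit ball of the sup norm, [m] is a default value. *)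
have [a1|a1] := leP `|a| 1; last first.
  by exists m; split=> // a00; rewrite a00 eqxx in a0.
have [G HG GH] := quasiperiodic_inverse (H_continuous a1) (H_inc a1) ltr01 (@H_D1 a).
have [P PE] := pushforward_probability (@circle_lebesgue R)
  (measurable_quantile (H_inc a1) GH).
exists P; split=> [a00|_]; first by rewrite a00 eqxx in a0.
by rewrite PE; apply: quantile_cdf => //; exact: H_inc.
Qed.

Let F a := projT1 (cid (H_measure a)).

Let F0 : F 0 = m.
Proof. by rewrite /F; case: cid => P /= [+ _]; apply. Qed.

Let F_cdf a : `|a| <= 1 -> arc_cdf (H a) (F a).
Proof. by rewrite /F; case: cid => P /= [_]. Qed.

(** The truncations of [a] and [b] may differ; both sums are extended to the larger one, which does
    not change them. *)
Let w_lip_param a b x : `|w a x - w b x| <= delta * n%:R * (4 * `|a - b|).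
Proof.
have := perturbation_lip_param f es d_gt1 L1 delta0 (maxn (trunc a) (trunc b)) a b x.
rewrite (perturbation_widen e delta f d x (leq_maxl _ _) (@truncP a)).
by rewrite (perturbation_widen e delta f d x (leq_maxr _ _) (@truncP b)).
Qed.

Let F_upper a b : `|a| <= 1 -> `|b| <= 1 ->
  wasserstein (F a) (F b) <= delta * n%:R * 4 / (c / 2) * `|a - b|.
Proof.
move=> a1 b1.
have -> : delta * n%:R * 4 / (c / 2) * `|a - b| =
  delta * n%:R * (4 * `|a - b|) / (c / 2) by ring.
apply: (wasserstein_cdf_le (k := 0) (F_cdf b1) (H_inc b1) (F_cdf a1) (H_inc a1)).
- by rewrite divr_gt0.
- by move=> x y; exact: H_lower.
move=> x; rewrite (_ : H a x - H b x - 0 = w b x - w a x); last by rewrite /H; ring.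
by rewrite distrC.
Qed.

Let f_nd x y : (f x <= f y) = (x <= y). Proof. exact: le_mono f_inc x y. Qed.

Let fDz x (k : int) : f (x + k%:~R) = f x + k%:~R * d%:R.
Proof. exact: quasiperiodicz. Qed.

(** Seen through [f], the arc is a ball modulo [d]: membership is a threshold on a Lipschitz
    function of [t]. *)
Let arc_threshold (u v t : R) : u <= v ->
  arc (g u) (g v) (circle_pi t) <->
  dist_multiples d (f t - (u + v) / 2) <= (v - u) / 2.
Proof.
move=> uv; rewrite arcP (dist_multiples_leP (ltnW d_gt1)).
by split=> -[k hk]; exists k; move: hk;
  rewrite -(f_nd (g _)) -(f_nd _ (g _)) !gK fDz; lra.
Qed.

Local Notation r := (bump_radius R n).
Local Notation p := (@bump_center R n).

(* The arcs [A j] are nested, so that [\sum_j \1_(A j)] is a discretized Lipschitz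
   function; as sets of end points they are the same as the arcs
   [arc (g (s j)) (g (1 + s j))], on which all oscillations but the first one have
   zero increment. *)
Let F_lower a b i : `|a| <= 1 -> `|b| <= 1 ->
  delta * r * `|a 0 i - b 0 i| / (L / r) <= wasserstein (F a) (F b).
Proof.
move=> a1 b1; have r0 := bump_radius_gt0 R n_gt0; have r2 := bump_radius_le R n_gt0.
have d2 : 2 <= d%:R :> R by rewrite ler_nat.
have g_inc := inverse_increasing gK f_inc.
apply: wasserstein_ge.
- by rewrite divr_gt0.
- by rewrite mulr_ge0// mulr_ge0// ltW.
- exact: (cdf_coupling (F_cdf a1) (H_inc a1) (F_cdf b1) (H_inc b1)).
move=> N N_gt0; have N0 : 0 < N%:R :> R by rewrite ltr0n.
pose s (j : 'I_N) : R := p i - r / 2 + r * (j%:R / N%:R).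
have s_itv j : `|s j - p i| <= r / 2.
  have j0 : 0 <= (j%:R : R) / N%:R by rewrite divr_ge0.
  have j1 : (j%:R : R) / N%:R <= 1 by rewrite ler_pdivrMr// mul1r ler_nat ltnW.
  have := ler_wpM2l (ltW r0) j1; have := mulr_ge0 (ltW r0) j0.
  by rewrite /s ler_norml; lra.
have s_diff j j' : `|s j - s j'| <= r.
  by have := s_itv j; have := s_itv j'; rewrite !ler_norml; lra.
(* Reversing the left end points gives all arcs the same centre in the coordinate [f t]. *)
pose A (j : 'I_N) := arc (g (s (rev_ord j))) (g (s j + 1)).
have A_itv j : g (s (rev_ord j)) <= g (s j + 1) < g (s (rev_ord j)) + 1.
  rewrite -(quasiperiodic_inverseD fK gK fD).
  have := s_diff (rev_ord j) j; rewrite ler_norml => hs.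
  by apply/andP; split; [apply/ltW/g_inc|apply: g_inc]; lra.
exists A.
  split=> [j|z z']; first exact: measurable_arc.
  (* Here [q] is the common centre, [h0] the smallest half-length, and [alpha] counts the excess of
     the distance over [h0] in steps of [r / N]. *)
  pose q := p i - r / 2 + r / 2 * ((N%:R - 1) / N%:R) + 2^-1.
  pose h0 := 2^-1 + r / 2 * ((1 - N%:R) / N%:R).
  pose alpha t := (dist_multiples d (f t - q) - h0) * (N%:R / r).
  have countE t : \sum_j \1_(A j) (circle_pi t) = count_ge N (alpha t).
    apply: eq_bigr => j _; rewrite indicE; congr (_ %:R); congr nat_of_bool.
    have jE : (rev_ord j)%:R = N%:R - 1 - j%:R :> R.
      by rewrite /= natrB// -natr1; ring.
    have qE : (s (rev_ord j) + (s j + 1)) / 2 = q.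
      by rewrite /s jE /q; field; rewrite gt_eqF.
    have hE : (s j + 1 - s (rev_ord j)) / 2 = h0 + j%:R * (r / N%:R).
      by rewrite /s jE /h0; field; rewrite gt_eqF.
    have uv : s (rev_ord j) <= s j + 1.
      by have := s_diff (rev_ord j) j; rewrite ler_norml; lra.
    have aE : (alpha t <= j%:R) = (dist_multiples d (f t - q) <= h0 + j%:R * (r / N%:R)).
      rewrite /alpha -ler_pdivlMr ?divr_gt0// invf_div lerBlDl.
      by [].
    rewrite aE; apply/idP/idP; rewrite inE.
      by move/(arc_threshold _ uv); rewrite qE hE.
    by move=> h; apply/(arc_threshold _ uv); rewrite qE hE.
  rewrite -(circle_sectionK z); set X := circle_section z.
  have [Y <- XY] := circle_dist_lift X z'.
  rewrite !countE XY; apply: le_trans (count_ge_lip _ _ _) _; rewrite lerD2r.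
  rewrite /alpha -mulrBl normrM (gtr0_norm (divr_gt0 N0 r0)).
  have -> : N%:R * (L / r) * `|X - Y| = L * `|X - Y| * (N%:R / r).
    by field; rewrite gt_eqF.
  rewrite ler_wpM2r ?(divr_ge0 (ltW N0) (ltW r0))//.
  have -> : dist_multiples d (f X - q) - h0 - (dist_multiples d (f Y - q) - h0) =
    dist_multiples d (f X - q) - dist_multiples d (f Y - q) by ring.
  apply: le_trans (dist_multiples_lip (ltnW d_gt1) _ _) _.
  by rewrite (_ : _ - _ = f X - f Y) ?f_lip//; ring.
have FA c' (c1 : `|c'| <= 1) j :
    fine (F c' (A j)) = H c' (g (s j + 1)) - H c' (g (s (rev_ord j))).
  by rewrite (F_cdf c1).2.
have test c' j : w c' (g (s j)) - w c' (g (s j + 1)) =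
    delta * (2 * bump d i (s j) * c' 0 i).
  exact: (perturbation_test L delta es d_gt1 n_gt0 fD gK).
have -> : \sum_j (fine (F a (A j)) - fine (F b (A j))) =
    delta * (a 0 i - b 0 i) * \sum_j 2 * bump d i (s j).
  under eq_bigr do rewrite !FA//.
  pose D x := H a x - H b x.
  transitivity (\sum_j (D (g (s j + 1)) - D (g (s (rev_ord j))))).
    by apply: eq_bigr => j _; rewrite /D; ring.
  (* Under the sum the reversal is undone, so that [g (s j + 1)] is compared with [g (s j)]. *)
  rewrite sumrB -(reindex_inj rev_ord_inj (P := xpredT) (F := fun j => D (g (s j)))).
  rewrite -sumrB mulr_sumr; apply: eq_bigr => j _.
  by have := test a j; have := test b j; rewrite /D /H; lra.
rewrite normrM (normrM delta) (gtr0_norm delta0).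
have sum_ge : N%:R * r <= `|\sum_j 2 * bump d i (s j)|.
  apply: le_trans (ler_norm _).
  rewrite mulr_natl -[N in X in X <= _]card_ord -sumr_const.
  by apply: ler_sum => j _; have := bump_ge d_gt1 (s_itv j); lra.
have := ler_wpM2l (mulr_ge0 (ltW delta0) (normr_ge0 (a 0 i - b 0 i))) sum_ge.
lra.
Qed.

(** By invariance both functions are distribution functions of [m], hence equal up to a constant. *)
Let M_transfer : exists t, forall x, transfer e g d M x = M x + t.
Proof.
have TM := transfer_cdf es (ltnW d_gt1) f_inc fK gK fD fPhi m_cdf.
have TM' : arc_cdf (transfer e g d M) m.
  split=> [|x y xy]; first exact: TM.1.
  by rewrite -TM.2// m_inv//; exact: measurable_arc.
exact: arc_cdf_eq TM' m_cdf.
Qed.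

(** One more push multiplies the error by at most [d] and adds one defect, and [d * (d + 1) ^+ k +
    (d + 1) ^+ k = (d + 1) ^+ k.+1]. Additive constants stay constant under the operator. *)
Let iter_push a k J : `|a| <= 1 -> exists P : probability (circle R) R,
  (P : set (circle R) -> \bar R) = iter k (fun mu => pushforward mu Phi) (F a) /\
  exists K, [/\ arc_cdf K P, {homo K : x y / x < y} &
    exists t, forall x, `|K x - H a x - t| <= (d%:R + 1) ^+ k *
      (delta * n%:R * (`|a| * (1 - damp L J `|a| + d%:R^-1 ^+ J)))].
Proof.
move=> a1; set eta := delta * n%:R * _.
have eta0 : 0 <= eta.
  have h0 : 0 <= 1 - damp L J `|a| + d%:R^-1 ^+ J.
    rewrite addr_ge0 ?exprn_ge0 ?invr_ge0// subr_ge0.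
    by have /andP[] := damp_itv L1 J (normr_ge0 a).
  by rewrite mulr_ge0// mulr_ge0// ltW.
elim: k => [|k [P [PE [K [PK K_inc [t Kt]]]]]].
  exists (F a); split=> //; exists (H a); split; [exact: F_cdf|exact: H_inc|].
  by exists 0 => x; rewrite subrr subr0 normr0 mulr_ge0// exprn_ge0// addr_ge0.
have [Q QE] := pushforward_probability P mPhi.
exists Q; split; first by rewrite iterS -PE.
exists (transfer e g d K); split.
- rewrite QE; exact: (transfer_cdf es (ltnW d_gt1) f_inc fK gK fD fPhi PK).
- exact: transfer_increasing es (ltnW d_gt1) (inverse_increasing gK f_inc) K_inc.
have [u Mu] := M_transfer.
exists (u + e * d%:R * t) => x.
have Tt : transfer e g d (fun x => K x - H a x - t) x =
    transfer e g d K x - (M x + u - transfer e g d (w a) x) - e * d%:R * t.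
  by rewrite !transferB transfer_cst Mu.
have -> : transfer e g d K x - H a x - (u + e * d%:R * t) =
    transfer e g d (fun x => K x - H a x - t) x -
    (transfer e g d (w a) x - w a x) by rewrite Tt /H; ring.
apply: le_trans (ler_normB _ _) _.
have h1 := transfer_le g d es Kt x.
have h2 : `|transfer e g d (w a) x - w a x| <= eta.
  by apply: transfer_perturbation_le => // i j; exact: truncP.
apply: le_trans (lerD h1 h2) _; rewrite exprS.
have : eta <= (d%:R + 1) ^+ k * eta by rewrite ler_peMl// exprn_ege1// lerDr.
lra.
Qed.

Let F_iterates (eps : R) (K : nat) : 0 < eps -> exists2 rad : R, 0 < rad &
  forall k a, (k <= K)%N -> `|a| <= 1 -> `|a| <= rad ->
    wasserstein (iter k (fun mu => pushforward mu Phi) (F a)) (F a) <= eps * `|a|.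
Proof.
move=> eps0; pose Z := (d%:R + 1) ^+ K * (delta * n%:R) / (c / 2).
have d1 : 0 < d%:R + 1 :> R by rewrite ltr_wpDl.
have dK : 0 < (d%:R + 1 : R) ^+ K by rewrite exprn_gt0.
have Z0 : 0 < Z.
  by apply: divr_gt0; [apply: mulr_gt0; [exact: dK|exact: mulr_gt0]|exact: divr_gt0].
pose eps' := eps / (2 * Z); have eps'0 : 0 < eps' by rewrite divr_gt0// mulr_gt0.
have d1' : 1 < d%:R :> R by rewrite ltr1n.
(* The index [J] is fixed before [a]: it makes the geometric tail at most [eps'], and then [rad]
   makes the loss of damping at [J] at most [eps']. *)
have [J hJ] := expr_unbounded d1' eps'0.
have {}hJ : d%:R^-1 ^+ J <= eps'.
  by rewrite exprVn -[leLHS]mul1r ler_pdivrMr// exprn_gt0// (lt_trans ltr01 d1').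
have [rad rad0 hrad] := damp_near1 L1 J eps'0.
exists rad => // k a kK a1 ar.
have [P [<- [U [PU U_inc [t Ut]]]]] := iter_push k J a1.
have aa : 0 <= `|a| <= rad by rewrite normr_ge0.
have c2 : 0 < c / 2 by rewrite divr_gt0.
have Hl x y : x <= y -> c / 2 * (y - x) <= H a y - H a x by exact: H_lower.
apply: le_trans (wasserstein_cdf_le (F_cdf a1) (H_inc a1) PU U_inc c2 Hl Ut) _.
have damp2 : 1 - damp L J `|a| + d%:R^-1 ^+ J <= 2 * eps'.
  by have := hrad _ aa; lra.
have E : Z * (2 * eps') = eps by rewrite /eps'; field; rewrite gt_eqF.
rewrite -E.
have -> : (d%:R + 1) ^+ k *
    (delta * n%:R * (`|a| * (1 - damp L J `|a| + d%:R^-1 ^+ J))) / (c / 2) =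
  (d%:R + 1) ^+ k * (delta * n%:R / (c / 2) * `|a| *
    (1 - damp L J `|a| + d%:R^-1 ^+ J)) by ring.
have -> : Z * (2 * eps') * `|a| = (d%:R + 1) ^+ K * (delta * n%:R / (c / 2) * `|a| *
    (2 * eps')) by rewrite /Z; ring.
have B0 : 0 <= delta * n%:R / (c / 2) * `|a|.
  by apply: mulr_ge0 => //; apply/ltW/divr_gt0; first exact: mulr_gt0.
apply: ler_pM.
- by rewrite exprn_ge0// ltW.
- rewrite mulr_ge0// addr_ge0 ?exprn_ge0 ?invr_ge0// subr_ge0.
  by have /andP[] := damp_itv L1 J (normr_ge0 a).
- by rewrite ler_weXn2l// lerDr.
- by rewrite ler_wpM2l.
Qed.

Lemma perturbed_measures : exists F : 'rV[R]_n -> probability (circle R) R,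
  [/\ bilipschitz_on (eball 1) F,
      F 0 = m,
      (fun a => wasserstein (pushforward (F a) Phi) (F a))
        =o_ (0 : 'rV[R]_n) (fun a => enorm a),
      forall (eps : R) (K : nat), 0 < eps ->
        exists2 r : R, 0 < r &
          forall (k : nat) (a : 'rV[R]_n), (k <= K)%N ->
            (eball 1 `&` eball r) a ->
            wasserstein (iter k (fun mu => pushforward mu Phi) (F a)) (F a)
              <= eps * enorm a &
      ae_on (eball 1) (fun a => atomless (F a))].
Proof.
have ball1 a : eball 1 a -> `|a| <= 1 by apply: le_trans (norm_le_enorm a).
exists F; split.
- pose c1 := delta * r / (L / r) / n%:R; pose c2 := delta * n%:R * 4 / (c / 2).
  have r0 := bump_radius_gt0 R n_gt0.
  have c10 : 0 < c1.
    apply: divr_gt0 => //; apply: divr_gt0; first exact: mulr_gt0.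
    exact: divr_gt0.
  have c20 : 0 < c2.
    by apply: divr_gt0; [apply: mulr_gt0 => //; exact: mulr_gt0|exact: divr_gt0].
  have C0 : 0 < c1^-1 + c2 by rewrite addr_gt0 ?invr_gt0.
  exists (c1^-1 + c2) => // a b /ball1 a1 /ball1 b1; apply/andP; split.
    apply: (le_trans (y := c1 * enorm (a - b))).
      rewrite ler_wpM2r ?sqrtr_ge0// -[leRHS]invrK lef_pV2 ?posrE ?invr_gt0//.
      by rewrite lerDl ltW.
    apply: (le_trans (y := c1 * (n%:R * `|a - b|))).
      by rewrite ler_wpM2l ?enorm_le_norm// ltW.
    have -> : c1 * (n%:R * `|a - b|) = delta * r / (L / r) * `|a - b|.
      by rewrite /c1; field; rewrite !gt_eqF.
    have [ab0|ab0] := eqVneq `|a - b| 0; first by rewrite ab0 mulr0 sqrtr_ge0.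
    (* The measures are tested in a coordinate that attains the sup norm of [a - b]; the factor
       [1 / n] in [c1] pays for the passage to the Euclidean norm. *)
    have [[i0 i] abi] := mx_norm_neq0 ab0.
    rewrite [X in _ * X]/Num.norm/= abi /= (ord1 i0) !mxE.
    by rewrite mulrAC; exact: F_lower.
  apply: le_trans (F_upper a1 b1) _; apply: ler_pM => //.
  - by rewrite ltW.
  - by rewrite lerDr invr_ge0 ltW.
  - exact: norm_le_enorm.
- exact: F0.
- apply/eqoP => eps eps0; have [rad rad0 hrad] := F_iterates 1 eps0.
  have small : \forall a \near (0 : 'rV[R]_n), `|a| < Num.min 1 rad.
    by apply: nbhs0_lt; rewrite lt_min ltr01.
  near=> a; have a_small : `|a| < Num.min 1 rad.
    by near: a; exact: small.
  move: a_small; rewrite lt_min => /andP[/ltW a1 /ltW ar].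
  rewrite ger0_norm ?sqrtr_ge0// (ger0_norm (sqrtr_ge0 _)).
  apply: le_trans (hrad 1%N a (leqnn _) a1 ar) _.
  by rewrite ler_wpM2l ?norm_le_enorm// ltW.
- move=> eps K eps0; have [rad rad0 hrad] := F_iterates K eps0.
  exists rad => // k a kK [/ball1 a1 ar].
  have ar' : `|a| <= rad by apply: le_trans (norm_le_enorm a) _.
  apply: le_trans (hrad k a kK a1 ar') _.
  by rewrite ler_wpM2l ?norm_le_enorm// ltW.
(* The exceptional set is empty: on the ball every [F a] has a distribution function. *)
rewrite /ae_on (_ : _ `&` _ = set0) ?lebesgue_outer0//.
apply/seteqP; split=> // a [/ball1 a1]; apply.
exact: arc_cdf_atomless (F_cdf a1).
Unshelve. all: by end_near. Qed.

End perturbed_measures.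

Theorem proposition1p5 (R : realType) :
  (forall (mu : probability (circle R) R) (v : circle R -> R),
     atomless mu -> v \in Lfun mu 2%:E ->
     countable [set t : R | 0 <= t <= 1 /\
                            ~ atomless (pushforward mu (id_plus v t))])
  /\
  (forall (Phi : circle R -> circle R) (rho : circle R -> R)
          (m : probability (circle R) R) (n : nat),
     C2_expanding Phi -> has_density rho m -> invariant_measure Phi m -> (0 < n)%N ->
     exists F : 'rV[R]_n -> probability (circle R) R,
       [/\ bilipschitz_on (eball 1) F,
           F 0 = m,
           (fun a => wasserstein (pushforward (F a) Phi) (F a))
             =o_ (0 : 'rV[R]_n) (fun a => enorm a),
           forall (eps : R) (K : nat), 0 < eps ->
             exists2 r : R, 0 < r &
               forall (k : nat) (a : 'rV[R]_n), (k <= K)%N ->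
                 (eball 1 `&` eball r) a ->
                 wasserstein (iter k (fun mu => pushforward mu Phi) (F a)) (F a)
                   <= eps * enorm a &
           ae_on (eball 1) (fun a => atomless (F a))]).
Proof.
split=> [mu v mu0 /sub_Lfun_mfun mv|Phi rho m n Phi_exp m_rho m_inv n_gt0].
  apply: sub_countable (countable_atoms mu0 (set_mem mv)).
  by apply: subset_card_le => t [].
have [e [f [d [l [L [B [[es d_gt1 l1 cf] [B0 fPhi fD f_up f_bd]]]]]]]] :=
  C2_expanding_lift Phi_exp.
have l0 : 0 < l by exact: lt_trans l1.
have f_inc : {homo f : x y / x < y}.
  move=> x y xy; rewrite -subr_gt0; apply: lt_le_trans (f_bd.1 _ _ (ltW xy)).
  by rewrite mulr_gt0 ?subr_gt0.
have L1 : 1 < L.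
  have := f_up 0 1 ler01; have := f_bd.1 0 1 ler01; rewrite subr0 !mulr1.
  by move=> h1 h2; exact: lt_le_trans l1 (le_trans h1 h2).
have f_lip x y : `|f x - f y| <= L * `|x - y|.
  wlog xy : x y / x <= y.
    move=> wl; have [|/ltW] := leP x y; first exact: wl.
    by rewrite distrC (distrC x); exact: wl.
  rewrite distrC (distrC x) ger0_norm ?ger0_norm ?subr_ge0 ?f_up//.
  by rewrite (le_mono f_inc).
have d0 : 0 < d%:R :> R by rewrite ltr0n ltnW.
have [g fK gK] := quasiperiodic_inverse cf f_inc d0 fD.
have m0 : atomless m.
  move=> z; have [_ _ ->] := m_rho; last exact: measurable_circle1.
  apply: null_set_integral; last exact: (arc_cdf_atomless (@circle_lebesgue_cdf R)).
  - exact: measurable_circle1.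
  - by apply/measurable_EFinP; apply: measurable_funS (let: And3 mr _ _ := m_rho in mr).
have [M m_cdf] := atomless_arc_cdf_ex m0.
have [c c0 M_lower] := invariant_cdf_lower es d_gt1 l1 B0 cf fPhi fD fK gK f_bd
  m_rho m_inv m_cdf.
have mPhi := lift_measurable cf fPhi.
exact: (perturbed_measures n_gt0 es d_gt1 L1 c0 f_inc fK gK fD f_lip fPhi mPhi
  m_inv m_cdf M_lower).
Qed.
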